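(* Let $H_n^-=\sum_{k=1}^n\frac{(-1)^{k-1}}{k}$ and, for $\operatorname{Re}s>0$, $$v(s)=\sum_{n=1}^\infty\frac{(-1)^{n-1}}{n^s}H_n^- .$$ For $\operatorname{Re} s>0$ and every positive integer $q>1+|\operatorname{Re}s|$, $$2v(s)=\zeta(s+1)-\sum_{m=0}^{q-1}\frac{s(s+1)(s+2)\cdots(s+2m)}{(2m+1)!}E_{2m+1}(0)\,\zeta(s+2m+2)+\frac{s(s+1)\cdots(s+2q-1)}{(2q-1)!}\int_0^\infty \bar E_{2q-1}(-t)\,\phi^+(s+2q,t)\,dt,$$ where $\phi^+(s,t)=\sum_{n=1}^\infty\frac{1}{n(n+t)^s}$; the right-hand side provides the continuation of $v$. Consequently $v$ admits an extension to the closed left half-plane $\operatorname{Re}s\le0$ which is holomorphic except for simple poles at $s=0,-1,-3,-5,\dots$, with residues $$\operatorname{Res}_{s=0}v=\frac12,\qquad \operatorname{Res}_{s=-2n-1}v=\frac12E_{2n+1}(0)\quad(n=0,1,2,\dots).$$ Moreover, for $n=1,2,\dots$, $$2v(-2n)=\zeta(1-2n)-nE_{2n-1}(0).$$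
   Context: $\zeta$ is the Riemann zeta function (meromorphically continued). The Euler polynomials $E_n(x)$ are defined by $\frac{2e^{xt}}{e^t+1}=\sum_{n\ge0}E_n(x)\frac{t^n}{n!}$ ($|t|<\pi$). For $q\ge0$, $\bar E_q$ is the function on $\mathbb{R}$ with $\bar E_q(x)=E_q(x)$ for $0\le x<1$ and $\bar E_q(x+1)=-\bar E_q(x)$ for all $x$ (so it is periodic of period 2). *)

(* Defs.v *)
From Stdlib Require Import Arith Reals Lra ClassicalEpsilon.
From Coquelicot Require Import Coquelicot.

Local Open Scope R_scope.

Definition Cexp (z : C) : C :=
  (exp (Re z) * cos (Im z), exp (Re z) * sin (Im z)).

(* x ^ s for real x > 0 and complex s, with the real logarithm of x *)
Definition Rcpow (x : R) (s : C) : C := Cexp (s * RtoC (ln x))%C.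

(* The sum of the series a 0 + a 1 + ...; meaningful only if it converges. *)
Definition Cseries (a : nat -> C) : C :=
  iota (is_series (V := C_CompleteNormedModule) a).

Definition ex_Cseries (a : nat -> C) : Prop :=
  ex_series (V := C_NormedModule) a.

(* Complex differentiability at every point of U. It is holomorphy
   when U is open. *)
Definition holomorphic_on (U : C -> Prop) (f : C -> C) : Prop :=
  forall z, U z -> ex_derive (K := C_AbsRing) (V := C_NormedModule) f z.

(* The principal part of f at a is r / (z - a) with r <> 0. The value f a
   is irrelevant. *)
Definition simple_pole_res (f : C -> C) (a r : C) : Prop :=
  r <> RtoC 0 /\
  exists h : C -> C,
    locally a (fun z => ex_derive (K := C_AbsRing) (V := C_NormedModule) h z) /\
    locally' a (fun z => f z = (r / (z - a) + h z)%C).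

(* f is the analytic continuation to C \ {1} of the sum of n ^ (-s), n >= 1. *)
Definition is_riemann_zeta (f : C -> C) : Prop :=
  holomorphic_on (fun s => s <> RtoC 1) f /\
  forall s : C, 1 < Re s ->
    is_series (V := C_NormedModule)
      (fun k : nat => (/ Rcpow (INR (S k)) s)%C) (f s).

(* By the identity theorem is_riemann_zeta determines the values off s = 1;
   the value at the pole s = 1 is arbitrary. *)
Definition zeta : C -> C :=
  epsilon (inhabits (fun _ : C => RtoC 0)) is_riemann_zeta.

Definition is_euler_poly (E : nat -> R -> R) : Prop :=
  forall x t : R, Rabs t < PI ->
    is_series (fun n : nat => E n x * t ^ n / INR (fact n))
      (2 * exp (x * t) / (exp t + 1)).

(* Uniqueness of power series expansions makes E_n(x) the only solution. *)
Definition euler_poly : nat -> R -> R :=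
  epsilon (inhabits (fun (_ : nat) (_ : R) => 0)) is_euler_poly.

Definition euler_bar (q : nat) (x : R) : R :=
  powerRZ (-1) (Int_part x) * euler_poly q (frac_part x).

Lemma euler_bar_unit (q : nat) (x : R) :
  0 <= x < 1 -> euler_bar q x = euler_poly q x.
Proof.
intros Hx; unfold euler_bar, frac_part.
rewrite <- (Int_part_spec x 0) by (simpl; lra).
simpl; rewrite Rminus_0_r; ring.
Qed.

Lemma euler_bar_shift (q : nat) (x : R) :
  euler_bar q (x + 1) = - euler_bar q x.
Proof.
unfold euler_bar, frac_part.
assert (H : Int_part (x + 1) = (Int_part x + 1)%Z).
{ symmetry; apply Int_part_spec; rewrite plus_IZR.
  generalize (base_Int_part x); lra. }
rewrite H, plus_IZR, powerRZ_add by lra.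
replace (x + 1 - (IZR (Int_part x) + 1)) with (x - IZR (Int_part x)) by ring.
simpl; ring.
Qed.

(* s (s + 1) ... (s + n - 1), with n factors *)
Fixpoint rising (s : C) (n : nat) : C :=
  match n with
  | O => RtoC 1
  | S m => (rising s m * (s + RtoC (INR m)))%C
  end.

Definition Hminus (n : nat) : R :=
  sum_n_m (fun k : nat => (-1) ^ (k - 1) / INR k) 1 n.

Definition v_term (s : C) (n : nat) : C :=
  (RtoC ((-1) ^ (n - 1)) / Rcpow (INR n) s * RtoC (Hminus n))%C.

Definition v (s : C) : C := Cseries (fun k : nat => v_term s (S k)).

Definition phi_plus_term (s : C) (t : R) (n : nat) : C :=
  (/ (RtoC (INR n) * Rcpow (INR n + t) s))%C.

Definition phi_plus (s : C) (t : R) : C :=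
  Cseries (fun k : nat => phi_plus_term s t (S k)).

Definition remainder_integrand (q : nat) (s : C) (t : R) : C :=
  (RtoC (euler_bar (2 * q - 1) (- t)) *
   phi_plus (s + RtoC (INR (2 * q))) t)%C.

(* All the series phi_plus (s + 2q) t, t >= 0, and the improper integral
   of remainder_integrand over [0, +oo) converge. *)
Definition remainder_converges (q : nat) (s : C) : Prop :=
  (forall t : R, 0 <= t ->
     ex_Cseries (fun k : nat =>
       phi_plus_term (s + RtoC (INR (2 * q)))%C t (S k))) /\
  ex_RInt_gen (V := C_R_NormedModule) (remainder_integrand q s)
    (at_point 0) (Rbar_locally p_infty).

Definition remainder_integral (q : nat) (s : C) : C :=
  RInt_gen (V := C_R_CompleteNormedModule) (remainder_integrand q s)
    (at_point 0) (Rbar_locally p_infty).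

(* For q >= 1; sum_n _ (q - 1) has the q terms m = 0, ..., q - 1. *)
Definition continuation_rhs (q : nat) (s : C) : C :=
  (zeta (s + RtoC 1)
   - sum_n (G := C_AbelianMonoid) (fun m : nat =>
       rising s (2 * m + 1) / RtoC (INR (fact (2 * m + 1)))
       * RtoC (euler_poly (2 * m + 1) 0)
       * zeta (s + RtoC (INR (2 * m + 2)))) (q - 1)
   + rising s (2 * q) / RtoC (INR (fact (2 * q - 1)))
     * remainder_integral q s)%C.

Definition v_pole (s : C) : Prop :=
  s = RtoC 0 \/ exists n : nat, s = RtoC (- INR (2 * n + 1)).

(* Main.v *)
Require Import Defs.
From Stdlib Require Import Arith Reals Lra Lia ClassicalEpsilon.
From Coquelicot Require Import Coquelicot.
Local Open Scope R_scope.

(* For f(x) = x^(-s), the derivative of sum_(j <= p) (-1)^j E_j(t)/j! f^(j)(n + t) in t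
   telescopes. Hence Boole's expression B(s,n), the finite part of the expansion of
   sum_j (-1)^j (n + j)^(-s) plus a remainder integral, satisfies B(s,n) + B(s,n+1) = n^(-s).
   A sequence with D(n) + D(n+1) = 0 that tends to 0 vanishes, so B(s,n) does not depend on
   the order q of the expansion. Summation by parts turns the partial sums of v(s) into those
   of sum_n B(s,n)/n, up to a term B(s,N+1) H_N^- that tends to 0, and summing the
   expansion of B(s,n)/n over n gives the right-hand side; its remainder is holomorphic
   because the error of first-order expansion in s is quadratic with summable constants.
   The zeta function is continued by Euler-Maclaurin summation and repeated integration by
   parts. Uniqueness of the continuation is reduced by s = 1 + e^w to entire functions that
   vanish on the real axis; Goursat's theorem against a narrow Gaussian makes them vanish.
   The values at 0, -2, -4, ... come from (1 - 2^(1-s)) zeta(s) = B(s,1).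
   The generating series of E_n(x) converges for |t| < pi because the partial sums of the
   tangent series satisfy S' <= 1 + S^2, hence S <= tan. *)

(** * Limits and derivatives of complex functions *)

(** The formula with a given q is available only where Re s + 2q is large, so [V] is assembled from
    values with q depending on s; independence of q makes the pieces agree on overlaps, and openness
    of the domains makes the result differentiable. The bound q > 1 + |Re s| gives Re s + 2q > 3:
    exponent 2 makes the double series of remainders converge, and the third unit pays for
    exchanging the sum over n with the improper integral. The functions [zeta] and [euler_poly] are
    picked by [epsilon], so a solution must be constructed before anything is known of them. For
    [zeta] uniqueness is needed as well, because its pole at 1 is read off from one concrete
    continuation. The poles of v are those of zeta(s + 1) and of zeta(s + 2m + 2). At s = -(2m+1)
    the rising factorial is -(2m+1)!, which cancels the denominator, and the residue is nonzero
    because the odd Taylor coefficients of tan are positive. *)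

Definition near (a : C) (P : C -> Prop) : Prop :=
  exists d, 0 < d /\ forall w, Cmod (w - a) < d -> P w.

(** Limits are measured by [Cmod] instead of the product structure of C, so every estimate is one
    inequality between moduli; [filterlim_Ctends] translates back. *)
Definition Ctends {T : Type} (F : (T -> Prop) -> Prop) (f : T -> C) (l : C) : Prop :=
  forall eps, 0 < eps -> F (fun x => Cmod (f x - l) < eps).

Notation Clim := (Ctends eventually).
Definition Ccont (f : C -> C) (z : C) : Prop := Ctends (near z) f (f z).

(* Caratheodory's form of complex differentiability *)
Definition Cdiff (f : C -> C) (z : C) : Prop :=
  exists q, Ccont q z /\ near z (fun w => f w = (f z + (w - z) * q w)%C).

Instance near_filter (a : C) : Filter (near a).
Proof.
split.
- exists 1; split; [lra|auto].
- intros P Q [d [Hd HP]] [e [He HQ]]; exists (Rmin d e); split; [apply Rmin_case; assumption|].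
  intros w Hw; split; [apply HP|apply HQ]; eapply Rlt_le_trans; try exact Hw;
    [apply Rmin_l|apply Rmin_r].
- intros P Q H [d [Hd HP]]; exists d; split; auto.
Qed.

Lemma Cmod_le_Re_Im (z : C) : Cmod z <= Rabs (Re z) + Rabs (Im z).
Proof.
replace z with (RtoC (Re z) + RtoC (Im z) * Ci)%C at 1
  by (destruct z; unfold Re, Im, RtoC, Ci, Cplus, Cmult; simpl; f_equal; ring).
eapply Rle_trans; [apply Cmod_triangle|].
rewrite Cmod_mult, Cmod_Ci, !Cmod_R; lra.
Qed.

Lemma im_le_Cmod (z : C) : Rabs (Im z) <= Cmod z.
Proof.
eapply Rle_trans; [|apply Rmax_Cmod]; apply Rmax_r.
Qed.

Lemma Ceq (a b : C) : Re a = Re b -> Im a = Im b -> a = b.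
Proof. destruct a, b; simpl; intros; subst; reflexivity. Qed.

Lemma Cmod_minus_sym (a b : C) : Cmod (a - b) = Cmod (b - a).
Proof. rewrite <- (Cmod_opp (b - a)); f_equal; ring. Qed.

Lemma Cmod_triangle_rev (a b : C) : Cmod a <= Cmod b + Cmod (a - b).
Proof.
replace a with (b + (a - b))%C at 1 by ring; apply Cmod_triangle.
Qed.

Lemma Cmod_sub_triangle (a b c : C) : Cmod (a - c) <= Cmod (a - b) + Cmod (b - c).
Proof. replace (a - c)%C with ((a - b) + (b - c))%C by ring; apply Cmod_triangle. Qed.

Lemma Cmod_small_0 (z : C) : (forall eps, 0 < eps -> Cmod z <= eps) -> z = RtoC 0.
Proof.
intros H; apply Cmod_eq_0, Rle_antisym; [|apply Cmod_ge_0].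
apply Rnot_lt_le; intros Hz; specialize (H (Cmod z / 2)); lra.
Qed.

Lemma norm_C_R (z : C) : norm (V := C_R_NormedModule) z = Cmod z.
Proof. symmetry; apply Cmod_norm. Qed.

Lemma ball_C_Cmod (x y : C) (e : R) :
  Cmod (y - x) < e -> ball (M := C_UniformSpace) x e y.
Proof.
intros H; split.
- change (Rabs (Re (y - x)) < e); eapply Rle_lt_trans; [apply re_le_Cmod|exact H].
- change (Rabs (Im (y - x)) < e); eapply Rle_lt_trans; [apply im_le_Cmod|exact H].
Qed.

Lemma Cmod_ball_C (x y : C) (e : R) :
  ball (M := C_UniformSpace) x e y -> Cmod (y - x) < 2 * e.
Proof.
intros [H1 H2]; eapply Rle_lt_trans; [apply Cmod_le_Re_Im|].
change (Rabs (Re (y - x)) < e) in H1; change (Rabs (Im (y - x)) < e) in H2; lra.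
Qed.

Lemma locally_C_Cmod (z : C) (P : C -> Prop) :
  (exists d, 0 < d /\ forall w, Cmod (w - z) < d -> P w) <->
  locally (T := C_UniformSpace) z P.
Proof.
split.
- intros [d [Hd H]]; assert (Hd2 : 0 < d / 2) by lra.
  exists (mkposreal _ Hd2); intros w Hw; apply H.
  apply Cmod_ball_C in Hw; simpl in Hw; lra.
- intros [e H]; exists e; split; [apply cond_pos|].
  intros w Hw; apply H, ball_C_Cmod, Hw.
Qed.

Lemma filterlim_Ctends {T : Type} (F : (T -> Prop) -> Prop) {FF : Filter F}
  (f : T -> C) (l : C) :
  filterlim f F (locally (T := C_UniformSpace) l) <-> Ctends F f l.
Proof.
split.
- intros H eps He; apply (H (fun w => Cmod (w - l) < eps)), locally_C_Cmod.
  exists eps; auto.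
- intros H P HP; apply locally_C_Cmod in HP; destruct HP as [d [Hd HP]].
  unfold filtermap; eapply filter_imp; [|apply (H d Hd)]; simpl; auto.
Qed.

Lemma Cmod_self (z : C) : Cmod (z - z) = 0.
Proof. replace (z - z)%C with (RtoC 0) by ring; apply Cmod_0. Qed.

Lemma Ctends_const {T : Type} (F : (T -> Prop) -> Prop) {FF : Filter F} (c : C) :
  Ctends F (fun _ => c) c.
Proof. intros eps He; apply filter_forall; intros; rewrite Cmod_self; exact He. Qed.

Lemma Ctends_plus {T : Type} (F : (T -> Prop) -> Prop) {FF : Filter F} (f g : T -> C) (a b : C) :
  Ctends F f a -> Ctends F g b -> Ctends F (fun x => f x + g x)%C (a + b)%C.
Proof.
intros Hf Hg eps He; assert (He2 : 0 < eps / 2) by lra.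
eapply filter_imp; [|exact (filter_and _ _ (Hf _ He2) (Hg _ He2))]; intros x [H1 H2].
replace (f x + g x - (a + b))%C with ((f x - a) + (g x - b))%C by ring.
eapply Rle_lt_trans; [apply Cmod_triangle|lra].
Qed.

Lemma Ctends_mult {T : Type} (F : (T -> Prop) -> Prop) {FF : Filter F} (f g : T -> C) (a b : C) :
  Ctends F f a -> Ctends F g b -> Ctends F (fun x => f x * g x)%C (a * b)%C.
Proof.
intros Hf Hg eps He; set (K := Cmod a + 1 + Cmod b).
assert (HK : 0 < K) by (unfold K; generalize (Cmod_ge_0 a) (Cmod_ge_0 b); lra).
assert (HeK : 0 < Rmin 1 (eps / K)) by (apply Rmin_case; [lra|apply Rdiv_lt_0_compat; lra]).
eapply filter_imp; [|exact (filter_and _ _ (Hf _ HeK) (Hg _ HeK))]; intros x [Ha Hb].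
assert (Ha1 := Rlt_le_trans _ _ _ Ha (Rmin_l _ _)).
assert (Ha2 := Rlt_le_trans _ _ _ Ha (Rmin_r _ _)).
assert (Hb2 := Rlt_le_trans _ _ _ Hb (Rmin_r _ _)).
replace (f x * g x - a * b)%C with (f x * (g x - b) + (f x - a) * b)%C by ring.
assert (HA : Cmod (f x) <= Cmod a + 1) by (generalize (Cmod_triangle_rev (f x) a); lra).
eapply Rle_lt_trans; [apply Cmod_triangle|]; rewrite !Cmod_mult.
replace eps with ((Cmod a + 1) * (eps / K) + (eps / K) * Cmod b) by (unfold K; field; fold K; lra).
generalize (Cmod_ge_0 a) (Cmod_ge_0 (f x)) (Cmod_ge_0 b) (Cmod_ge_0 (g x - b))
  (Cmod_ge_0 (f x - a)); intros; nra.
Qed.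

Lemma Ctends_scal {T : Type} (F : (T -> Prop) -> Prop) {FF : Filter F} (c : C) (f : T -> C) (a : C) :
  Ctends F f a -> Ctends F (fun x => c * f x)%C (c * a)%C.
Proof. intros H; apply Ctends_mult; [exact FF|apply Ctends_const, FF|exact H]. Qed.

Lemma is_series_Clim (a : nat -> C) (l : C) :
  is_series (V := C_NormedModule) a l <->
  Clim (fun n => sum_n (G := C_AbelianMonoid) a n) l.
Proof. apply (filterlim_Ctends eventually). Qed.

Lemma Clim_unique (u : nat -> C) (l l' : C) : Clim u l -> Clim u l' -> l = l'.
Proof.
intros H H'; apply Ceq_minus, Cmod_small_0; intros eps He.
destruct (H (eps / 2)) as [N HN]; [lra|]; destruct (H' (eps / 2)) as [N' HN']; [lra|].
specialize (HN (max N N') (Nat.le_max_l _ _)).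
specialize (HN' (max N N') (Nat.le_max_r _ _)).
rewrite Cmod_minus_sym in HN.
generalize (Cmod_sub_triangle l (u (max N N')) l'); lra.
Qed.

Lemma Clim_ext (u v : nat -> C) (l : C) :
  (forall n, u n = v n) -> Clim u l -> Clim v l.
Proof.
intros E H eps He; destruct (H eps He) as [N HN]; exists N; intros n Hn.
rewrite <- E; auto.
Qed.

Lemma Clim_minus (u v : nat -> C) (a b : C) :
  Clim u a -> Clim v b -> Clim (fun n => u n - v n)%C (a - b)%C.
Proof.
intros H H'; apply (Clim_ext (fun n => u n + (-(1)) * v n)%C); [intros; ring|].
replace (a - b)%C with (a + (-(1)) * b)%C by ring.
apply Ctends_plus; [typeclasses eauto|exact H|apply Ctends_scal; [typeclasses eauto|exact H']].
Qed.

Lemma Clim_S (u : nat -> C) (l : C) : Clim u l -> Clim (fun n => u (S n)) l.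
Proof.
intros H eps He; destruct (H eps He) as [N HN]; exists N; intros; apply HN; lia.
Qed.

Lemma Clim_S_inv (u : nat -> C) (l : C) : Clim (fun n => u (S n)) l -> Clim u l.
Proof.
intros H eps He; destruct (H eps He) as [N HN]; exists (S N); intros n Hn.
destruct n; [lia|]; apply HN; lia.
Qed.

Lemma Clim_le_0 (u : nat -> C) (b : nat -> R) :
  (forall n, Cmod (u n) <= b n) -> is_lim_seq b 0 -> Clim u (RtoC 0).
Proof.
intros H Hb eps He; apply is_lim_seq_spec in Hb.
destruct (Hb (mkposreal eps He)) as [N HN]; exists N; intros n Hn.
specialize (HN n Hn); simpl in HN; rewrite Rminus_0_r in HN.
replace (u n - 0)%C with (u n) by ring.
eapply Rle_lt_trans; [apply H|]; eapply Rle_lt_trans; [apply Rle_abs|exact HN].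
Qed.

Lemma Clim_Cmod_le (u : nat -> C) (l : C) (M : R) :
  (forall n, Cmod (u n) <= M) -> Clim u l -> Cmod l <= M.
Proof.
intros H Hl; apply Rnot_lt_le; intros Hc.
destruct (Hl (Cmod l - M)) as [N HN]; [lra|].
specialize (HN N (Nat.le_refl _)); rewrite Cmod_minus_sym in HN.
generalize (Cmod_triangle_rev l (u N)) (H N); lra.
Qed.

Lemma Clim_cauchy (u : nat -> C) :
  (forall eps, 0 < eps -> exists N, forall n m, (N <= n)%nat -> (N <= m)%nat ->
     Cmod (u n - u m) < eps) -> exists l, Clim u l.
Proof.
intros H.
destruct (proj1 (filterlim_locally_cauchy (U := C_CompleteNormedModule)
  (F := eventually) u)) as [l Hl].
- intros eps; destruct (H eps (cond_pos eps)) as [N HN].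
  exists (fun n => (N <= n)%nat); split; [exists N; auto|].
  intros n m Hn Hm; apply ball_C_Cmod, HN; auto.
- exists l; apply (filterlim_Ctends eventually); exact Hl.
Qed.

Lemma Ccont_id (z : C) : Ccont (fun w => w) z.
Proof. intros eps He; exists eps; auto. Qed.

Lemma Ccont_comp (f g : C -> C) (z : C) :
  Ccont f z -> Ccont g (f z) -> Ccont (fun w => g (f w)) z.
Proof.
intros Hf Hg eps He; destruct (Hg eps He) as [d [Hd Hg']].
destruct (Hf d Hd) as [e [He' Hf']]; exists e; split; auto.
Qed.

Lemma near_self (a : C) (P : C -> Prop) : near a P -> P a.
Proof. intros [d [Hd H]]; apply H; rewrite Cmod_self; exact Hd. Qed.

Lemma Ccont_ext_loc (f g : C -> C) (z : C) :
  near z (fun w => f w = g w) -> Ccont f z -> Ccont g z.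
Proof.
intros E H eps He; eapply filter_imp; [|exact (filter_and _ _ E (H eps He))].
intros w [E1 H1]; rewrite <- E1, <- (near_self z _ E); exact H1.
Qed.

Lemma Cdiff_Ccont (f : C -> C) (z : C) : Cdiff f z -> Ccont f z.
Proof.
intros [q [Hq H]].
apply Ccont_ext_loc with (f := fun w => (f z + (w + - z) * q w)%C).
- eapply filter_imp; [|exact H]; intros w E; rewrite E; reflexivity.
- apply (Ctends_plus (near z)); [apply Ctends_const, near_filter|].
  apply (Ctends_mult (near z)); [|exact Hq].
  apply (Ctends_plus (near z)); [apply Ccont_id|apply Ctends_const, near_filter].
Qed.

Lemma Cdiff_ext_loc (f g : C -> C) (z : C) :
  near z (fun w => f w = g w) -> Cdiff f z -> Cdiff g z.
Proof.
intros E [q [Hq H]]; exists q; split; [exact Hq|].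
eapply filter_imp; [|exact (filter_and _ _ E H)]; intros w [E1 H1].
rewrite <- E1, <- (near_self z _ E); exact H1.
Qed.

Lemma Cdiff_ext (f g : C -> C) (z : C) :
  (forall w, f w = g w) -> Cdiff f z -> Cdiff g z.
Proof. intros E; apply Cdiff_ext_loc, filter_forall, E. Qed.

Lemma Cdiff_const (c z : C) : Cdiff (fun _ => c) z.
Proof.
exists (fun _ => RtoC 0); split; [apply Ctends_const, near_filter|].
apply filter_forall; intros; ring.
Qed.

Lemma Cdiff_id (z : C) : Cdiff (fun w => w) z.
Proof.
exists (fun _ => RtoC 1); split; [apply Ctends_const, near_filter|].
apply filter_forall; intros; ring.
Qed.

Lemma Cdiff_plus (f g : C -> C) (z : C) :
  Cdiff f z -> Cdiff g z -> Cdiff (fun w => f w + g w)%C z.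
Proof.
intros [q [Hq H]] [r [Hr H']]; exists (fun w => q w + r w)%C; split.
- apply (Ctends_plus (near z)); assumption.
- eapply filter_imp; [|exact (filter_and _ _ H H')]; intros w [E E'].
  rewrite E, E'; ring.
Qed.

Lemma Cdiff_mult (f g : C -> C) (z : C) :
  Cdiff f z -> Cdiff g z -> Cdiff (fun w => f w * g w)%C z.
Proof.
intros Hf Hg; assert (Cf := Cdiff_Ccont _ _ Hf).
destruct Hf as [q [Hq H]], Hg as [r [Hr H']]; exists (fun w => q w * g z + f w * r w)%C; split.
- apply (Ctends_plus (near z)); apply (Ctends_mult (near z)); try assumption.
  apply Ctends_const, near_filter.
- eapply filter_imp; [|exact (filter_and _ _ H H')]; intros w [E E'].
  rewrite E', E; ring.
Qed.

Lemma Cdiff_scal (c : C) (f : C -> C) (z : C) :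
  Cdiff f z -> Cdiff (fun w => c * f w)%C z.
Proof. intros H; apply Cdiff_mult; [apply Cdiff_const|exact H]. Qed.

Lemma Cdiff_opp (f : C -> C) (z : C) : Cdiff f z -> Cdiff (fun w => - f w)%C z.
Proof.
intros H; apply (Cdiff_ext (fun w => (-(1)) * f w)%C); [intros; ring|].
apply Cdiff_scal, H.
Qed.

Lemma Cdiff_minus (f g : C -> C) (z : C) :
  Cdiff f z -> Cdiff g z -> Cdiff (fun w => f w - g w)%C z.
Proof. intros Hf Hg; apply Cdiff_plus; [exact Hf|apply Cdiff_opp, Hg]. Qed.

Lemma Cdiff_comp (f g : C -> C) (z : C) :
  Cdiff f z -> Cdiff g (f z) -> Cdiff (fun w => g (f w)) z.
Proof.
intros Hf Hg; assert (Cf := Cdiff_Ccont _ _ Hf).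
destruct Hf as [q [Hq H]], Hg as [r [Hr [e [He H']]]]; exists (fun w => q w * r (f w))%C; split.
- apply (Ctends_mult (near z)); [exact Hq|]; apply (Ccont_comp f r); assumption.
- eapply filter_imp; [|exact (filter_and _ _ H (Cf e He))]; intros w [E E'].
  rewrite (H' (f w) E'), E at 1; ring.
Qed.

Lemma Cdiff_shift (f : C -> C) (a z : C) :
  Cdiff f (z + a) -> Cdiff (fun w => f (w + a)%C) z.
Proof.
intros H; apply (Cdiff_comp (fun w => w + a)%C f); [|exact H].
apply Cdiff_plus; [apply Cdiff_id|apply Cdiff_const].
Qed.

Lemma Ccont_inv (z : C) : z <> RtoC 0 -> Ccont (fun w => / w)%C z.
Proof.
intros Hz eps He; assert (Hm : 0 < Cmod z) by (apply Cmod_gt_0, Hz).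
exists (Rmin (Cmod z / 2) (eps * Cmod z * Cmod z / 2)).
split; [apply Rmin_case; [lra|]; assert (0 < eps * Cmod z * Cmod z) by
  (repeat apply Rmult_lt_0_compat; lra); lra|].
intros w Hw.
assert (Hw1 := Rlt_le_trans _ _ _ Hw (Rmin_l _ _)).
assert (Hw2 := Rlt_le_trans _ _ _ Hw (Rmin_r _ _)).
assert (Hwm : Cmod z / 2 < Cmod w).
{ generalize (Cmod_triangle_rev z w); rewrite Cmod_minus_sym in Hw1; lra. }
assert (Hw0 : w <> RtoC 0) by (apply Cmod_gt_0; lra).
replace (/ w - / z)%C with ((z - w) / (w * z))%C by (field; split; auto).
rewrite Cmod_div, Cmod_mult, Cmod_minus_sym by (apply Cmult_neq_0; auto).
apply Rmult_lt_reg_r with (Cmod w * Cmod z); [apply Rmult_lt_0_compat; lra|].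
replace (Cmod (w - z) / (Cmod w * Cmod z) * (Cmod w * Cmod z)) with (Cmod (w - z))
  by (field; lra).
eapply Rlt_trans; [exact Hw2|].
replace (eps * Cmod z * Cmod z / 2) with (eps * (Cmod z / 2 * Cmod z)) by field.
apply Rmult_lt_compat_l; [lra|]; apply Rmult_lt_compat_r; lra.
Qed.

Lemma Cdiff_inv (z : C) : z <> RtoC 0 -> Cdiff (fun w => / w)%C z.
Proof.
intros Hz; exists (fun w => - / z * / w)%C; split.
- apply (Ctends_mult (near z)); [apply Ctends_const, near_filter|apply Ccont_inv, Hz].
- assert (Hm : 0 < Cmod z) by (apply Cmod_gt_0, Hz).
  exists (Cmod z); split; [exact Hm|]; intros w Hw.
  assert (Hw0 : w <> RtoC 0).
  { intros E; subst; rewrite Cmod_minus_sym in Hw.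
    replace (z - 0)%C with z in Hw by ring; lra. }
  field; auto.
Qed.

(** The slope function is the difference quotient, completed by [l] at [z]; the hypothesis is its
    continuity there. *)
Lemma Cdiff_of_increments (f : C -> C) (z l : C) :
  (forall eps, 0 < eps -> exists d, 0 < d /\ forall w, Cmod (w - z) < d ->
     Cmod (f w - f z - (w - z) * l) <= eps * Cmod (w - z)) -> Cdiff f z.
Proof.
intros H.
exists (fun w => if Ceq_dec w z then l else ((f w - f z) / (w - z))%C); split.
- intros eps He; destruct (H (eps / 2)) as [d [Hd H']]; [lra|].
  exists d; split; [exact Hd|]; intros w Hw.
  destruct (Ceq_dec z z) as [_|n]; [|congruence].
  destruct (Ceq_dec w z) as [E|n]; [rewrite Cmod_self; exact He|].
  assert (Hn : (w - z)%C <> RtoC 0) by (apply Cminus_eq_contra, n).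
  assert (Hm : 0 < Cmod (w - z)) by (apply Cmod_gt_0, Hn).
  replace ((f w - f z) / (w - z) - l)%C
    with ((f w - f z - (w - z) * l) / (w - z))%C by (field; exact Hn).
  rewrite Cmod_div by exact Hn.
  apply Rmult_lt_reg_r with (Cmod (w - z)); [exact Hm|].
  unfold Rdiv at 1; rewrite Rmult_assoc, Rinv_l, Rmult_1_r by lra.
  eapply Rle_lt_trans; [apply H', Hw|]; apply Rmult_lt_compat_r; lra.
- exists 1; split; [lra|]; intros w _.
  destruct (Ceq_dec w z) as [E|n]; [subst; ring|].
  field; apply Cminus_eq_contra, n.
Qed.

Lemma Cdiff_ex_derive (f : C -> C) (z : C) :
  Cdiff f z <-> ex_derive (K := C_AbsRing) (V := C_NormedModule) f z.
Proof.
split.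
- intros [q [Hq [d [Hd H]]]]; exists (q z); split; [apply is_linear_scal_l|].
  intros x Hx.
  (* The derivative is stated for every limit [x] of the filter at [z]; uniqueness of limits leaves
     only [x = z]. *)
  apply (is_filter_lim_locally_unique (K := C_AbsRing)
    (V := AbsRing_NormedModule C_AbsRing)) in Hx; subst x.
  intros eps; destruct (Hq eps (cond_pos eps)) as [e [He Hq']].
  assert (Hde : 0 < Rmin d e) by (apply Rmin_case; lra).
  exists (mkposreal _ Hde); intros w Hw.
  change (Cmod (w - z) < Rmin d e) in Hw.
  generalize (Rmin_l d e) (Rmin_r d e); intros.
  change (Cmod (f w - f z - (w - z) * q z) <= eps * Cmod (w - z)).
  rewrite (H w) by lra.
  replace (f z + (w - z) * q w - f z - (w - z) * q z)%C
    with ((q w - q z) * (w - z))%C by ring.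
  rewrite Cmod_mult; apply Rmult_le_compat_r; [apply Cmod_ge_0|].
  apply Rlt_le, Hq'; lra.
- intros [l [_ H]]; specialize (H z (fun P HP => HP)).
  apply Cdiff_of_increments with l; intros eps He.
  destruct (H (mkposreal eps He)) as [d Hd]; exists d; split; [apply cond_pos|].
  intros w Hw; apply (Hd w), Hw.
Qed.

(** * The complex exponential and complex-valued integrals *)

Lemma exp_le (x y : R) : x <= y -> exp x <= exp y.
Proof. intros [H| ->]; [apply Rlt_le, exp_increasing, H|apply Rle_refl]. Qed.

Lemma continuous_of_ex_derive (f : R -> R) (x : R) : ex_derive f x -> continuous f x.
Proof. apply (ex_derive_continuous (K := R_AbsRing) (V := R_NormedModule)). Qed.

Lemma Cexp_plus (a b : C) : Cexp (a + b) = (Cexp a * Cexp b)%C.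
Proof.
apply Ceq; unfold Cexp; rewrite ?re_mult, ?im_mult; simpl;
  rewrite exp_plus, ?cos_plus, ?sin_plus; unfold Re, Im; ring.
Qed.

Lemma Cexp_0 : Cexp (RtoC 0) = RtoC 1.
Proof. apply Ceq; unfold Cexp; simpl; rewrite exp_0, ?cos_0, ?sin_0; ring. Qed.

Lemma Cexp_RtoC (x : R) : Cexp (RtoC x) = RtoC (exp x).
Proof. apply Ceq; unfold Cexp; simpl; rewrite ?cos_0, ?sin_0; ring. Qed.

Lemma Cmod_Cexp (z : C) : Cmod (Cexp z) = exp (Re z).
Proof.
unfold Cmod, Cexp; simpl.
replace (exp (Re z) * cos (Im z) * (exp (Re z) * cos (Im z) * 1) +
         exp (Re z) * sin (Im z) * (exp (Re z) * sin (Im z) * 1))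
  with (exp (Re z) * exp (Re z) * (Rsqr (sin (Im z)) + Rsqr (cos (Im z))))
  by (unfold Rsqr; ring).
rewrite sin2_cos2, Rmult_1_r; apply sqrt_square, Rlt_le, exp_pos.
Qed.

Lemma Cexp_neq_0 (z : C) : Cexp z <> RtoC 0.
Proof. apply Cmod_gt_0; rewrite Cmod_Cexp; apply exp_pos. Qed.

Lemma Cexp_opp (z : C) : Cexp (- z) = (/ Cexp z)%C.
Proof.
assert (H : (Cexp (- z) * Cexp z)%C = RtoC 1).
{ rewrite <- Cexp_plus, <- Cexp_0; f_equal; ring. }
replace (Cexp (- z)) with (Cexp (- z) * Cexp z * / Cexp z)%C
  by (field; apply Cexp_neq_0).
rewrite H; ring.
Qed.

Notation is_Cderive := (is_derive (K := R_AbsRing) (V := C_R_NormedModule)).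
Notation is_CRInt := (is_RInt (V := C_R_NormedModule)).
Notation ex_CRInt := (ex_RInt (V := C_R_NormedModule)).
Notation CRInt := (RInt (V := C_R_CompleteNormedModule)).
Notation Rcont := (continuous (T := R_UniformSpace) (U := C_UniformSpace)).

Lemma is_Cderive_pair (f g : R -> R) (t a b : R) :
  is_derive f t a -> is_derive g t b ->
  is_Cderive (fun t => (f t, g t)) t (a, b).
Proof.
intros Hf Hg.
apply is_derive_ext with
  (fun t => plus (G := C_R_NormedModule) (scal (f t) (1, 0)) (scal (g t) (0, 1))).
- intros u; apply Ceq; simpl; unfold scal, plus; simpl; unfold mult; simpl; ring.
- replace (a, b) with
    (plus (G := C_R_NormedModule) (scal (V := C_R_NormedModule) a (1, 0))
       (scal (V := C_R_NormedModule) b (0, 1))).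
  + apply @is_derive_plus; apply (is_derive_scal_l (V := C_R_NormedModule)); assumption.
  + apply Ceq; simpl; unfold scal, plus; simpl; unfold mult; simpl; ring.
Qed.

Lemma is_Cderive_ext (f g : R -> C) (t : R) (l l' : C) :
  (forall u, f u = g u) -> l = l' -> is_Cderive f t l -> is_Cderive g t l'.
Proof. intros E <- H; apply is_derive_ext with f; auto. Qed.

Lemma is_Cderive_Cexp_line (z : C) (t : R) :
  is_Cderive (fun t => Cexp (z * RtoC t)) t (z * Cexp (z * RtoC t))%C.
Proof.
apply is_Cderive_ext with
  (f := fun t => (exp (Re z * t) * cos (Im z * t), exp (Re z * t) * sin (Im z * t)))
  (l := (exp (Re z * t) * Re z * cos (Im z * t)
           - exp (Re z * t) * Im z * sin (Im z * t),
         exp (Re z * t) * Re z * sin (Im z * t)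
           + exp (Re z * t) * Im z * cos (Im z * t))).
- intros u; unfold Cexp; rewrite re_scal_r, im_scal_r; reflexivity.
- unfold Cexp; rewrite re_scal_r, im_scal_r.
  apply Ceq; [rewrite re_mult|rewrite im_mult]; simpl; ring.
- apply is_Cderive_pair; auto_derive; auto; ring.
Qed.

Lemma is_Cderive_Cexp (z : C) (g : R -> R) (t g' : R) :
  is_derive g t g' ->
  is_Cderive (fun t => Cexp (z * RtoC (g t))) t (RtoC g' * (z * Cexp (z * RtoC (g t))))%C.
Proof.
intros Hg; rewrite <- scal_R_Cmult.
apply (is_derive_comp (V := C_R_NormedModule) (fun u => Cexp (z * RtoC u)) g);
  [apply is_Cderive_Cexp_line|exact Hg].
Qed.

(** Multiplication by [c] is a bounded real-linear map, so it passes through the derivative; the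
    module is C over the reals. *)
Lemma is_Cderive_Cmult (c : C) (f : R -> C) (t : R) (l : C) :
  is_Cderive f t l -> is_Cderive (fun t => c * f t)%C t (c * l)%C.
Proof.
assert (S : forall (k : R) (x : C), (c * scal (V := C_R_NormedModule) k x)%C =
  scal (V := C_R_NormedModule) k (c * x)%C :> C)
  by (intros k x; rewrite !scal_R_Cmult; ring).
intros H; eapply filterdiff_ext_lin.
- apply (filterdiff_comp' (U := R_NormedModule) (V := C_R_NormedModule)
    (W := C_R_NormedModule) f (fun w => (c * w)%C)); [exact H|].
  apply filterdiff_linear; split.
  + intros x y; apply Cmult_plus_distr_l.
  + exact S.
  + exists (Cmod c + 1); split; [generalize (Cmod_ge_0 c); lra|]; intros x.
    rewrite !norm_C_R, Cmod_mult; generalize (Cmod_ge_0 x); nra.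
- intros y; apply S.
Qed.

Lemma is_Cderive_plus (f g : R -> C) (t : R) (a b : C) :
  is_Cderive f t a -> is_Cderive g t b ->
  is_Cderive (fun t => f t + g t)%C t (a + b)%C.
Proof. intros; apply (is_derive_plus (V := C_R_NormedModule)); assumption. Qed.

Lemma is_Cderive_Rmult (e : R -> R) (f : R -> C) (t e' : R) (l : C) :
  is_derive e t e' -> is_Cderive f t l ->
  is_Cderive (fun t => RtoC (e t) * f t)%C t (RtoC e' * f t + RtoC (e t) * l)%C.
Proof.
intros He Hf.
apply is_Cderive_ext with (f := fun t => scal (V := C_R_NormedModule) (e t) (f t))
  (l := plus (G := C_R_NormedModule) (scal (V := C_R_NormedModule) e' (f t))
    (scal (V := C_R_NormedModule) (e t) l)).
- intros; apply scal_R_Cmult.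
- rewrite <- !scal_R_Cmult; reflexivity.
- assert (H := filterdiff_scal_fct (K := R_AbsRing) (V := C_R_NormedModule)
    t e f (fun y => scal y e') (fun y => scal y l) Rmult_comm He Hf).
  eapply filterdiff_ext_lin; [exact H|].
  intros y; apply Ceq; simpl; unfold scal, plus, mult; simpl; unfold mult; simpl; ring.
Qed.

Lemma Rcont_Ctends (f : R -> C) (t : R) : Rcont f t <-> Ctends (locally t) f (f t).
Proof. apply (filterlim_Ctends (locally t)). Qed.

Lemma is_Cderive_Rcont (f : R -> C) (t : R) (l : C) : is_Cderive f t l -> Rcont f t.
Proof.
intros H; apply (ex_derive_continuous (K := R_AbsRing) (V := C_R_NormedModule)).
exists l; exact H.
Qed.

Lemma Rcont_comp_Ccont (f : C -> C) (g : R -> C) (t : R) :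
  Rcont g t -> Ccont f (g t) -> Rcont (fun t => f (g t)) t.
Proof.
intros Hg Hf; apply Rcont_Ctends; intros eps He; destruct (Hf eps He) as [d [Hd Hf']].
eapply filter_imp; [|exact (proj1 (Rcont_Ctends g t) Hg d Hd)]; auto.
Qed.

Lemma Rcont_mult (f g : R -> C) (t : R) :
  Rcont f t -> Rcont g t -> Rcont (fun t => f t * g t)%C t.
Proof.
intros Hf Hg; apply Rcont_Ctends, (Ctends_mult (locally t)); apply Rcont_Ctends; assumption.
Qed.

Lemma Rcont_plus (f g : R -> C) (t : R) :
  Rcont f t -> Rcont g t -> Rcont (fun t => f t + g t)%C t.
Proof. intros; apply (continuous_plus (V := C_R_NormedModule)); assumption. Qed.

Lemma Rcont_const (c : C) (t : R) : Rcont (fun _ => c) t.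
Proof. apply continuous_const. Qed.

Lemma Rcont_RtoC (e : R -> R) (t : R) : continuous e t -> Rcont (fun t => RtoC (e t)) t.
Proof.
intros H; apply Rcont_Ctends; intros eps He.
eapply filter_imp; [|exact (proj1 (filterlim_locally e (e t)) H (mkposreal eps He))].
intros u Hu; rewrite <- RtoC_minus, Cmod_R; exact Hu.
Qed.

Lemma ex_CRInt_cont (f : R -> C) (a b : R) :
  (forall t, Rmin a b <= t <= Rmax a b -> Rcont f t) -> ex_CRInt f a b.
Proof. intros H; apply (ex_RInt_continuous (V := C_R_CompleteNormedModule)); exact H. Qed.

Lemma CRInt_correct (f : R -> C) (a b : R) :
  ex_CRInt f a b -> is_CRInt f a b (CRInt f a b).
Proof. apply (RInt_correct (V := C_R_CompleteNormedModule)). Qed.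

Lemma CRInt_unique (f : R -> C) (a b : R) (l : C) : is_CRInt f a b l -> CRInt f a b = l.
Proof. apply (is_RInt_unique (V := C_R_CompleteNormedModule)). Qed.

Lemma is_CRInt_unique2 (f : R -> C) (a b : R) (l l' : C) :
  is_CRInt f a b l -> is_CRInt f a b l' -> l = l'.
Proof. intros H H'; apply CRInt_unique in H; apply CRInt_unique in H'; congruence. Qed.

Lemma is_CRInt_Cmult (c : C) (f : R -> C) (a b : R) (l : C) :
  is_CRInt f a b l -> is_CRInt (fun t => c * f t)%C a b (c * l)%C.
Proof.
intros H.
assert (H1 := is_RInt_fct_extend_fst f a b l H).
assert (H2 := is_RInt_fct_extend_snd f a b l H).
replace (c * l)%C with (Re c * fst l - Im c * snd l, Re c * snd l + Im c * fst l)
  by (apply Ceq; simpl; unfold Re, Im; ring).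
apply (is_RInt_fct_extend_pair (U := R_NormedModule) (V := R_NormedModule)).
- apply is_RInt_ext with (fun t => minus (scal (Re c) (fst (f t))) (scal (Im c) (snd (f t)))).
  + intros; reflexivity.
  + apply (is_RInt_minus (V := R_NormedModule)); apply (is_RInt_scal (V := R_NormedModule)); assumption.
- apply is_RInt_ext with (fun t => plus (scal (Re c) (snd (f t))) (scal (Im c) (fst (f t)))).
  + intros; reflexivity.
  + apply (is_RInt_plus (V := R_NormedModule)); apply (is_RInt_scal (V := R_NormedModule)); assumption.
Qed.

Lemma is_CRInt_plus (f g : R -> C) (a b : R) (l m : C) :
  is_CRInt f a b l -> is_CRInt g a b m -> is_CRInt (fun t => f t + g t)%C a b (l + m)%C.
Proof. apply (is_RInt_plus (V := C_R_NormedModule)). Qed.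

Lemma is_CRInt_minus (f g : R -> C) (a b : R) (l m : C) :
  is_CRInt f a b l -> is_CRInt g a b m -> is_CRInt (fun t => f t - g t)%C a b (l - m)%C.
Proof. apply (is_RInt_minus (V := C_R_NormedModule)). Qed.

Lemma is_CRInt_ext (f g : R -> C) (a b : R) (l : C) :
  (forall t, Rmin a b < t < Rmax a b -> f t = g t) -> is_CRInt f a b l -> is_CRInt g a b l.
Proof. apply (is_RInt_ext (V := C_R_NormedModule)). Qed.

Lemma is_CRInt_bound (f : R -> C) (a b M : R) (l : C) :
  a <= b -> (forall t, a <= t <= b -> Cmod (f t) <= M) -> is_CRInt f a b l ->
  Cmod l <= (b - a) * M.
Proof.
intros Hab HM H; rewrite <- norm_C_R.
apply (norm_RInt_le_const (V := C_R_NormedModule) f a b l M); auto.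
intros t Ht; rewrite norm_C_R; auto.
Qed.

Lemma is_CRInt_derive (f df : R -> C) (a b : R) :
  (forall t, Rmin a b <= t <= Rmax a b -> is_Cderive f t (df t)) ->
  (forall t, Rmin a b <= t <= Rmax a b -> Rcont df t) ->
  is_CRInt df a b (f b - f a)%C.
Proof. apply (is_RInt_derive (V := C_R_CompleteNormedModule)). Qed.

(** A complex-valued function need not attain its mean slope at an intermediate point, so the bound
    comes from integrating the derivative. *)
Lemma C_mean_value (f df : R -> C) (M : R) :
  (forall t, 0 <= t <= 1 -> is_Cderive f t (df t)) ->
  (forall t, 0 <= t <= 1 -> Rcont df t) ->
  (forall t, 0 <= t <= 1 -> Cmod (df t) <= M) -> Cmod (f 1 - f 0) <= M.
Proof.
intros Hd Hc HM; replace M with ((1 - 0) * M) by ring.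
apply is_CRInt_bound with (f := df); [lra|exact HM|].
apply is_CRInt_derive; intros t; rewrite Rmin_left, Rmax_right by lra; auto.
Qed.

Lemma Rcont_Cexp_line (z : C) (t : R) : Rcont (fun t => Cexp (z * RtoC t)) t.
Proof. eapply is_Cderive_Rcont, is_Cderive_Cexp_line. Qed.

Lemma Cexp_bound_1 (z : C) : Cmod (Cexp z - 1) <= Cmod z * exp (Cmod z).
Proof.
replace (Cexp z - 1)%C with (Cexp (z * RtoC 1) - Cexp (z * RtoC 0))%C
  by (rewrite Cmult_1_r, Cmult_0_r, Cexp_0; ring).
apply (C_mean_value (fun t => Cexp (z * RtoC t)) (fun t => z * Cexp (z * RtoC t))%C).
- intros; apply is_Cderive_Cexp_line.
- intros; apply Rcont_mult; [apply Rcont_const|apply Rcont_Cexp_line].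
- intros t Ht; rewrite Cmod_mult, Cmod_Cexp, re_scal_r.
  apply Rmult_le_compat_l; [apply Cmod_ge_0|].
  apply exp_le; generalize (re_le_Cmod z) (Rle_abs (Re z)) (Cmod_ge_0 z); nra.
Qed.

(** Along t -> exp(z t) - z t the derivative is z (exp(z t) - 1), and [Cexp_bound_1] supplies the
    second factor |z|. *)
Lemma Cexp_bound_2 (z : C) : Cmod (Cexp z - 1 - z) <= Cmod z ^ 2 * exp (Cmod z).
Proof.
replace (Cexp z - 1 - z)%C with
  ((Cexp (z * RtoC 1) + (- z) * RtoC 1) - (Cexp (z * RtoC 0) + (- z) * RtoC 0))%C
  by (rewrite Cmult_1_r, !Cmult_0_r, Cexp_0; ring).
apply (C_mean_value (fun t => Cexp (z * RtoC t) + (- z) * RtoC t)%C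
  (fun t => z * (Cexp (z * RtoC t) - 1))%C).
- intros t _; apply is_Cderive_ext
    with (f := fun t => (Cexp (z * RtoC t) + (- z) * RtoC t)%C)
         (l := (z * Cexp (z * RtoC t) + (- z) * RtoC 1)%C); [reflexivity|ring|].
  apply is_Cderive_plus; [apply is_Cderive_Cexp_line|].
  apply is_Cderive_Cmult, is_Cderive_pair; auto_derive; auto.
- intros; apply Rcont_mult; [apply Rcont_const|].
  apply Rcont_plus; [apply Rcont_Cexp_line|apply Rcont_const].
- intros t Ht; rewrite Cmod_mult; simpl; rewrite Rmult_1_r, Rmult_assoc.
  apply Rmult_le_compat_l; [apply Cmod_ge_0|].
  eapply Rle_trans; [apply Cexp_bound_1|].
  rewrite Cmod_mult, Cmod_R, Rabs_right by lra.
  assert (H : Cmod z * t <= Cmod z) by (generalize (Cmod_ge_0 z); nra).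
  apply Rmult_le_compat; try lra.
  + apply Rmult_le_pos; [apply Cmod_ge_0|lra].
  + apply Rlt_le, exp_pos.
  + apply exp_le, H.
Qed.

(* [f] differs from an affine function near [s] by a quadratic error; unlike
   differentiability this passes to pointwise limits when the constants are fixed. *)
Definition qdiff (f : C -> C) (s : C) (r M : R) : Prop :=
  exists d, forall h, Cmod h < r ->
    Cmod (f (s + h)%C - f s - h * d) <= M * Cmod h ^ 2.

Lemma qdiff_Cdiff (f : C -> C) (s : C) (r M : R) : 0 < r -> qdiff f s r M -> Cdiff f s.
Proof.
intros Hr [l H]; apply Cdiff_of_increments with l; intros eps He.
set (M' := Rabs M + 1).
assert (HM' : 0 < M') by (unfold M'; generalize (Rabs_pos M); lra).
exists (Rmin r (eps / M')); split; [apply Rmin_case; [lra|apply Rdiv_lt_0_compat; lra]|].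
intros w Hw; generalize (Rmin_l r (eps / M')) (Rmin_r r (eps / M')); intros.
specialize (H (w - s)%C ltac:(lra)); replace (s + (w - s))%C with w in H by ring.
eapply Rle_trans; [exact H|]; simpl pow; rewrite Rmult_1_r, <- Rmult_assoc.
apply Rmult_le_compat_r; [apply Cmod_ge_0|].
apply Rle_trans with (M' * Cmod (w - s)).
- apply Rmult_le_compat_r; [apply Cmod_ge_0|unfold M'; generalize (Rle_abs M); lra].
- replace eps with (M' * (eps / M')) by (field; lra); apply Rmult_le_compat_l; lra.
Qed.

Lemma qdiff_plus (f g : C -> C) (s : C) (r M N : R) :
  qdiff f s r M -> qdiff g s r N -> qdiff (fun s => f s + g s)%C s r (M + N).
Proof.
intros [d H] [e H']; exists (d + e)%C; intros h Hh.
replace (f (s + h) + g (s + h) - (f s + g s) - h * (d + e))%C with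
  ((f (s + h) - f s - h * d) + (g (s + h) - g s - h * e))%C by ring.
eapply Rle_trans; [apply Cmod_triangle|].
specialize (H h Hh); specialize (H' h Hh); lra.
Qed.

Lemma qdiff_scal (c : C) (f : C -> C) (s : C) (r M : R) :
  qdiff f s r M -> qdiff (fun s => c * f s)%C s r (Cmod c * M).
Proof.
intros [d H]; exists (c * d)%C; intros h Hh.
replace (c * f (s + h) - c * f s - h * (c * d))%C with
  (c * (f (s + h) - f s - h * d))%C by ring.
rewrite Cmod_mult, Rmult_assoc; apply Rmult_le_compat_l; [apply Cmod_ge_0|auto].
Qed.

Lemma qdiff_ext (f g : C -> C) (s : C) (r M N : R) :
  (forall s, f s = g s) -> M <= N -> qdiff f s r M -> qdiff g s r N.
Proof.
intros E HMN [d H]; exists d; intros h Hh; rewrite <- !E.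
eapply Rle_trans; [apply H, Hh|]; apply Rmult_le_compat_r; [apply pow2_ge_0|lra].
Qed.

(** The slopes of the [f n] form a Cauchy sequence: for one fixed small real [h], [h * d n] differs
    from a convergent sequence of increments by at most M h^2. The error bound then passes to the
    limit. *)
Lemma qdiff_lim (f : nat -> C -> C) (g : C -> C) (s : C) (r M : R) :
  0 < r -> (forall n, qdiff (f n) s r M) ->
  (forall h, Cmod h < r -> Clim (fun n => f n (s + h)%C) (g (s + h)%C)) ->
  qdiff g s r M.
Proof.
intros Hr H Hlim.
assert (H0 : Clim (fun n => f n s) (g s)).
{ specialize (Hlim (RtoC 0)); rewrite Cmod_0, Cplus_0_r in Hlim; auto. }
destruct (choice (fun n d => forall h, Cmod h < r ->
  Cmod (f n (s + h)%C - f n s - h * d) <= M * Cmod h ^ 2) H) as [d Hd].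
assert (Hc : exists l, Clim d l).
{ apply Clim_cauchy; intros eps He.
  set (M' := Rabs M + 1).
  assert (HM' : 0 < M') by (unfold M'; generalize (Rabs_pos M); lra).
  (* Two slopes differ by at most eps / 2 + 2 M' h: the first part comes from convergence within eps
     h / 8 at [s] and at [s + h], the second from the quadratic errors. This [h] makes the total at
     most 3 eps / 4. *)
  set (h := Rmin (r / 2) (eps / (8 * M'))).
  assert (Hh : 0 < h) by (apply Rmin_case; [lra|apply Rdiv_lt_0_compat; lra]).
  assert (Hhr : h < r) by (generalize (Rmin_l (r / 2) (eps / (8 * M'))); unfold h; lra).
  assert (HhM : M' * h <= eps / 8).
  { replace (eps / 8) with (M' * (eps / (8 * M'))) by (field; lra).
    apply Rmult_le_compat_l; [lra|apply Rmin_r]. }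
  assert (Hch : Cmod (RtoC h) = h) by (rewrite Cmod_R, Rabs_right; lra).
  destruct (Hlim (RtoC h) ltac:(lra) (eps * h / 8)) as [N1 HN1]; [apply Rdiv_lt_0_compat; nra|].
  destruct (H0 (eps * h / 8)) as [N2 HN2]; [apply Rdiv_lt_0_compat; nra|].
  exists (max N1 N2).
  assert (K : forall n, (max N1 N2 <= n)%nat ->
    Cmod (h * d n - (g (s + h)%C - g s)) <= eps * h / 4 + M' * h ^ 2).
  { intros n Hn; specialize (HN1 n ltac:(lia)); specialize (HN2 n ltac:(lia)).
    specialize (Hd n (RtoC h) ltac:(lra)); rewrite Hch in Hd.
    replace (h * d n - (g (s + h) - g s))%C with
      (- (f n (s + h) - f n s - h * d n) + (f n (s + h) - g (s + h)) + - (f n s - g s))%C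
      by ring.
    eapply Rle_trans; [apply Cmod_triangle|].
    rewrite Cmod_opp.
    eapply Rle_trans; [apply Rplus_le_compat_r, Cmod_triangle|]; rewrite Cmod_opp.
    assert (M * h ^ 2 <= M' * h ^ 2).
    { apply Rmult_le_compat_r; [apply pow2_ge_0|unfold M'; generalize (Rle_abs M); lra]. }
    lra. }
  intros n m Hn Hm.
  assert (Kn := K n Hn); assert (Km := K m Hm).
  rewrite Cmod_minus_sym in Km.
  assert (T := Cmod_sub_triangle (h * d n) (g (s + h)%C - g s) (h * d m)).
  replace (h * d n - h * d m)%C with (h * (d n - d m))%C in T by ring.
  rewrite Cmod_mult, Hch in T.
  assert (T' : h * Cmod (d n - d m) <= h * (eps / 2 + 2 * (M' * h))).
  { eapply Rle_trans; [exact T|]; lra. }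
  apply Rmult_le_reg_l in T'; [lra|exact Hh]. }
destruct Hc as [l Hl]; exists l; intros h Hh.
apply Clim_Cmod_le with (u := fun n => (f n (s + h) - f n s - h * d n)%C); [intros n; auto|].
apply Clim_minus; [apply Clim_minus; auto|apply (Ctends_scal eventually), Hl].
Qed.

Lemma Cdiff_Cexp (z : C) : Cdiff Cexp z.
Proof.
apply qdiff_Cdiff with (r := 1) (M := Cmod (Cexp z) * exp 1); [lra|].
exists (Cexp z); intros h Hh; rewrite Cexp_plus.
replace (Cexp z * Cexp h - Cexp z - h * Cexp z)%C with (Cexp z * (Cexp h - 1 - h))%C by ring.
rewrite Cmod_mult, Rmult_assoc; apply Rmult_le_compat_l; [apply Cmod_ge_0|].
eapply Rle_trans; [apply Cexp_bound_2|]; rewrite Rmult_comm.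
apply Rmult_le_compat_r; [apply pow2_ge_0|apply exp_le; lra].
Qed.

(** * Goursat's theorem and the identity theorem *)

Definition hseg (f : C -> C) (c a b : R) : C := CRInt (fun t => f (t, c)) a b.
Definition vseg (f : C -> C) (a c d : R) : C := CRInt (fun t => f (a, t)) c d.
(** The integral over the boundary of [a, b] x [c, d], counterclockwise, written with real
    parameters so that only integrals in a real variable occur. *)
Definition rect (f : C -> C) (a b c d : R) : C :=
  (hseg f c a b - hseg f d a b + Ci * (vseg f b c d - vseg f a c d))%C.

Lemma Rcont_hline (f : C -> C) (c t : R) : (forall z, Ccont f z) -> Rcont (fun t => f (t, c)) t.
Proof.
intros Hf; apply (Rcont_comp_Ccont f (fun t => (t, c))); [|apply Hf].
eapply is_Cderive_Rcont, is_Cderive_pair; auto_derive; auto.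
Qed.

Lemma Rcont_vline (f : C -> C) (a t : R) : (forall z, Ccont f z) -> Rcont (fun t => f (a, t)) t.
Proof.
intros Hf; apply (Rcont_comp_Ccont f (fun t => (a, t))); [|apply Hf].
eapply is_Cderive_Rcont, is_Cderive_pair; auto_derive; auto.
Qed.

Lemma hseg_correct (f : C -> C) (c a b : R) : (forall z, Ccont f z) ->
  is_CRInt (fun t => f (t, c)) a b (hseg f c a b).
Proof. intros Hf; apply CRInt_correct, ex_CRInt_cont; intros; apply Rcont_hline, Hf. Qed.

Lemma vseg_correct (f : C -> C) (a c d : R) : (forall z, Ccont f z) ->
  is_CRInt (fun t => f (a, t)) c d (vseg f a c d).
Proof. intros Hf; apply CRInt_correct, ex_CRInt_cont; intros; apply Rcont_vline, Hf. Qed.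

Lemma is_CRInt_Chasles (f : R -> C) (a b c : R) (l m : C) :
  is_CRInt f a b l -> is_CRInt f b c m -> is_CRInt f a c (l + m)%C.
Proof. apply (is_RInt_Chasles (V := C_R_NormedModule)). Qed.

Lemma hseg_Chasles (f : C -> C) (c a m b : R) : (forall z, Ccont f z) ->
  hseg f c a b = (hseg f c a m + hseg f c m b)%C.
Proof.
intros Hf; apply CRInt_unique; apply is_CRInt_Chasles with m; apply hseg_correct, Hf.
Qed.

Lemma vseg_Chasles (f : C -> C) (a c m d : R) : (forall z, Ccont f z) ->
  vseg f a c d = (vseg f a c m + vseg f a m d)%C.
Proof.
intros Hf; apply CRInt_unique; apply is_CRInt_Chasles with m; apply vseg_correct, Hf.
Qed.

(** The inner edges are traversed twice, in opposite directions. *)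
Lemma rect_quarters (f : C -> C) (a m b c n d : R) : (forall z, Ccont f z) ->
  rect f a b c d =
    (rect f a m c n + rect f m b c n + rect f a m n d + rect f m b n d)%C.
Proof.
intros Hf; unfold rect.
rewrite (hseg_Chasles f c a m b), (hseg_Chasles f d a m b),
  (vseg_Chasles f a c n d), (vseg_Chasles f b c n d) by exact Hf.
ring.
Qed.

(** The primitive is al z + be z^2 / 2; inside the proof the real and imaginary parts of z^2 / 2 are
    written out so that they can be differentiated in t. *)
Lemma hseg_affine (al be : C) (c a b : R) :
  is_CRInt (fun t => al + be * (t, c))%C a b
    ((al * (b, c) + be * ((b, c) * (b, c)) / 2) - (al * (a, c) + be * ((a, c) * (a, c)) / 2))%C.
Proof.
apply (is_CRInt_derive (fun t => al * (t, c) + be * ((t, c) * (t, c)) / 2)%C).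
- intros t _.
  apply is_Cderive_ext with (f := fun t => (al * (t, c) + be * (((t * t - c * c) / 2)%R, (t * c)%R))%C)
    (l := (al * (1, 0) + be * (t, c))%C).
  + intros u; apply Ceq; unfold Cdiv, Cinv; simpl; field.
  + apply Ceq; simpl; ring.
  + apply is_Cderive_plus; apply is_Cderive_Cmult, is_Cderive_pair; auto_derive; auto; field.
- intros t _; apply Rcont_plus; [apply Rcont_const|apply Rcont_mult; [apply Rcont_const|]].
  eapply is_Cderive_Rcont, is_Cderive_pair; auto_derive; auto.
Qed.

Lemma vseg_affine (al be : C) (a c d : R) :
  is_CRInt (fun t => Ci * (al + be * (a, t)))%C c d
    ((al * (a, d) + be * ((a, d) * (a, d)) / 2) - (al * (a, c) + be * ((a, c) * (a, c)) / 2))%C.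
Proof.
apply (is_CRInt_derive (fun t => al * (a, t) + be * ((a, t) * (a, t)) / 2)%C).
- intros t _.
  apply is_Cderive_ext with (f := fun t => (al * (a, t) + be * (((a * a - t * t) / 2)%R, (a * t)%R))%C)
    (l := (al * (0, 1) + be * ((- t)%R, a))%C).
  + intros u; apply Ceq; unfold Cdiv, Cinv; simpl; field.
  + apply Ceq; unfold Ci; simpl; ring.
  + apply is_Cderive_plus; apply is_Cderive_Cmult, is_Cderive_pair; auto_derive; auto; field.
- intros t _; apply Rcont_mult; [apply Rcont_const|].
  apply Rcont_plus; [apply Rcont_const|apply Rcont_mult; [apply Rcont_const|]].
  eapply is_Cderive_Rcont, is_Cderive_pair; auto_derive; auto.
Qed.

(** Subtracting the affine function changes each side by a difference of corner values of its
    primitive. These cancel around the rectangle, so only an error of size [K] is integrated, over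
    the perimeter. *)
Lemma rect_bound_affine (f : C -> C) (al be : C) (a b c d K : R) :
  (forall z, Ccont f z) -> a <= b -> c <= d ->
  (forall x y, a <= x <= b -> c <= y <= d -> Cmod (f (x, y) - (al + be * (x, y))) <= K) ->
  Cmod (rect f a b c d) <= 2 * K * ((b - a) + (d - c)).
Proof.
intros Hf Hab Hcd HK.
set (P := fun z => (al * z + be * (z * z) / 2)%C).
assert (Hh : forall y, c <= y <= d ->
  Cmod (hseg f y a b - (P (b, y) - P (a, y))) <= (b - a) * K).
{ intros y Hy; apply is_CRInt_bound with (f := fun t => (f (t, y) - (al + be * (t, y)))%C); auto.
  apply is_CRInt_minus; [apply hseg_correct, Hf|apply hseg_affine]. }
assert (Hv : forall x, a <= x <= b ->
  Cmod (Ci * vseg f x c d - (P (x, d) - P (x, c))) <= (d - c) * K).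
{ intros x Hx; apply is_CRInt_bound
    with (f := fun t => (Ci * f (x, t) - Ci * (al + be * (x, t)))%C); auto.
  - intros t Ht; replace (Ci * f (x, t) - Ci * (al + be * (x, t)))%C
      with (Ci * (f (x, t) - (al + be * (x, t))))%C by ring.
    rewrite Cmod_mult, Cmod_Ci, Rmult_1_l; auto.
  - apply is_CRInt_minus; [apply is_CRInt_Cmult, vseg_correct, Hf|apply vseg_affine]. }
replace (rect f a b c d) with
  ((hseg f c a b - (P (b, c) - P (a, c))) + - (hseg f d a b - (P (b, d) - P (a, d)))
   + ((Ci * vseg f b c d - (P (b, d) - P (b, c)))
   + - (Ci * vseg f a c d - (P (a, d) - P (a, c)))))%C by (unfold rect; ring).
eapply Rle_trans; [apply Cmod_triangle|].
eapply Rle_trans; [apply Rplus_le_compat; apply Cmod_triangle|].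
rewrite !Cmod_opp.
generalize (Hh c ltac:(lra)) (Hh d ltac:(lra)) (Hv a ltac:(lra)) (Hv b ltac:(lra)); lra.
Qed.

Record box := Box { bl : R; br : R; bb : R; bt : R }.

Definition rect_box (f : C -> C) (Q : box) : C := rect f (bl Q) (br Q) (bb Q) (bt Q).

Definition halves (f : C -> C) (Q Q' : box) : Prop :=
  bl Q <= bl Q' /\ br Q' <= br Q /\ bb Q <= bb Q' /\ bt Q' <= bt Q /\
  br Q' - bl Q' = (br Q - bl Q) / 2 /\ bt Q' - bb Q' = (bt Q - bb Q) / 2 /\
  Cmod (rect_box f Q) <= 4 * Cmod (rect_box f Q').

(** By the triangle inequality one quarter carries at least a fourth of the integral. [Q'] is
    asserted before the order hypotheses so that [choice] yields a map defined on all boxes. *)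
Lemma exists_half (f : C -> C) : (forall z, Ccont f z) ->
  forall Q, exists Q', bl Q <= br Q -> bb Q <= bt Q -> halves f Q Q'.
Proof.
intros Hf Q; destruct Q as [a b c d]; set (m := (a + b) / 2); set (n := (c + d) / 2).
assert (E := rect_quarters f a m b c n d Hf).
assert (T : Cmod (rect f a b c d) <=
  Cmod (rect f a m c n) + Cmod (rect f m b c n) + Cmod (rect f a m n d) + Cmod (rect f m b n d)).
{ rewrite E; eapply Rle_trans; [apply Cmod_triangle|]; apply Rplus_le_compat_r.
  eapply Rle_trans; [apply Cmod_triangle|]; apply Rplus_le_compat_r, Cmod_triangle. }
unfold halves, rect_box; simpl.
destruct (Rle_dec (Cmod (rect f a b c d)) (4 * Cmod (rect f a m c n))).
{ exists (Box a m c n); simpl; intros; unfold m, n in *; repeat split; lra. }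
destruct (Rle_dec (Cmod (rect f a b c d)) (4 * Cmod (rect f m b c n))).
{ exists (Box m b c n); simpl; intros; unfold m, n in *; repeat split; lra. }
destruct (Rle_dec (Cmod (rect f a b c d)) (4 * Cmod (rect f a m n d))).
{ exists (Box a m n d); simpl; intros; unfold m, n in *; repeat split; lra. }
exists (Box m b n d); simpl; intros; unfold m, n in *; repeat split; lra.
Qed.

Lemma nested_point (l r : nat -> R) :
  (forall n, l n <= l (S n)) -> (forall n, r (S n) <= r n) -> (forall n, l n <= r n) ->
  exists x, forall n, l n <= x <= r n.
Proof.
intros Hl Hr Hlr.
assert (Ml : forall n k, l n <= l (k + n)%nat)
  by (intros n; induction k; simpl; [lra|generalize (Hl (k + n)%nat); lra]).
assert (Mr : forall n k, r (k + n)%nat <= r n)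
  by (intros n; induction k; simpl; [lra|generalize (Hr (k + n)%nat); lra]).
assert (X : forall m n, l m <= r n).
{ intros m n; eapply Rle_trans; [apply (Ml m n)|]; rewrite Nat.add_comm.
  eapply Rle_trans; [apply Hlr|apply Mr]. }
destruct (completeness (fun x => exists n, x = l n)) as [x [Hub Hlub]].
- exists (r 0%nat); intros y [n ->]; apply X.
- exists (l 0%nat), 0%nat; reflexivity.
- exists x; intros n; split; [apply Hub; exists n; reflexivity|].
  apply Hlub; intros y [m ->]; apply X.
Qed.

Theorem Goursat (f : C -> C) (a b c d : R) :
  (forall z, Cdiff f z) -> a <= b -> c <= d -> rect f a b c d = RtoC 0.
Proof.
intros Hf Hab Hcd.
assert (Hc : forall z, Ccont f z) by (intros z; apply Cdiff_Ccont, Hf).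
destruct (choice _ (exists_half f Hc)) as [nxt Hnxt].
set (Q := fun n => Nat.iter n nxt (Box a b c d)).
assert (HW : forall n, br (Q n) - bl (Q n) = (b - a) / 2 ^ n /\
  bt (Q n) - bb (Q n) = (d - c) / 2 ^ n).
{ induction n as [|n [IH1 IH2]]; [simpl; split; field|].
  assert (P : 0 < 2 ^ n) by (apply pow_lt; lra).
  assert (0 <= (b - a) / 2 ^ n) by (apply Rdiv_le_0_compat; lra).
  assert (0 <= (d - c) / 2 ^ n) by (apply Rdiv_le_0_compat; lra).
  destruct (Hnxt (Q n)) as [_ [_ [_ [_ [E1 [E2 _]]]]]]; try lra.
  change (Q (S n)) with (nxt (Q n)); rewrite E1, E2, IH1, IH2; simpl.
  split; field; lra. }
assert (Hv : forall n, bl (Q n) <= br (Q n) /\ bb (Q n) <= bt (Q n)).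
{ intros n; destruct (HW n); assert (P : 0 < 2 ^ n) by (apply pow_lt; lra).
  assert (0 <= (b - a) / 2 ^ n) by (apply Rdiv_le_0_compat; lra).
  assert (0 <= (d - c) / 2 ^ n) by (apply Rdiv_le_0_compat; lra).
  lra. }
assert (Hh : forall n, halves f (Q n) (Q (S n))) by (intros n; apply Hnxt; apply Hv).
destruct (nested_point (fun n => bl (Q n)) (fun n => br (Q n))) as [x Hx];
  [intros n; destruct (Hh n) as (?&?&?&?&?); lra ..|intros n; apply Hv|].
destruct (nested_point (fun n => bb (Q n)) (fun n => bt (Q n))) as [y Hy];
  [intros n; destruct (Hh n) as (?&?&?&?&?); lra ..|intros n; apply Hv|].
assert (HI : forall n, Cmod (rect f a b c d) <= 4 ^ n * Cmod (rect_box f (Q n))).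
{ induction n; [simpl; unfold rect_box; simpl; lra|].
  destruct (Hh n) as (_&_&_&_&_&_&H).
  assert (P : 0 < 4 ^ n) by (apply pow_lt; lra); simpl pow.
  eapply Rle_trans; [exact IHn|].
  replace (4 * 4 ^ n * Cmod (rect_box f (Q (S n))))
    with (4 ^ n * (4 * Cmod (rect_box f (Q (S n))))) by ring.
  apply Rmult_le_compat_l; [lra|exact H]. }
set (L := (b - a) + (d - c)).
apply Cmod_small_0; intros eps He.
(* After n bisections a factor 4^n is lost, while the affine bound gives 2 e (L / 2^n)^2; the powers
   cancel and leave 2 e L^2. The summand 1 covers a degenerate rectangle with L = 0. *)
set (e := eps / (2 * (L * L) + 1)).
assert (HLL : 0 <= L * L) by apply Rle_0_sqr.
assert (He' : 0 < e) by (apply Rdiv_lt_0_compat; lra).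
destruct (Hf (x, y)) as [q [Hq [r [Hr Hfq]]]].
destruct (Hq e He') as [r' [Hr' Hq']].
assert (Hmin : 0 < Rmin r r') by (apply Rmin_case; lra).
(* With this [n] the box, of half-perimeter L / 2^n, lies where the slope function stays within [e]
   of its value at (x, y). *)
destruct (pow_lt_1_zero (1/2) ltac:(rewrite Rabs_right; lra) (Rmin r r' / (L + 1)))
  as [n Hn]; [apply Rdiv_lt_0_compat; unfold L in *; lra|].
specialize (Hn n (Nat.le_refl _)).
assert (P : 0 < 2 ^ n) by (apply pow_lt; lra).
assert (HLn : L / 2 ^ n < Rmin r r').
{ rewrite Rabs_right in Hn by (apply Rle_ge, pow_le; lra).
  assert (E : (1 / 2) ^ n = / 2 ^ n) by (unfold Rdiv; rewrite Rmult_1_l, pow_inv; reflexivity).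
  rewrite E in Hn; apply Rle_lt_trans with ((L + 1) * / 2 ^ n).
  - apply Rmult_le_compat_r; [apply Rlt_le, Rinv_0_lt_compat, P|lra].
  - apply Rmult_lt_reg_r with (/ (L + 1)); [apply Rinv_0_lt_compat; unfold L; lra|].
    replace ((L + 1) * / 2 ^ n * / (L + 1)) with (/ 2 ^ n) by (field; unfold L; lra).
    exact Hn. }
destruct (HW n) as [W1 W2]; destruct (Hv n) as [V1 V2].
specialize (Hx n); specialize (Hy n); simpl in Hx, Hy.
assert (B : Cmod (rect_box f (Q n)) <= 2 * (e * (L / 2 ^ n)) * (L / 2 ^ n)).
{ replace (2 * (e * (L / 2 ^ n)) * (L / 2 ^ n)) with
    (2 * (e * (L / 2 ^ n)) * ((br (Q n) - bl (Q n)) + (bt (Q n) - bb (Q n))))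
    by (rewrite W1, W2; unfold L; field; lra).
  unfold rect_box; apply rect_bound_affine with (al := (f (x, y) - (x, y) * q (x, y))%C) (be := q (x, y)); auto.
  intros u w Hu Hw.
  assert (D : Cmod ((u, w) - (x, y)) <= L / 2 ^ n).
  { eapply Rle_trans; [apply Cmod_le_Re_Im|].
    replace (L / 2 ^ n) with ((b - a) / 2 ^ n + (d - c) / 2 ^ n) by (unfold L; field; lra).
    rewrite <- W1, <- W2; simpl; apply Rplus_le_compat; apply Rabs_le; lra. }
  generalize (Rmin_l r r') (Rmin_r r r'); intros.
  rewrite (Hfq (u, w)) by lra.
  replace (f (x, y) + ((u, w) - (x, y)) * q (u, w)
    - (f (x, y) - (x, y) * q (x, y) + q (x, y) * (u, w)))%C
    with ((q (u, w) - q (x, y)) * ((u, w) - (x, y)))%C by ring.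
  rewrite Cmod_mult; apply Rmult_le_compat; try apply Cmod_ge_0; [|exact D].
  apply Rlt_le, Hq'; lra. }
eapply Rle_trans; [apply (HI n)|].
apply Rle_trans with (4 ^ n * (2 * (e * (L / 2 ^ n)) * (L / 2 ^ n))).
- apply Rmult_le_compat_l; [apply pow_le; lra|exact B].
- replace (4 ^ n) with (2 ^ n * 2 ^ n) by (rewrite <- Rpow_mult_distr; f_equal; lra).
  replace (2 ^ n * 2 ^ n * (2 * (e * (L / 2 ^ n)) * (L / 2 ^ n))) with (e * (2 * (L * L)))
    by (field; lra).
  replace eps with (e * (2 * (L * L) + 1)) by (unfold e; field; lra).
  apply Rmult_le_compat_l; lra.
Qed.

(** * Gaussian weights and the identity theorem *)

Lemma bounded_on (f : R -> C) (a b : R) :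
  (forall t, a <= t <= b -> Rcont f t) ->
  exists M, 0 < M /\ forall t, a <= t <= b -> Cmod (f t) <= M.
Proof.
intros Hf.
destruct (bounded_continuity (V := C_R_NormedModule) f a b Hf) as [M HM].
exists (Rabs M + 1); split; [generalize (Rabs_pos M); lra|]; intros t Ht.
specialize (HM t Ht); rewrite norm_C_R in HM; generalize (Rle_abs M); lra.
Qed.

(** A weak form of Laplace's method. Below, p is bounded by 1/2 - K t^2, and the second moment of
    the Gaussian is expressed by its mass through the derivative of t exp(-N t^2). For N >= 2K at
    least a quarter of the mass remains. *)
Lemma gaussian_lower (p : R -> R) (tau : R) : 0 < tau ->
  (forall t, continuous p t) -> p 0 = 1 ->
  exists N0, 0 < N0 /\ forall N, N0 <= N ->
    tau / 2 * exp (- N * tau ^ 2) <= RInt (fun t => p t * exp (- N * t ^ 2)) (- (2 * tau)) (2 * tau).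
Proof.
intros Ht Hp H0; set (D := 2 * tau).
assert (HD : 0 < D) by (unfold D; lra).
destruct (bounded_on (fun t => RtoC (p t)) (- D) D) as [M [HM HMp]];
  [intros; apply Rcont_RtoC, Hp|].
destruct (proj1 (filterlim_locally p (p 0)) (Hp 0) (mkposreal (1/2) ltac:(lra))) as [eta Heta].
simpl in Heta; assert (He := cond_pos eta).
(* Near 0, p exceeds 1/2 by continuity; for |t| >= eta this [K] makes K t^2 >= M + 1/2, while p >=
   -M. *)
set (K := (M + 1/2) / eta ^ 2).
assert (Hee : 0 < eta ^ 2) by (apply pow_lt; lra).
assert (HK : 0 < K) by (apply Rdiv_lt_0_compat; lra).
assert (Hpl : forall t, - D <= t <= D -> 1/2 - K * t ^ 2 <= p t).
{ intros t Htd; destruct (Rlt_dec (Rabs t) eta) as [Hl|Hl].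
  - assert (HB : Rabs (p t - p 0) < 1/2).
    { apply (Heta t); change (Rabs (t - 0) < eta); rewrite Rminus_0_r; exact Hl. }
    rewrite H0 in HB; apply Rabs_def2 in HB.
    generalize (pow2_ge_0 t); nra.
  - specialize (HMp t Htd); rewrite Cmod_R in HMp.
    assert (eta ^ 2 <= t ^ 2).
    { rewrite <- (pow2_abs t); apply pow_incr; lra. }
    assert (M + 1/2 <= K * t ^ 2).
    { replace (M + 1/2) with (K * eta ^ 2) by (unfold K; field; lra).
      apply Rmult_le_compat_l; lra. }
    generalize (Rle_abs (- p t)); rewrite Rabs_Ropp; lra. }
exists (2 * K); split; [lra|]; intros N HN; assert (HN0 : 0 < N) by lra.
assert (Hce : forall t, continuous (fun t => exp (- N * t ^ 2)) t).
{ intros t; apply continuous_of_ex_derive; auto_derive; auto. }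
assert (Ice : forall a b, ex_RInt (fun t => exp (- N * t ^ 2)) a b).
{ intros; apply (ex_RInt_continuous (V := R_CompleteNormedModule)); intros; apply Hce. }
set (J := RInt (fun t => exp (- N * t ^ 2)) (- D) D).
assert (HJ : tau * 2 * exp (- N * tau ^ 2) <= J).
{ unfold J.
  rewrite <- (RInt_Chasles (fun t => exp (- N * t ^ 2)) (- D) (- tau) D) by apply Ice.
  rewrite <- (RInt_Chasles (fun t => exp (- N * t ^ 2)) (- tau) tau D) by apply Ice.
  assert (P : forall a b, a <= b -> 0 <= RInt (fun t => exp (- N * t ^ 2)) a b).
  { intros; apply RInt_ge_0; auto; intros; apply Rlt_le, exp_pos. }
  assert (P1 := P (- D) (- tau) ltac:(unfold D; lra)).
  assert (P2 := P tau D ltac:(unfold D; lra)).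
  assert (P3 : tau * 2 * exp (- N * tau ^ 2) <= RInt (fun t => exp (- N * t ^ 2)) (- tau) tau).
  { replace (tau * 2 * exp (- N * tau ^ 2)) with (RInt (fun _ => exp (- N * tau ^ 2)) (- tau) tau)
      by (rewrite RInt_const; unfold scal; simpl; unfold mult; simpl; ring).
    apply RInt_le; [lra|apply ex_RInt_const|apply Ice|].
    intros t Htt; apply exp_le.
    assert (0 <= N * ((tau - t) * (tau + t))) by (repeat apply Rmult_le_pos; lra); lra. }
  set (x1 := RInt _ (- D) (- tau)) in *; set (x2 := RInt _ (- tau) tau) in *.
  set (x3 := RInt _ tau D) in *.
  change (tau * 2 * exp (- N * tau ^ 2) <= x1 + (x2 + x3)); lra. }
assert (HI : is_RInt (fun t => (1/2 - K * t ^ 2) * exp (- N * t ^ 2)) (- D) D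
  ((1/2 - K / (2 * N)) * J + K / (2 * N) * (2 * D * exp (- N * D ^ 2)))).
{ assert (I2 : is_RInt (fun t => (1 - 2 * N * t ^ 2) * exp (- N * t ^ 2)) (- D) D
    (2 * D * exp (- N * D ^ 2))).
  { replace (2 * D * exp (- N * D ^ 2)) with
      (minus (D * exp (- N * D ^ 2)) (- D * exp (- N * (- D) ^ 2)))
      by (unfold minus, plus, opp; simpl; replace (- D * (- D * 1)) with (D * (D * 1)) by ring; ring).
    apply (is_RInt_derive (V := R_CompleteNormedModule) (fun t => t * exp (- N * t ^ 2))).
    - intros t _; auto_derive; auto; change (t * (t * 1)) with (t ^ 2); ring.
    - intros t _; apply continuous_of_ex_derive; auto_derive; auto. }
  apply is_RInt_ext with (fun t => plus (scal (1/2 - K / (2 * N)) (exp (- N * t ^ 2)))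
    (scal (K / (2 * N)) ((1 - 2 * N * t ^ 2) * exp (- N * t ^ 2)))).
  - intros t _; unfold plus, scal; simpl; unfold mult; simpl; field; lra.
  - apply (is_RInt_plus (V := R_NormedModule)); apply (is_RInt_scal (V := R_NormedModule)); auto.
    apply (RInt_correct (V := R_CompleteNormedModule)), Ice. }
assert (HKN : K / (2 * N) <= 1/4).
{ apply Rmult_le_reg_r with (2 * N); [lra|].
  unfold Rdiv at 1; rewrite Rmult_assoc, Rinv_l by lra; lra. }
apply Rle_trans with ((1/2 - K / (2 * N)) * J + K / (2 * N) * (2 * D * exp (- N * D ^ 2))).
- assert (0 < exp (- N * D ^ 2)) by apply exp_pos.
  assert (0 < exp (- N * tau ^ 2)) by apply exp_pos.
  assert (0 < K / (2 * N)) by (apply Rdiv_lt_0_compat; lra).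
  assert (0 <= K / (2 * N) * (2 * D * exp (- N * D ^ 2)))
    by (apply Rmult_le_pos; [lra|apply Rmult_le_pos; lra]).
  assert (0 < tau * 2 * exp (- N * tau ^ 2)) by (apply Rmult_lt_0_compat; lra).
  nra.
- rewrite <- (is_RInt_unique _ _ _ _ HI); apply RInt_le; [lra|eexists; exact HI| |].
  + apply (ex_RInt_continuous (V := R_CompleteNormedModule)); intros t _.
    apply (continuous_mult p (fun t => exp (- N * t ^ 2))); auto.
  + intros t Htd; apply Rmult_le_compat_r; [apply Rlt_le, exp_pos|apply Hpl; lra].
Qed.

(* Integrate [G w * exp (- N (w - i tau)^2)] around the rectangle
   [-2 tau, 2 tau] x [0, tau]: as [N] grows the vertical sides are negligible
   against the mass of the Gaussian on the top side. *)
Lemma entire_zero_above (G : C -> C) (tau : R) : 0 < tau ->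
  (forall w, Cdiff G w) -> (forall x : R, G (RtoC x) = RtoC 0) -> G (0, tau) = RtoC 0.
Proof.
intros Ht HG H0; destruct (Ceq_dec (G (0, tau)) (RtoC 0)) as [|Hn]; [assumption|exfalso].
set (g := G (0, tau)) in *.
assert (Hc : forall z, Ccont G z) by (intros z; apply Cdiff_Ccont, HG).
set (p := fun t => Re (/ g * G (t, tau))%C).
assert (Hp : forall t, continuous p t).
{ intros t; apply (filterlim_comp _ _ _ (fun t => / g * G (t, tau))%C fst _
    (locally (T := C_UniformSpace) (/ g * G (t, tau))%C)).
  - apply Rcont_mult; [apply Rcont_const|apply Rcont_hline, Hc].
  - apply (continuous_fst (U := R_UniformSpace) (V := R_UniformSpace)). }
destruct (gaussian_lower p tau Ht Hp) as [N0 [HN0 HN]].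
{ unfold p; fold g; rewrite Cinv_l by exact Hn; reflexivity. }
set (D := 2 * tau) in *.
destruct (bounded_on (fun t => G (- D, t)) 0 tau) as [M1 [HM1 HM1']];
  [intros; apply Rcont_vline, Hc|].
destruct (bounded_on (fun t => G (D, t)) 0 tau) as [M2 [HM2 HM2']];
  [intros; apply Rcont_vline, Hc|].
assert (Hg : 0 < Cmod g) by (apply Cmod_gt_0, Hn).
set (A := 2 * (M1 + M2) / Cmod g).
assert (HA : 0 < A) by (apply Rdiv_lt_0_compat; lra).
(* The estimates below lead to exp(2 N tau^2) <= A; together with A <= 2 N tau^2 this contradicts
   exp u > 1 + u. *)
set (N := Rmax N0 (A / (2 * tau ^ 2))).
assert (Htt : 0 < tau ^ 2) by (apply pow_lt; lra).
assert (HNN : N0 <= N) by apply Rmax_l.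
assert (HNA : A <= 2 * N * tau ^ 2).
{ replace A with (2 * tau ^ 2 * (A / (2 * tau ^ 2))) by (field; lra).
  replace (2 * N * tau ^ 2) with (2 * tau ^ 2 * N) by ring.
  apply Rmult_le_compat_l; [lra|apply Rmax_r]. }
specialize (HN N HNN).
set (E := fun w => Cexp (- RtoC N * ((w - (0, tau)) * (w - (0, tau))))%C).
set (f := fun w => (G w * E w)%C).
assert (Hf : forall w, Cdiff f w).
{ intros w; apply Cdiff_mult; [apply HG|].
  apply (Cdiff_comp (fun w => - RtoC N * ((w - (0, tau)) * (w - (0, tau))))%C Cexp);
    [|apply Cdiff_Cexp].
  apply Cdiff_scal, Cdiff_mult; apply Cdiff_minus; try apply Cdiff_id; apply Cdiff_const. }
assert (Hfc : forall z, Ccont f z) by (intros z; apply Cdiff_Ccont, Hf).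
assert (HE : forall x y, Cmod (E (x, y)) = exp (- N * (x ^ 2 - (y - tau) ^ 2))).
{ intros x y; unfold E; rewrite Cmod_Cexp; f_equal; simpl; ring. }
assert (R0 := Goursat f (- D) D 0 tau Hf ltac:(unfold D; lra) ltac:(lra)).
assert (Hbot : hseg f 0 (- D) D = RtoC 0).
{ apply CRInt_unique; apply is_CRInt_ext with (fun _ => RtoC 0).
  - intros t _; unfold f; change (t, 0) with (RtoC t); rewrite H0; ring.
  - assert (I0 := is_RInt_const (V := C_R_NormedModule) (- D) D (RtoC 0)).
    rewrite scal_R_Cmult, Cmult_0_r in I0; exact I0. }
(* On these sides the exponent has real part -N (4 tau^2 - (y - tau)^2) <= -3 N tau^2, while the top
   side is at least of order exp(-N tau^2). *)
assert (Hside : forall (x M : R), x ^ 2 = D ^ 2 -> 0 < M ->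
  (forall t, 0 <= t <= tau -> Cmod (G (x, t)) <= M) ->
  Cmod (vseg f x 0 tau) <= tau * (M * exp (- N * (3 * tau ^ 2)))).
{ intros x M Hx HM HMt; replace tau with (tau - 0) at 2 by ring.
  apply is_CRInt_bound with (f := fun t => f (x, t)); [lra| |apply vseg_correct, Hfc].
  intros t Htt'; unfold f; rewrite Cmod_mult, HE.
  apply Rmult_le_compat; [apply Cmod_ge_0|apply Rlt_le, exp_pos|auto|].
  apply exp_le; rewrite Hx; unfold D.
  assert (0 <= N * (t * (2 * tau - t))) by (repeat apply Rmult_le_pos; lra); lra. }
assert (Htop : hseg f tau (- D) D = (Ci * (vseg f D 0 tau - vseg f (- D) 0 tau))%C).
{ unfold rect in R0; rewrite Hbot in R0.
  apply Ceq_minus; rewrite <- Copp_0, <- R0; ring. }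
assert (Hm : Cmod (hseg f tau (- D) D) <= tau * (M1 + M2) * exp (- N * (3 * tau ^ 2))).
{ rewrite Htop, Cmod_mult, Cmod_Ci, Rmult_1_l.
  eapply Rle_trans; [apply Cmod_triangle|]; rewrite Cmod_opp.
  assert (S1 := Hside D M2 eq_refl HM2 HM2').
  assert (S2 := Hside (- D) M1 ltac:(ring) HM1 HM1').
  lra. }
assert (HI : is_RInt (fun t => p t * exp (- N * t ^ 2)) (- D) D (Re (/ g * hseg f tau (- D) D)%C)).
{ assert (HI := is_RInt_fct_extend_fst _ _ _ _
    (is_CRInt_Cmult (/ g) _ _ _ _ (hseg_correct f tau (- D) D Hfc))).
  eapply is_RInt_ext; [|exact HI].
  intros t _; unfold p, f.
  replace (E (t, tau)) with (RtoC (exp (- N * t ^ 2))).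
  - rewrite Cmult_assoc; apply re_scal_r.
  - unfold E; rewrite <- Cexp_RtoC; f_equal; apply Ceq; simpl; ring. }
rewrite (is_RInt_unique _ _ _ _ HI) in HN.
assert (HU : Re (/ g * hseg f tau (- D) D)%C <= / Cmod g * (tau * (M1 + M2) * exp (- N * (3 * tau ^ 2)))).
{ eapply Rle_trans; [apply Rle_abs|]; eapply Rle_trans; [apply re_le_Cmod|].
  rewrite Cmod_mult, Cmod_inv by exact Hn.
  apply Rmult_le_compat_l; [apply Rlt_le, Rinv_0_lt_compat, Hg|exact Hm]. }
assert (X : tau / 2 * exp (- N * tau ^ 2) <= tau / 2 * (A * exp (- N * (3 * tau ^ 2)))).
{ eapply Rle_trans; [exact HN|]; eapply Rle_trans; [exact HU|].
  right; unfold A; field; lra. }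
apply Rmult_le_reg_l in X; [|lra].
assert (Y : exp (2 * N * tau ^ 2) <= A).
{ apply Rmult_le_reg_r with (exp (- N * (3 * tau ^ 2))); [apply exp_pos|].
  rewrite <- exp_plus; eapply Rle_trans; [|exact X]; apply exp_le; lra. }
generalize (exp_ineq1 (2 * N * tau ^ 2)); intros Z.
assert (0 < N) by lra.
assert (0 < 2 * N * tau ^ 2) by (apply Rmult_lt_0_compat; lra).
specialize (Z ltac:(lra)); lra.
Qed.

Lemma polar (z : C) : z <> RtoC 0 -> exists w, 0 < Im w /\ Cexp w = z.
Proof.
intros Hz; set (r := Cmod z); assert (Hr : 0 < r) by (apply Cmod_gt_0, Hz).
assert (E2 : Re z ^ 2 + Im z ^ 2 = r ^ 2) by (symmetry; apply Cmod2_alt).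
set (c := Re z / r); set (s := Im z / r).
assert (Hcs : c ^ 2 + s ^ 2 = 1).
{ unfold c, s; replace ((Re z / r) ^ 2 + (Im z / r) ^ 2) with ((Re z ^ 2 + Im z ^ 2) / r ^ 2)
    by (field; lra); rewrite E2; field; lra. }
assert (Hc1 : -1 <= c <= 1) by (split; nra).
(* A full turn is added to make the argument positive, because [entire_zero_above] reaches only the
   upper half-plane. *)
assert (T : exists th, 0 < th /\ cos th = c /\ sin th = s).
{ assert (Hs : sqrt (1 - Rsqr c) = Rabs s).
  { rewrite <- sqrt_Rsqr_abs; f_equal; unfold Rsqr; lra. }
  generalize (acos_bound c) PI_RGT_0; intros Hb HPI.
  destruct (Rle_dec 0 s) as [Hs0|Hs0].
  - exists (acos c + 2 * PI); rewrite cos_plus, sin_plus, cos_2PI, sin_2PI, !Rmult_0_r, !Rmult_1_r, Rminus_0_r, Rplus_0_r.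
    repeat split; [lra|apply cos_acos; lra|].
    rewrite sin_acos, Hs, Rabs_right by lra; reflexivity.
  - exists (- acos c + 2 * PI); rewrite cos_plus, sin_plus, cos_2PI, sin_2PI, !Rmult_0_r, !Rmult_1_r, Rminus_0_r, Rplus_0_r.
    rewrite cos_neg, sin_neg; repeat split; [lra|apply cos_acos; lra|].
    rewrite sin_acos, Hs, Rabs_left by lra; ring. }
destruct T as [th [Hth [Ec Es]]].
exists (ln r, th); split; [exact Hth|].
unfold Cexp; simpl; rewrite exp_ln, Ec, Es by exact Hr.
apply Ceq; simpl; unfold c, s; field; lra.
Qed.

(** u -> 1 + exp u maps the plane onto the plane without 1, and the real line into Re s > 1. A real
    translation brings the chosen logarithm of s - 1 to the imaginary axis, where
    [entire_zero_above] applies. *)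
Lemma identity_theorem_punctured (h : C -> C) :
  (forall s, s <> RtoC 1 -> Cdiff h s) -> (forall s, 1 < Re s -> h s = RtoC 0) ->
  forall s, s <> RtoC 1 -> h s = RtoC 0.
Proof.
intros Hd H0 s Hs.
destruct (polar (s - 1)%C) as [w [Hw E]]; [apply Cminus_eq_contra, Hs|].
assert (N1 : forall u, (1 + Cexp u)%C <> RtoC 1).
{ intros u Hu; apply (Cexp_neq_0 u).
  replace (Cexp u) with (1 + Cexp u - 1)%C by ring; rewrite Hu; ring. }
set (G := fun u => h (1 + Cexp (u + RtoC (Re w)))%C).
assert (HG : G (0, Im w) = RtoC 0).
{ apply entire_zero_above; [exact Hw| |].
  - intros u; unfold G.
    apply (Cdiff_comp (fun u => 1 + Cexp (u + RtoC (Re w)))%C h); [|apply Hd, N1].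
    apply Cdiff_plus; [apply Cdiff_const|]; apply Cdiff_shift, Cdiff_Cexp.
  - intros x; unfold G; apply H0; rewrite <- RtoC_plus, Cexp_RtoC; simpl.
    generalize (exp_pos (x + Re w)); lra. }
unfold G in HG.
replace ((0, Im w) + RtoC (Re w))%C with w in HG by (apply Ceq; simpl; ring).
rewrite E in HG; replace (1 + (s - 1))%C with s in HG by ring; exact HG.
Qed.

(** * Euler polynomials *)

Lemma is_pseries_series (a : nat -> R) (t l : R) :
  is_pseries a t l <-> is_series (fun n => a n * t ^ n) l.
Proof.
assert (E : forall n, scal (V := R_NormedModule) (pow_n t n) (a n) = a n * t ^ n).
{ intros n; replace (pow_n t n) with (t ^ n) by (symmetry; apply pow_n_pow).
  apply Rmult_comm. }
split; apply is_series_ext; intros n; [|symmetry]; apply E.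
Qed.

Lemma CV_radius_ge (a : nat -> R) (x : R) : ex_pseries a x -> Rbar_le (Rabs x) (CV_radius a).
Proof.
intros [l H]; apply (proj1 (is_pseries_series _ _ _)) in H.
apply Rbar_not_lt_le; intros Hlt; apply (CV_disk_outside _ _ Hlt).
apply ex_series_lim_0; exists l; exact H.
Qed.

Lemma CV_radius_gt (a : nat -> R) (rho x : R) :
  (forall r, 0 <= r < rho -> ex_pseries a r) -> Rabs x < rho -> Rbar_lt (Rabs x) (CV_radius a).
Proof.
intros H Hx; apply Rbar_lt_le_trans with (Rabs ((Rabs x + rho) / 2)).
- simpl; generalize (Rabs_pos x); intros; rewrite (Rabs_right ((Rabs x + rho) / 2)); lra.
- apply CV_radius_ge, H; generalize (Rabs_pos x); lra.
Qed.

(** * Power series of tan and tanh *)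

Definition unit_coef (n : nat) : R := match n with O => 1 | S _ => 0 end.

Lemma is_pseries_unit (t : R) : is_pseries unit_coef t 1.
Proof.
apply (proj2 (is_pseries_series _ _ _)), is_series_decr_1.
match goal with |- is_series _ ?l => replace l with 0
  by (unfold plus, opp; simpl; ring) end.
apply is_series_ext with (fun n : nat => 0 * 0 ^ n).
- intros n; simpl; ring.
- apply (proj1 (is_pseries_series (fun _ => 0) 0 0)).
  assert (E : ex_pseries (fun _ : nat => 0) 0).
  { apply CV_radius_inside; rewrite CV_radius_const_0; simpl; auto. }
  apply PSeries_correct in E; rewrite PSeries_const_0 in E; exact E.
Qed.

(** Identities between Euler coefficients are proved below by comparing generating functions through
    this uniqueness. *)
Lemma is_pseries_coef_unique (a b : nat -> R) (F : R -> R) (rho : R) : 0 < rho ->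
  (forall t, Rabs t < rho -> is_pseries a t (F t)) ->
  (forall t, Rabs t < rho -> is_pseries b t (F t)) -> forall n, a n = b n.
Proof.
intros Hr Ha Hb n.
assert (P : forall c, (forall t, Rabs t < rho -> is_pseries c t (F t)) ->
  Rbar_lt 0 (CV_radius c)).
{ intros c Hc; replace (Finite 0) with (Finite (Rabs 0)) by (rewrite Rabs_R0; reflexivity).
  apply CV_radius_gt with rho; [|rewrite Rabs_R0; exact Hr].
  intros r Hr'; exists (F r); apply Hc; rewrite Rabs_right; lra. }
apply PSeries_ext_recip; [apply P, Ha|apply P, Hb|].
exists (mkposreal rho Hr); intros t Ht.
assert (Ht' : Rabs t < rho).
{ change (Rabs (t - 0) < rho) in Ht; rewrite Rminus_0_r in Ht; exact Ht. }
rewrite (is_pseries_unique _ _ _ (Ha t Ht')), (is_pseries_unique _ _ _ (Hb t Ht')); reflexivity.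
Qed.

Lemma sum_f_R0_nonneg (f : nat -> R) (n : nat) :
  (forall k, (k <= n)%nat -> 0 <= f k) -> 0 <= sum_f_R0 f n.
Proof.
induction n; intros H; simpl; [apply H; lia|].
specialize (IHn (fun k Hk => H k (Nat.le_trans _ _ _ Hk (Nat.le_succ_diag_r n)))).
generalize (H (S n) (Nat.le_refl _)); lra.
Qed.

(* Taylor coefficients of tan, from tan' = 1 + tan^2; [tan_upto N] is correct up to index [N]. *)
Fixpoint tan_upto (N : nat) : nat -> R :=
  match N with
  | O => fun _ => 0
  | S n => fun k => if Nat.leb k n then tan_upto n k
      else (unit_coef n + PS_mult (tan_upto n) (tan_upto n) n) / INR (S n)
  end.

Definition tan_coef (n : nat) : R := tan_upto n n.

Lemma tan_upto_stable (N k : nat) : (k <= N)%nat -> tan_upto N k = tan_coef k.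
Proof.
induction N; intros H.
- replace k with 0%nat by lia; reflexivity.
- destruct (Nat.eq_dec k (S N)) as [->|Hk]; [reflexivity|].
  change (tan_upto (S N) k) with (if Nat.leb k N then tan_upto N k
    else (unit_coef N + PS_mult (tan_upto N) (tan_upto N) N) / INR (S N)).
  rewrite (proj2 (Nat.leb_le k N)) by lia; apply IHN; lia.
Qed.

Lemma tan_coef_0 : tan_coef 0 = 0.
Proof. reflexivity. Qed.

Lemma tan_coef_S (n : nat) :
  INR (S n) * tan_coef (S n) = unit_coef n + PS_mult tan_coef tan_coef n.
Proof.
unfold tan_coef at 1.
change (tan_upto (S n) (S n)) with (if Nat.leb (S n) n then tan_upto n (S n)
  else (unit_coef n + PS_mult (tan_upto n) (tan_upto n) n) / INR (S n)).
rewrite (proj2 (Nat.leb_gt (S n) n)) by lia.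
replace (PS_mult (tan_upto n) (tan_upto n) n) with (PS_mult tan_coef tan_coef n).
- field; apply not_0_INR; lia.
- unfold PS_mult; apply sum_eq; intros i Hi; rewrite !tan_upto_stable by lia; reflexivity.
Qed.

(** In a convolution of odd order one of the two indices is always even, so every product vanishes
    by induction. *)
Lemma tan_coef_even (k : nat) : tan_coef (2 * k) = 0.
Proof.
induction k as [k IH] using lt_wf_ind.
destruct k as [|k]; [reflexivity|].
replace (2 * S k)%nat with (S (S (2 * k))) by lia.
apply Rmult_eq_reg_l with (INR (S (S (2 * k)))); [|apply not_0_INR; lia].
rewrite tan_coef_S, Rmult_0_r; simpl unit_coef; rewrite Rplus_0_l.
unfold PS_mult; rewrite (sum_eq _ (fun _ => 0)); [apply sum_eq_R0; auto|].
intros i Hi; destruct (Nat.Even_or_Odd i) as [[j ->]|[j ->]].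
- rewrite IH by lia; ring.
- replace (S (2 * k) - (2 * j + 1))%nat with (2 * (k - j))%nat by lia.
  rewrite (IH (k - j)%nat) by lia; ring.
Qed.

Lemma tan_coef_nonneg (n : nat) : 0 <= tan_coef n.
Proof.
induction n as [n IH] using lt_wf_ind.
destruct n as [|n]; [rewrite tan_coef_0; lra|].
assert (HI : 0 < INR (S n)) by (apply lt_0_INR; lia).
apply Rmult_le_reg_l with (INR (S n)); [exact HI|]; rewrite Rmult_0_r, tan_coef_S.
apply Rplus_le_le_0_compat; [destruct n; simpl; lra|].
apply sum_f_R0_nonneg; intros k Hk; apply Rmult_le_pos; apply IH; lia.
Qed.

Lemma tan_coef_1 : tan_coef 1 = 1.
Proof.
generalize (tan_coef_S 0); unfold PS_mult; simpl; rewrite tan_coef_0; lra.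
Qed.

(** All products in the recursion are nonnegative, and the one with indices 1 and m equals
    [tan_coef m], positive by induction. Strict positivity is what makes the poles of v genuine. *)
Lemma tan_coef_odd_pos (k : nat) : 0 < tan_coef (2 * k + 1).
Proof.
induction k; [simpl; rewrite tan_coef_1; lra|].
replace (2 * S k + 1)%nat with (S (S (2 * k + 1))) by lia.
set (m := (2 * k + 1)%nat) in *.
assert (HI : 0 < INR (S (S m))) by (apply lt_0_INR; lia).
apply Rmult_lt_reg_l with (INR (S (S m))); [exact HI|]; rewrite Rmult_0_r, tan_coef_S.
simpl unit_coef; rewrite Rplus_0_l; unfold PS_mult.
rewrite tech5, Nat.sub_diag, tan_coef_0, Rmult_0_r, Rplus_0_r.
destruct m as [|m']; [simpl in IHk; rewrite tan_coef_0 in IHk; lra|].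
rewrite decomp_sum by lia; simpl pred.
rewrite tan_coef_0, Rmult_0_l, Rplus_0_l.
destruct m' as [|m''].
- simpl; rewrite tan_coef_1; lra.
- rewrite decomp_sum by lia.
  assert (0 <= sum_f_R0 (fun i => tan_coef (S (S i)) * tan_coef (S (S (S m'')) - S (S i))) (pred (S m''))).
  { apply sum_f_R0_nonneg; intros; apply Rmult_le_pos; apply tan_coef_nonneg. }
  rewrite tan_coef_1; replace (S (S (S m'')) - 1)%nat with (S (S m'')) by lia.
  lra.
Qed.

Definition tan_sum (N : nat) (x : R) : R := sum_f_R0 (fun k => tan_coef k * x ^ k) N.

Lemma tan_sum_nonneg (N : nat) (x : R) : 0 <= x -> 0 <= tan_sum N x.
Proof.
intros; apply sum_f_R0_nonneg; intros.
apply Rmult_le_pos; [apply tan_coef_nonneg|apply pow_le; lra].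
Qed.

Lemma is_derive_tan_sum (N : nat) (x : R) :
  is_derive (tan_sum (S N)) x (sum_f_R0 (fun k => INR (S k) * tan_coef (S k) * x ^ k) N).
Proof.
induction N.
- apply is_derive_ext with (fun x => tan_coef 0 + tan_coef 1 * x).
  + intros t; unfold tan_sum; simpl; ring.
  + auto_derive; auto; simpl; ring.
- apply is_derive_ext with (fun x => plus (tan_sum (S N) x) (tan_coef (S (S N)) * x ^ (S (S N)))).
  + intros t; reflexivity.
  + rewrite tech5; apply (is_derive_plus (V := R_NormedModule)); [exact IHN|].
    auto_derive; auto; simpl pred; simpl; ring.
Qed.

Lemma tan_sum_le (N : nat) (x : R) : 0 <= x -> tan_sum N x <= tan_sum (S N) x.
Proof.
intros Hx; unfold tan_sum; rewrite tech5.
assert (0 <= tan_coef (S N) * x ^ S N)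
  by (apply Rmult_le_pos; [apply tan_coef_nonneg|apply pow_le, Hx]); lra.
Qed.

(** By the recursion the coefficients of the derivative up to degree N are those of 1 + S^2; the
    terms of the square that are left over are nonnegative. *)
Lemma tan_sum_derive_le (N : nat) (x : R) : 0 <= x ->
  sum_f_R0 (fun k => INR (S k) * tan_coef (S k) * x ^ k) N <= 1 + tan_sum (S N) x ^ 2.
Proof.
intros Hx.
rewrite (sum_eq _ (fun k => unit_coef k * x ^ k + PS_mult tan_coef tan_coef k * x ^ k))
  by (intros; rewrite tan_coef_S; ring).
rewrite sum_plus.
apply Rplus_le_compat.
- destruct N; [simpl; lra|].
  rewrite decomp_sum by lia; simpl pred.
  rewrite (sum_eq _ (fun _ => 0)) by (intros; simpl; ring).
  rewrite sum_eq_R0 by auto; simpl; lra.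
- assert (K := cauchy_finite (fun k => tan_coef k * x ^ k) (fun k => tan_coef k * x ^ k) (S N)
    ltac:(lia)).
  simpl pow; rewrite Rmult_1_r; unfold tan_sum; rewrite K.
  assert (P : forall k, 0 <= tan_coef k * x ^ k)
    by (intros; apply Rmult_le_pos; [apply tan_coef_nonneg|apply pow_le, Hx]).
  match goal with |- _ <= _ + ?r => assert (0 <= r) end.
  { apply sum_f_R0_nonneg; intros; apply sum_f_R0_nonneg; intros; apply Rmult_le_pos; apply P. }
  rewrite tech5.
  assert (0 <= sum_f_R0 (fun p => tan_coef p * x ^ p * (tan_coef (S N - p) * x ^ (S N - p))) (S N))
    by (apply sum_f_R0_nonneg; intros; apply Rmult_le_pos; apply P).
  rewrite (sum_eq _ (fun k => sum_f_R0 (fun p => tan_coef p * x ^ p * (tan_coef (k - p) * x ^ (k - p))) k) N);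
    [lra|].
  intros i Hi; unfold PS_mult; rewrite Rmult_comm, scal_sum.
  apply sum_eq; intros j Hj.
  replace (x ^ i) with (x ^ j * x ^ (i - j)) by (rewrite <- pow_add; f_equal; lia); ring.
Qed.

(** The arctangent of the partial sum vanishes at 0 and has derivative at most 1, hence stays below
    x. *)
Lemma tan_sum_bound (N : nat) (x : R) : 0 <= x < PI / 2 -> tan_sum N x <= tan x.
Proof.
intros Hx; eapply Rle_trans; [apply tan_sum_le; lra|].
set (df := fun x => sum_f_R0 (fun k => INR (S k) * tan_coef (S k) * x ^ k) N).
assert (Hd : forall t, is_derive (fun x => atan (tan_sum (S N) x)) t (df t / (1 + tan_sum (S N) t ^ 2))).
{ intros t; replace (df t / (1 + tan_sum (S N) t ^ 2))
    with (scal (df t) (/ (1 + tan_sum (S N) t ^ 2)))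
    by (unfold scal; simpl; unfold mult; simpl; unfold Rdiv; ring).
  apply (is_derive_comp (V := R_NormedModule) atan (tan_sum (S N))).
  - apply is_derive_Reals, derivable_pt_lim_atan.
  - apply is_derive_tan_sum. }
destruct (MVT_gen (fun x => atan (tan_sum (S N) x)) 0 x
  (fun t => df t / (1 + tan_sum (S N) t ^ 2))) as [c [Hc E]].
- intros; apply Hd.
- intros t _; apply continuity_pt_filterlim.
  apply (continuous_of_ex_derive
    (fun x => atan (tan_sum (S N) x))).
  eexists; apply Hd.
- rewrite Rmin_left, Rmax_right in Hc by lra.
  assert (E0 : tan_sum (S N) 0 = 0).
  { unfold tan_sum; rewrite decomp_sum by lia; rewrite tan_coef_0, Rmult_0_l, Rplus_0_l.
    rewrite (sum_eq _ (fun _ => 0)) by (intros; simpl; ring). apply sum_eq_R0; auto. }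
  rewrite E0, atan_0, !Rminus_0_r in E.
  assert (HQ : df c / (1 + tan_sum (S N) c ^ 2) <= 1).
  { assert (0 < 1 + tan_sum (S N) c ^ 2) by (generalize (pow2_ge_0 (tan_sum (S N) c)); lra).
    apply Rmult_le_reg_r with (1 + tan_sum (S N) c ^ 2); [assumption|].
    unfold Rdiv; rewrite Rmult_assoc, Rinv_l, Rmult_1_l, Rmult_1_r by lra.
    apply tan_sum_derive_le; lra. }
  assert (HA : atan (tan_sum (S N) x) <= x) by (rewrite E; nra).
  rewrite <- (tan_atan (tan_sum (S N) x)).
  generalize (atan_bound (tan_sum (S N) x)); intros.
  destruct HA as [HA|HA]; [|rewrite HA; lra].
  apply Rlt_le, tan_increasing; lra.
Qed.

Lemma tan_coef_term_bound (n : nat) (x : R) : 0 <= x < PI / 2 -> tan_coef n * x ^ n <= tan x.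
Proof.
intros Hx; eapply Rle_trans; [|apply (tan_sum_bound n x Hx)].
unfold tan_sum; destruct n; [simpl; lra|]; rewrite tech5.
generalize (tan_sum_nonneg n x ltac:(lra)); unfold tan_sum; lra.
Qed.

(* The sign pattern 0, 1, 0, -1, ... turns tan into tanh. *)
Fixpoint tanh_sign (n : nat) : R :=
  match n with O => 0 | 1%nat => 1 | S (S m) => - tanh_sign m end.

Definition tanh_coef (n : nat) : R := tanh_sign n * tan_coef n.

Lemma tanh_sign_SS (n : nat) : tanh_sign (S (S n)) = - tanh_sign n.
Proof. reflexivity. Qed.

Lemma tanh_sign_odd (a : nat) : tanh_sign (2 * a + 1) = (-1) ^ a.
Proof.
induction a; [reflexivity|].
replace (2 * S a + 1)%nat with (S (S (2 * a + 1))) by lia.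
rewrite tanh_sign_SS, IHa; simpl; ring.
Qed.

Lemma tanh_sign_add (a j : nat) : tanh_sign (2 * a + j) = (-1) ^ a * tanh_sign j.
Proof.
induction a; [simpl; ring|].
replace (2 * S a + j)%nat with (S (S (2 * a + j))) by lia.
rewrite tanh_sign_SS, IHa; simpl; ring.
Qed.

Lemma tanh_sign_bound (n : nat) : Rabs (tanh_sign n) <= 1.
Proof.
assert (H : Rabs (tanh_sign n) <= 1 /\ Rabs (tanh_sign (S n)) <= 1); [|apply H].
induction n as [|n [IH1 IH2]]; [simpl; rewrite Rabs_R0, Rabs_R1; lra|].
split; [exact IH2|]; rewrite tanh_sign_SS, Rabs_Ropp; exact IH1.
Qed.

(** Only odd i contribute to the convolution, and there the signs at i and n - i multiply to the
    opposite of the sign at n + 1. Thus tan' = 1 + tan^2 turns into tanh' = 1 - tanh^2. *)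
Lemma tanh_coef_S (n : nat) :
  INR (S n) * tanh_coef (S n) = unit_coef n - PS_mult tanh_coef tanh_coef n.
Proof.
assert (E : PS_mult tanh_coef tanh_coef n = - tanh_sign (S n) * PS_mult tan_coef tan_coef n).
{ unfold PS_mult; rewrite scal_sum; apply sum_eq; intros i Hi; unfold tanh_coef.
  destruct (Nat.Even_or_Odd i) as [[j ->]|[j ->]].
  - rewrite tan_coef_even; ring.
  - rewrite tanh_sign_odd.
    replace (S n) with (2 * (j + 1) + (n - (2 * j + 1)))%nat by lia.
    replace (2 * (j + 1) + (n - (2 * j + 1)) - (2 * j + 1))%nat
      with (S n - (2 * j + 1))%nat by lia.
    rewrite tanh_sign_add, pow_add; simpl; ring. }
rewrite E; unfold tanh_coef.
replace (INR (S n) * (tanh_sign (S n) * tan_coef (S n)))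
  with (tanh_sign (S n) * (INR (S n) * tan_coef (S n))) by ring.
rewrite tan_coef_S; destruct n; [simpl; ring|]; simpl unit_coef; ring.
Qed.

(** For r strictly between |x| and PI / 2 the terms at r are bounded by tan r, so the radius of
    convergence is at least r. *)
Lemma tanh_radius (x : R) : Rabs x < PI / 2 -> Rbar_lt (Rabs x) (CV_radius tanh_coef).
Proof.
intros Hx; set (r := (Rabs x + PI / 2) / 2); assert (Hp := Rabs_pos x).
apply Rbar_lt_le_trans with r; [simpl; unfold r; lra|].
apply (proj1 (CV_radius_bounded tanh_coef)).
exists (tan r); intros n.
assert (Hr : 0 <= r < PI / 2) by (unfold r; lra).
unfold tanh_coef; rewrite !Rabs_mult.
rewrite (Rabs_right (tan_coef n)), (Rabs_right (r ^ n)) by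
  (apply Rle_ge; [apply tan_coef_nonneg || apply pow_le; lra]).
eapply Rle_trans; [|apply (tan_coef_term_bound n r Hr)].
assert (0 <= tan_coef n * r ^ n) by
  (apply Rmult_le_pos; [apply tan_coef_nonneg|apply pow_le; lra]).
generalize (tanh_sign_bound n) (Rabs_pos (tanh_sign n)); intros; nra.
Qed.

Lemma tanh_ode (u : R) : Rabs u < PI / 2 ->
  is_derive (PSeries tanh_coef) u (1 - PSeries tanh_coef u ^ 2).
Proof.
intros Hu; assert (Hr := tanh_radius u Hu).
assert (Ep : ex_pseries (PS_mult tanh_coef tanh_coef) u) by (apply ex_pseries_mult; assumption).
replace (1 - PSeries tanh_coef u ^ 2) with (PSeries (PS_derive tanh_coef) u);
  [apply is_derive_PSeries, Hr|].
rewrite (PSeries_ext _ (PS_minus unit_coef (PS_mult tanh_coef tanh_coef))).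
- rewrite PSeries_minus by (try assumption; eexists; apply is_pseries_unit).
  rewrite (is_pseries_unique _ _ _ (is_pseries_unit u)), PSeries_mult by assumption.
  simpl; ring.
- intros n; unfold PS_derive; rewrite tanh_coef_S; reflexivity.
Qed.

(* With y the power series, D = y (e^{2u} + 1) - (e^{2u} - 1) satisfies the linear
   equation D' = (1 - y) D and D(0) = 0. *)
Lemma tanh_PSeries (u : R) : Rabs u < PI / 2 ->
  PSeries tanh_coef u * (exp (2 * u) + 1) = exp (2 * u) - 1.
Proof.
intros Hu; set (y := PSeries tanh_coef); set (Y := PSeries (PS_Int tanh_coef)).
assert (HY : forall t, Rabs t < PI / 2 -> is_derive Y t (y t)).
{ intros t Ht; unfold Y, y.
  replace (PSeries tanh_coef t) with (PSeries (PS_derive (PS_Int tanh_coef)) t).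
  - apply is_derive_PSeries; rewrite CV_radius_Int; apply tanh_radius, Ht.
  - apply PSeries_ext; intros n; unfold PS_derive.
    change (INR (S n) * (tanh_coef n / INR (S n)) = tanh_coef n); field.
    apply not_0_INR; lia. }
assert (Hy : forall t, Rabs t < PI / 2 -> is_derive y t (1 - y t ^ 2)) by apply tanh_ode.
(* exp(Y - t), with Y a primitive of y, is the integrating factor for D' = (1 - y) D, so [P] is
   constant. *)
set (P := fun t => (y t * (exp (2 * t) + 1) - (exp (2 * t) - 1)) * exp (Y t - t)).
assert (HP : forall t, Rabs t < PI / 2 -> is_derive P t 0).
{ intros t Ht; unfold P.
  assert (D1 := Hy t Ht); assert (D2 := HY t Ht).
  auto_derive; [repeat split; eexists; [exact D1|exact D2]|].
  assert (E1 : Derive (fun x : R => y x) t = 1 - y t ^ 2) by (apply is_derive_unique, D1).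
  assert (E2 : Derive (fun x : R => Y x) t = y t) by (apply is_derive_unique, D2).
  rewrite E1, E2; ring. }
assert (Hb : forall t, Rmin 0 u <= t <= Rmax 0 u -> Rabs t < PI / 2).
{ intros t Ht; apply Rabs_def2 in Hu; generalize PI_RGT_0; intros.
  revert Ht; unfold Rmin, Rmax; destruct (Rle_dec 0 u); intros; apply Rabs_def1; lra. }
destruct (MVT_gen P 0 u (fun _ => 0)) as [c [_ E]].
- intros; apply HP, Hb; lra.
- intros; apply continuity_pt_filterlim.
  apply (continuous_of_ex_derive P).
  eexists; apply HP, Hb; assumption.
- assert (y0 : y 0 = 0).
  { unfold y; rewrite PSeries_0; unfold tanh_coef; simpl; ring. }
  assert (P0 : P 0 = 0) by (unfold P; rewrite y0, Rmult_0_r, exp_0; ring).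
  rewrite P0, Rmult_0_l, Rminus_0_r in E; unfold P in E.
  apply Rmult_integral in E; destruct E as [E|E]; [lra|].
  generalize (exp_pos (Y u - u)); lra.
Qed.

(* Taylor coefficients of 2 / (e^t + 1) = 1 - tanh (t / 2) *)
Definition euler_coef (n : nat) : R := unit_coef n - tanh_coef n / 2 ^ n.

Lemma euler_coef_pseries (t : R) : Rabs t < PI -> is_pseries euler_coef t (2 / (exp t + 1)).
Proof.
intros Ht.
assert (Hu : Rabs (t / 2) < PI / 2) by (unfold Rdiv; rewrite Rabs_mult, (Rabs_right (/2)); lra).
assert (H1 := PSeries_correct _ _ (CV_radius_inside _ _ (tanh_radius _ Hu))).
assert (H2 := tanh_PSeries _ Hu).
replace (2 * (t / 2)) with t in H2 by field.
apply (proj1 (is_pseries_series _ _ _)) in H1.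
assert (H3 := proj1 (is_pseries_series _ _ _) (is_pseries_unit t)).
assert (H4 := is_series_minus _ _ _ _ H3 H1).
apply (proj2 (is_pseries_series _ _ _)).
assert (He := exp_pos t).
replace (2 / (exp t + 1)) with (plus 1 (opp (PSeries tanh_coef (t / 2)))).
- eapply is_series_ext; [|exact H4].
  intros n; unfold euler_coef, plus, opp; simpl.
  unfold Rdiv; rewrite Rpow_mult_distr, pow_inv; ring.
- unfold plus, opp; simpl.
  apply Rmult_eq_reg_r with (exp t + 1); [|lra].
  replace ((1 + - PSeries tanh_coef (t / 2)) * (exp t + 1))
    with (exp t + 1 - PSeries tanh_coef (t / 2) * (exp t + 1)) by ring.
  rewrite H2; field; lra.
Qed.

Lemma euler_coef_0 : euler_coef 0 = 1.
Proof. unfold euler_coef, tanh_coef; simpl; field. Qed.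

Lemma euler_coef_even (k : nat) : (0 < k)%nat -> euler_coef (2 * k) = 0.
Proof.
intros Hk; unfold euler_coef, tanh_coef; rewrite tan_coef_even.
destruct k; [lia|]; rewrite Rmult_0_r; unfold Rdiv; rewrite Rmult_0_l; simpl; ring.
Qed.

Lemma euler_coef_odd (k : nat) : euler_coef (2 * k + 1) <> 0.
Proof.
unfold euler_coef, tanh_coef; rewrite tanh_sign_odd.
replace (unit_coef (2 * k + 1)) with 0 by (replace (2 * k + 1)%nat with (S (2 * k)) by lia; reflexivity).
assert (H := tan_coef_odd_pos k).
assert (H1 : (-1) ^ k <> 0) by (apply pow_nonzero; lra).
assert (H2 : 2 ^ (2 * k + 1) <> 0) by (apply pow_nonzero; lra).
intros E; apply (Rmult_integral_contrapositive_currified _ _ H1 (Rgt_not_eq _ _ H)).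
apply Rmult_eq_reg_r with (/ 2 ^ (2 * k + 1)); [|apply Rinv_neq_0_compat, H2].
unfold Rdiv in E; lra.
Qed.

(** * Generating series of the Euler polynomials and its symmetries *)

Lemma exp_pseries (x t : R) : is_pseries (fun n => x ^ n / INR (fact n)) t (exp (x * t)).
Proof.
apply (proj2 (is_pseries_series _ _ _)).
assert (H := is_exp_Reals (x * t)); apply (proj1 (is_pseries_series _ _ _)) in H.
eapply is_series_ext; [|exact H]; intros n; simpl.
rewrite Rpow_mult_distr; unfold Rdiv; ring.
Qed.

(** This is E_n(x) / n!, the Cauchy product of 2 / (e^t + 1) with e^(x t). In this normalization
    differentiation is a shift of the index. *)
Definition euler_poly_coef (n : nat) (x : R) : R :=
  PS_mult euler_coef (fun k => x ^ k / INR (fact k)) n.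

Lemma euler_poly_coef_pseries (x t : R) : Rabs t < PI ->
  is_pseries (fun n => euler_poly_coef n x) t (2 * exp (x * t) / (exp t + 1)).
Proof.
intros Ht.
replace (2 * exp (x * t) / (exp t + 1)) with (2 / (exp t + 1) * exp (x * t))
  by (field; generalize (exp_pos t); lra).
apply is_pseries_mult; [apply euler_coef_pseries, Ht|apply exp_pseries| |].
- apply CV_radius_gt with PI; [|exact Ht].
  intros r Hr; eexists; apply euler_coef_pseries; rewrite Rabs_right; lra.
- apply CV_radius_gt with PI; [|exact Ht]; intros; eexists; apply exp_pseries.
Qed.

(** Only existence is at stake: [epsilon] returns a solution as soon as there is one. *)
Lemma euler_poly_spec : is_euler_poly euler_poly.
Proof.
unfold euler_poly; apply epsilon_spec.
exists (fun n x => INR (fact n) * euler_poly_coef n x); intros x t Ht.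
assert (H := euler_poly_coef_pseries x t Ht); apply (proj1 (is_pseries_series _ _ _)) in H.
eapply is_series_ext; [|exact H]; intros n; simpl; field; apply INR_fact_neq_0.
Qed.

Lemma euler_poly_pseries (x t : R) : Rabs t < PI ->
  is_pseries (fun n => euler_poly n x / INR (fact n)) t (2 * exp (x * t) / (exp t + 1)).
Proof.
intros Ht; apply (proj2 (is_pseries_series _ _ _)); eapply is_series_ext; [|exact (euler_poly_spec x t Ht)].
intros n; simpl; field; apply INR_fact_neq_0.
Qed.

Lemma euler_poly_eq (n : nat) (x : R) : euler_poly n x / INR (fact n) = euler_poly_coef n x.
Proof.
apply (is_pseries_coef_unique (fun n => euler_poly n x / INR (fact n))
  (fun n => euler_poly_coef n x) (fun t => 2 * exp (x * t) / (exp t + 1)) PI PI_RGT_0).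
- intros; apply euler_poly_pseries; assumption.
- intros; apply euler_poly_coef_pseries; assumption.
Qed.

Lemma euler_poly_coef_0 (n : nat) : euler_poly_coef n 0 = euler_coef n.
Proof.
apply (is_pseries_coef_unique (fun n => euler_poly_coef n 0) euler_coef
  (fun t => 2 / (exp t + 1)) PI PI_RGT_0); [|apply euler_coef_pseries].
intros t Ht; assert (H := euler_poly_coef_pseries 0 t Ht).
rewrite Rmult_0_l, exp_0, Rmult_1_r in H; exact H.
Qed.

(** Coefficients are compared in 2 e^t / (e^t + 1) + 2 / (e^t + 1) = 2. *)
Lemma euler_poly_coef_1 (n : nat) : euler_poly_coef (S n) 1 = - euler_coef (S n).
Proof.
assert (H : euler_poly_coef (S n) 1 + euler_coef (S n) = 2 * unit_coef (S n)); [|simpl in H; lra].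
apply (is_pseries_coef_unique (fun n => euler_poly_coef n 1 + euler_coef n)
  (fun n => 2 * unit_coef n) (fun _ => 2) PI PI_RGT_0).
- intros t Ht.
  replace 2 with (plus (2 * exp (1 * t) / (exp t + 1)) (2 / (exp t + 1))).
  + apply (is_pseries_plus (V := R_NormedModule) (fun n => euler_poly_coef n 1) euler_coef);
      [apply euler_poly_coef_pseries|apply euler_coef_pseries]; exact Ht.
  + unfold plus; simpl; rewrite Rmult_1_l; field; generalize (exp_pos t); lra.
- intros t Ht.
  assert (H := is_pseries_scal (V := R_NormedModule) 2 unit_coef t 1 (Rmult_comm _ _)
    (is_pseries_unit t)).
  change (scal 2 1) with (2 * 1) in H; rewrite Rmult_1_r in H; exact H.
Qed.

(** The generating function is invariant under x -> 1 - x combined with t -> -t. *)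
Lemma euler_poly_coef_sym (n : nat) (x : R) :
  euler_poly_coef n (1 - x) = (-1) ^ n * euler_poly_coef n x.
Proof.
apply (is_pseries_coef_unique (fun n => euler_poly_coef n (1 - x))
  (fun n => (-1) ^ n * euler_poly_coef n x) (fun t => 2 * exp ((1 - x) * t) / (exp t + 1))
  PI PI_RGT_0).
- intros; apply euler_poly_coef_pseries; assumption.
- intros t Ht; rewrite <- Rabs_Ropp in Ht.
  assert (H := euler_poly_coef_pseries x (- t) Ht); apply (proj1 (is_pseries_series _ _ _)) in H.
  apply (proj2 (is_pseries_series _ _ _)).
  replace (2 * exp ((1 - x) * t) / (exp t + 1)) with (2 * exp (x * - t) / (exp (- t) + 1)).
  + eapply is_series_ext; [|exact H]; intros n'; simpl.
    replace (- t) with ((-1) * t) by ring; rewrite Rpow_mult_distr; ring.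
  + replace ((1 - x) * t) with (t + x * - t) by ring; rewrite exp_plus, exp_Ropp.
    generalize (exp_pos t); intros; field; repeat split; lra.
Qed.

Lemma euler_poly_coef_deg0 (x : R) : euler_poly_coef 0 x = 1.
Proof. unfold euler_poly_coef, PS_mult; simpl; rewrite euler_coef_0; field. Qed.

Lemma is_derive_sum_f_R0 (f df : nat -> R -> R) (x : R) (n : nat) :
  (forall k, (k <= n)%nat -> is_derive (f k) x (df k x)) ->
  is_derive (fun x => sum_f_R0 (fun k => f k x) n) x (sum_f_R0 (fun k => df k x) n).
Proof.
induction n; intros H; [apply H; lia|].
simpl; apply (is_derive_plus (V := R_NormedModule)); [apply IHn; intros|]; apply H; lia.
Qed.

Lemma is_derive_euler_poly_coef (n : nat) (x : R) :
  is_derive (euler_poly_coef (S n)) x (euler_poly_coef n x).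
Proof.
replace (euler_poly_coef n x) with
  (sum_f_R0 (fun k => euler_coef k *
     (INR (S n - k) * x ^ pred (S n - k) / INR (fact (S n - k)))) (S n)).
- apply (is_derive_sum_f_R0 (fun k x => euler_coef k * (x ^ (S n - k) / INR (fact (S n - k))))
    (fun k x => euler_coef k * (INR (S n - k) * x ^ pred (S n - k) / INR (fact (S n - k))))).
  intros k _; generalize (S n - k)%nat; intros m; auto_derive; auto; unfold Rdiv; ring.
- rewrite tech5, Nat.sub_diag; simpl (INR 0); unfold euler_poly_coef, PS_mult.
  replace (euler_coef (S n) * (0 * x ^ pred 0 / INR (fact 0))) with 0 by (unfold Rdiv; ring).
  rewrite Rplus_0_r; apply sum_eq; intros k Hk.
  replace (S n - k)%nat with (S (n - k)) by lia; simpl pred.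
  rewrite fact_simpl, mult_INR; field; split; [apply INR_fact_neq_0|apply not_0_INR; lia].
Qed.

Lemma euler_poly_odd_neq_0 (k : nat) : euler_poly (2 * k + 1) 0 <> 0.
Proof.
intros E; apply (euler_coef_odd k).
rewrite <- euler_poly_coef_0, <- euler_poly_eq, E; unfold Rdiv; ring.
Qed.

(** * Complex series and Mellin-type integrals of periodic kernels *)

(** The upper index is excluded, unlike in [sum_n]: the empty sum is then available as the base case
    of telescoping identities. *)
Fixpoint Csum (u : nat -> C) (n : nat) : C :=
  match n with O => RtoC 0 | S m => (Csum u m + u m)%C end.

Lemma Csum_S (u : nat -> C) (n : nat) : Csum u (S n) = (Csum u n + u n)%C.
Proof. reflexivity. Qed.

Lemma Csum_sum_n (u : nat -> C) (n : nat) :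
  sum_n (G := C_AbelianMonoid) u n = Csum u (S n).
Proof.
induction n; [rewrite sum_O; simpl; ring|].
rewrite sum_Sn, IHn; reflexivity.
Qed.

Lemma is_series_Csum (u : nat -> C) (l : C) :
  is_series (V := C_NormedModule) u l <-> Clim (Csum u) l.
Proof.
split; intros H.
- apply is_series_Clim in H; apply Clim_S_inv.
  apply (Clim_ext _ _ _ (Csum_sum_n u) H).
- apply is_series_Clim; apply Clim_S in H.
  eapply Clim_ext; [|exact H]; intros n; symmetry; apply Csum_sum_n.
Qed.

Lemma Cseries_unique (u : nat -> C) (l : C) : Clim (Csum u) l -> Cseries u = l.
Proof.
intros H; apply is_series_Csum in H; unfold Cseries.
apply (iota_filterlim_locally (V := C_CompleteNormedModule) (F := eventually)); exact H.
Qed.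

Lemma Csum_ext (u v : nat -> C) (n : nat) :
  (forall k, (k < n)%nat -> u k = v k) -> Csum u n = Csum v n.
Proof.
induction n; intros H; [reflexivity|]; simpl.
rewrite IHn, (H n) by (intros; try apply H; lia); reflexivity.
Qed.

Lemma Csum_plus (u v : nat -> C) (n : nat) :
  Csum (fun k => u k + v k)%C n = (Csum u n + Csum v n)%C.
Proof. induction n; simpl; [ring|rewrite IHn; ring]. Qed.

Lemma Csum_minus (u v : nat -> C) (n : nat) :
  Csum (fun k => u k - v k)%C n = (Csum u n - Csum v n)%C.
Proof. induction n; simpl; [ring|rewrite IHn; ring]. Qed.

Lemma Csum_scal (c : C) (u : nat -> C) (n : nat) :
  Csum (fun k => c * u k)%C n = (c * Csum u n)%C.
Proof. induction n; simpl; [ring|rewrite IHn; ring]. Qed.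

Lemma Csum_zero (n : nat) : Csum (fun _ => RtoC 0) n = RtoC 0.
Proof. induction n; simpl; [reflexivity|rewrite IHn; ring]. Qed.

Lemma Csum_shift (u : nat -> C) (n : nat) :
  Csum u (S n) = (u O + Csum (fun k => u (S k)) n)%C.
Proof.
induction n; [simpl; ring|].
change (Csum u (S (S n))) with (Csum u (S n) + u (S n))%C; rewrite IHn; simpl; ring.
Qed.

(** Since y + 1 <= 2y, 1/y^2 is at most twice 1/(y (y + 1)). This telescoping majorant is the source
    of the factor 2 in the tail bounds below. *)
Lemma inv_sq_telescope (K y : R) : 0 <= K -> 1 <= y -> K / y ^ 2 <= 2 * K / y - 2 * K / (y + 1).
Proof.
intros HK Hy.
replace (2 * K / y - 2 * K / (y + 1)) with (K / y ^ 2 * (2 * y / (y + 1))) by (field; lra).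
rewrite <- (Rmult_1_r (K / y ^ 2)) at 1; apply Rmult_le_compat_l.
- apply Rdiv_le_0_compat; [lra|apply pow_lt; lra].
- apply Rmult_le_reg_r with (y + 1); [lra|].
  unfold Rdiv; rewrite Rmult_assoc, Rinv_l by lra; lra.
Qed.

Lemma Csum_Cauchy_bound (a : nat -> C) (K x : R) (N k : nat) : 0 <= K -> 1 <= x ->
  (forall n, Cmod (a n) <= K / (x + INR n) ^ 2) ->
  Cmod (Csum a (k + N) - Csum a N) <= 2 * K / (x + INR N) - 2 * K / (x + INR (k + N)).
Proof.
intros HK Hx Ha; induction k; [simpl; rewrite Cmod_self; lra|].
change (Csum a (S k + N)) with (Csum a (k + N) + a (k + N)%nat)%C.
change (S k + N)%nat with (S (k + N)); rewrite S_INR.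
replace (Csum a (k + N) + a (k + N)%nat - Csum a N)%C
  with ((Csum a (k + N) - Csum a N) + a (k + N)%nat)%C by ring.
eapply Rle_trans; [apply Cmod_triangle|].
generalize (Ha (k + N)%nat) (inv_sq_telescope K (x + INR (k + N)) HK
  ltac:(generalize (pos_INR (k + N)); lra)).
rewrite Rplus_assoc; lra.
Qed.

(** The tail bound depends only on [K] and [x], so convergence is uniform in any further
    parameter. *)
Lemma Csum_conv (a : nat -> C) (K x : R) : 0 <= K -> 1 <= x ->
  (forall n, Cmod (a n) <= K / (x + INR n) ^ 2) ->
  exists l, Clim (Csum a) l /\ forall N, Cmod (l - Csum a N) <= 2 * K / (x + INR N).
Proof.
intros HK Hx Ha.
assert (B : forall N n, (N <= n)%nat -> Cmod (Csum a n - Csum a N) <= 2 * K / (x + INR N)).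
{ intros N n Hn; replace n with ((n - N) + N)%nat by lia.
  eapply Rle_trans; [apply (Csum_Cauchy_bound a K x N (n - N) HK Hx Ha)|].
  assert (0 <= 2 * K / (x + INR (n - N + N))).
  { apply Rdiv_le_0_compat; [lra|generalize (pos_INR (n - N + N)); lra]. }
  lra. }
assert (Hc : exists l, Clim (Csum a) l).
{ apply Clim_cauchy; intros eps He.
  destruct (INR_unbounded (4 * K / eps + 1)) as [N HN].
  assert (HB : 2 * K / (x + INR N) < eps / 2).
  { apply Rmult_lt_reg_r with (x + INR N); [generalize (pos_INR N); lra|].
    unfold Rdiv at 1; rewrite Rmult_assoc, Rinv_l, Rmult_1_r by (generalize (pos_INR N); lra).
    assert (E : eps / 2 * (4 * K / eps + 1) = 2 * K + eps / 2) by (field; lra).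
    assert (eps / 2 * (4 * K / eps + 1) < eps / 2 * (x + INR N))
      by (apply Rmult_lt_compat_l; lra).
    lra. }
  exists N; intros n m Hn Hm.
  generalize (B N n Hn) (B N m Hm) (Cmod_sub_triangle (Csum a n) (Csum a N) (Csum a m)).
  rewrite (Cmod_minus_sym (Csum a m)); lra. }
destruct Hc as [l Hl]; exists l; split; [exact Hl|]; intros N.
apply Clim_Cmod_le with (u := fun n => (Csum a (N + n)%nat - Csum a N)%C).
- intros n; apply B; lia.
- apply Clim_minus; [|apply (Ctends_const eventually)].
  intros eps He; destruct (Hl eps He) as [M HM]; exists M; intros; apply HM; lia.
Qed.

(** The quadratic errors of the terms add up to a telescoping bound that does not depend on the
    number of terms, so [qdiff_lim] applies to the partial sums. *)
Lemma qdiff_series (f : nat -> C -> C) (g : C -> C) (s : C) (eps K x : R) :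
  0 < eps -> 0 <= K -> 1 <= x ->
  (forall n, qdiff (f n) s eps (K / (x + INR n) ^ 2)) ->
  (forall h, Cmod h < eps -> Clim (Csum (fun n => f n (s + h)%C)) (g (s + h)%C)) ->
  qdiff g s eps (2 * K / x).
Proof.
intros Heps HK Hx Hf Hg.
apply qdiff_lim with (f := fun N z => Csum (fun n => f n z) N); [exact Heps| |exact Hg].
assert (Q : forall N, qdiff (fun z => Csum (fun n => f n z) N) s eps
  (2 * K / x - 2 * K / (x + INR N))).
{ induction N.
  - exists (RtoC 0); intros h _; simpl.
    replace (0 - 0 - h * 0)%C with (RtoC 0) by ring; rewrite Cmod_0.
    rewrite Rplus_0_r, Rminus_diag, Rmult_0_l; lra.
  - eapply qdiff_ext; [intros; reflexivity| |apply qdiff_plus; [exact IHN|apply Hf]].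
    generalize (inv_sq_telescope K (x + INR N) HK ltac:(generalize (pos_INR N); lra)).
    rewrite S_INR, <- Rplus_assoc; lra. }
intros N; eapply qdiff_ext; [intros; reflexivity| |apply Q].
assert (0 <= 2 * K / (x + INR N)).
{ apply Rdiv_le_0_compat; [lra|generalize (pos_INR N); lra]. }
lra.
Qed.

Definition Clim_val (u : nat -> C) : C := epsilon (inhabits (RtoC 0)) (Clim u).

Lemma Clim_val_correct (u : nat -> C) : (exists l, Clim u l) -> Clim u (Clim_val u).
Proof. apply epsilon_spec. Qed.

Lemma Clim_val_unique (u : nat -> C) (l : C) : Clim u l -> Clim_val u = l.
Proof. intros H; apply (Clim_unique u); [apply Clim_val_correct; exists l|]; exact H. Qed.

(** * The powers x^(-z) and their dependence on x and z *)

Definition pw (x : R) (z : C) : C := Cexp (- (z * RtoC (ln x))).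

Lemma inv_Rcpow (x : R) (z : C) : (/ Rcpow x z)%C = pw x z.
Proof. unfold pw, Rcpow; rewrite Cexp_opp; reflexivity. Qed.

Lemma Cmod_pw (x : R) (z : C) : Cmod (pw x z) = exp (- (Re z * ln x)).
Proof. unfold pw; rewrite Cmod_Cexp, re_opp, re_scal_r; reflexivity. Qed.

Lemma pw_plus (x : R) (z w : C) : pw x (z + w) = (pw x z * pw x w)%C.
Proof. unfold pw; rewrite <- Cexp_plus; f_equal; ring. Qed.

Lemma pw_mult (x y : R) (z : C) : 0 < x -> 0 < y -> pw (x * y) z = (pw x z * pw y z)%C.
Proof.
intros Hx Hy; unfold pw; rewrite <- Cexp_plus, ln_mult by assumption.
f_equal; rewrite RtoC_plus; ring.
Qed.

Lemma pw_base_1 (z : C) : pw 1 z = RtoC 1.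
Proof. unfold pw; rewrite ln_1, Cmult_0_r, Copp_0; apply Cexp_0. Qed.

Lemma pw_1 (x : R) : 0 < x -> pw x (RtoC 1) = RtoC (/ x).
Proof.
intros Hx; unfold pw; rewrite Cmult_1_l, <- RtoC_opp, Cexp_RtoC, exp_Ropp, exp_ln by exact Hx.
reflexivity.
Qed.

Lemma pw_m1 (x : R) : 0 < x -> pw x (RtoC (-1)) = RtoC x.
Proof.
intros Hx; unfold pw; rewrite <- RtoC_mult, <- RtoC_opp, Cexp_RtoC.
replace (- (-1 * ln x)) with (ln x) by ring; rewrite exp_ln by exact Hx; reflexivity.
Qed.

Lemma exp_INR_ln (k : nat) (x : R) : 0 < x -> exp (- (INR k * ln x)) = / x ^ k.
Proof.
intros Hx; rewrite exp_Ropp; f_equal; induction k.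
- simpl; rewrite Rmult_0_l; apply exp_0.
- rewrite S_INR; replace ((INR k + 1) * ln x) with (ln x + INR k * ln x) by ring.
  rewrite exp_plus, IHk, exp_ln by exact Hx; reflexivity.
Qed.

Lemma ln_nonneg (x : R) : 1 <= x -> 0 <= ln x.
Proof. intros [H|<-]; [rewrite <- ln_1; apply Rlt_le, ln_increasing; lra|rewrite ln_1; lra]. Qed.

Lemma Cmod_pw_le (x : R) (z : C) (k : nat) : 1 <= x -> INR k <= Re z ->
  Cmod (pw x z) <= / x ^ k.
Proof.
intros Hx Hk; rewrite Cmod_pw, <- exp_INR_ln by lra; apply exp_le.
generalize (ln_nonneg x Hx); nra.
Qed.

Lemma is_Cderive_pw (x : R) (z : C) (t : R) : 0 < x + t ->
  is_Cderive (fun t => pw (x + t) z) t (- (z * pw (x + t) (z + 1)))%C.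
Proof.
intros Ht.
apply is_Cderive_ext with (f := fun t => Cexp ((- z) * RtoC (ln (x + t))))
  (l := (RtoC (/ (x + t)) * ((- z) * Cexp ((- z) * RtoC (ln (x + t)))))%C).
- intros u; unfold pw; f_equal; ring.
- rewrite pw_plus, pw_1 by exact Ht; unfold pw.
  replace (- (z * RtoC (ln (x + t))))%C with ((- z) * RtoC (ln (x + t)))%C by ring; ring.
- apply (is_Cderive_Cexp (- z) (fun t => ln (x + t))); auto_derive; [exact Ht|field; lra].
Qed.

Lemma Rcont_pw (x : R) (z : C) (t : R) : 0 < x + t -> Rcont (fun t => pw (x + t) z) t.
Proof. intros H; eapply is_Cderive_Rcont, is_Cderive_pw, H. Qed.

(** The decay loses 3 eps in the exponent: two of them absorb (ln x)^2 <= x^(2 eps) / eps^2, the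
    third absorbs exp(|h| ln x). *)
Lemma qdiff_pw_rem (x : R) (s h : C) (eps : R) (k : nat) :
  0 < eps -> 1 <= x -> INR k + 3 * eps <= Re s -> Cmod h < eps ->
  Cmod (pw x (s + h) - pw x s - h * (- RtoC (ln x) * pw x s))%C <= / eps ^ 2 / x ^ k * Cmod h ^ 2.
Proof.
intros He Hx Hs Hh; set (L := ln x); assert (HL : 0 <= L) by apply ln_nonneg, Hx.
rewrite pw_plus.
replace (pw x s * pw x h - pw x s - h * (- RtoC L * pw x s))%C
  with (pw x s * (Cexp (- (h * RtoC L)) - 1 - (- (h * RtoC L))))%C by (unfold pw; fold L; ring).
rewrite Cmod_mult, Cmod_pw; fold L.
eapply Rle_trans; [apply Rmult_le_compat_l; [apply Rlt_le, exp_pos|apply Cexp_bound_2]|].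
rewrite Cmod_opp, Cmod_mult, Cmod_R, (Rabs_right L) by lra.
assert (H1 : L ^ 2 <= / eps ^ 2 * exp (2 * eps * L)).
{ assert (H2 : eps * L <= exp (eps * L)).
  { destruct (Rle_lt_or_eq_dec 0 (eps * L)) as [H|H]; [nra| |].
    - generalize (exp_ineq1 (eps * L)); lra.
    - rewrite <- H, exp_0; lra. }
  apply Rmult_le_reg_l with (eps ^ 2); [apply pow_lt; lra|].
  rewrite <- Rmult_assoc, Rinv_r, Rmult_1_l by (apply pow_nonzero; lra).
  replace (2 * eps * L) with (eps * L + eps * L) by ring; rewrite exp_plus.
  replace (eps ^ 2 * L ^ 2) with ((eps * L) * (eps * L)) by ring.
  apply Rmult_le_compat; nra. }
replace (/ eps ^ 2 / x ^ k) with (/ eps ^ 2 * exp (- (INR k * L)))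
  by (unfold L; rewrite exp_INR_ln by lra; reflexivity).
apply Rle_trans with (exp (- (Re s * L)) * ((Cmod h ^ 2 * (/ eps ^ 2 * exp (2 * eps * L))) * exp (eps * L))).
- apply Rmult_le_compat_l; [apply Rlt_le, exp_pos|].
  apply Rmult_le_compat.
  + apply pow2_ge_0.
  + apply Rlt_le, exp_pos.
  + rewrite Rpow_mult_distr; apply Rmult_le_compat_l; [apply pow2_ge_0|exact H1].
  + apply exp_le; nra.
- replace (exp (- (Re s * L)) * (Cmod h ^ 2 * (/ eps ^ 2 * exp (2 * eps * L)) * exp (eps * L)))
    with (/ eps ^ 2 * (exp (- (Re s * L)) * exp (2 * eps * L) * exp (eps * L)) * Cmod h ^ 2) by ring.
  rewrite <- !exp_plus.
  apply Rmult_le_compat_r; [apply pow2_ge_0|].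
  apply Rmult_le_compat_l; [apply Rlt_le, Rinv_0_lt_compat, pow_lt, He|].
  apply exp_le; nra.
Qed.

Lemma Cdiff_pw (x : R) (s : C) : Cdiff (pw x) s.
Proof.
apply (Cdiff_comp (fun z => - (z * RtoC (ln x)))%C Cexp); [|apply Cdiff_Cexp].
apply Cdiff_opp, Cdiff_mult; [apply Cdiff_id|apply Cdiff_const].
Qed.

(** * Integrals over unit cells and their signed sums *)

Definition cell (e : R -> R) (z : C) (x : R) : C :=
  CRInt (fun t => RtoC (e t) * pw (x + t) z)%C 0 1.

Record kernel (e : R -> R) (M : R) : Prop := {
  kernel_cont : forall t, continuous e t;
  kernel_pos : 0 <= M;
  kernel_bound : forall t, 0 <= t <= 1 -> Rabs (e t) <= M }.

Lemma cell_correct (e : R -> R) (M : R) (z : C) (x : R) : kernel e M -> 0 < x ->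
  is_CRInt (fun t => RtoC (e t) * pw (x + t) z)%C 0 1 (cell e z x).
Proof.
intros He Hx; apply CRInt_correct, ex_CRInt_cont; intros t Ht.
rewrite Rmin_left in Ht by lra.
apply Rcont_mult; [apply Rcont_RtoC, (kernel_cont _ _ He)|apply Rcont_pw; lra].
Qed.

Lemma inv_pow_le (x y : R) (k : nat) : 0 < x -> x <= y -> / y ^ k <= / x ^ k.
Proof. intros; apply Rinv_le_contravar; [apply pow_lt; lra|apply pow_incr; lra]. Qed.

Lemma cell_bound (e : R -> R) (M : R) (z : C) (x : R) (k : nat) : kernel e M -> 1 <= x ->
  INR k <= Re z -> Cmod (cell e z x) <= M / x ^ k.
Proof.
intros He Hx Hk; replace (M / x ^ k) with ((1 - 0) * (M * / x ^ k)) by (unfold Rdiv; ring).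
apply is_CRInt_bound with (f := fun t => (RtoC (e t) * pw (x + t) z)%C); [lra| |].
- intros t Ht; rewrite Cmod_mult, Cmod_R; apply Rmult_le_compat.
  + apply Rabs_pos.
  + apply Cmod_ge_0.
  + apply (kernel_bound _ _ He), Ht.
  + eapply Rle_trans; [apply Cmod_pw_le; [lra|exact Hk]|apply inv_pow_le; lra].
- apply cell_correct with M; [exact He|lra].
Qed.

(** The slope is the integral of the s-derivative of the integrand; the pointwise error of
    [qdiff_pw_rem] is uniform in t and is simply integrated. *)
Lemma qdiff_cell (e : R -> R) (M : R) (s : C) (x eps : R) (k : nat) : kernel e M -> 1 <= x ->
  0 < eps -> INR k + 3 * eps <= Re s ->
  qdiff (fun z => cell e z x) s eps (M / eps ^ 2 / x ^ k).
Proof.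
intros He Hx Heps Hs.
assert (HI : is_CRInt (fun t => RtoC (e t) * (- RtoC (ln (x + t)) * pw (x + t) s))%C 0 1
  (CRInt (fun t => RtoC (e t) * (- RtoC (ln (x + t)) * pw (x + t) s))%C 0 1)).
{ apply CRInt_correct, ex_CRInt_cont; intros t Ht; rewrite Rmin_left in Ht by lra.
  apply Rcont_mult; [apply Rcont_RtoC, (kernel_cont _ _ He)|].
  apply Rcont_mult; [|apply Rcont_pw; lra].
  apply (Rcont_comp_Ccont (fun w => - w)%C (fun t => RtoC (ln (x + t)))).
  - apply Rcont_RtoC, continuous_of_ex_derive.
    auto_derive; lra.
  - apply Cdiff_Ccont, Cdiff_opp, Cdiff_id. }
eexists; intros h Hh.
replace (M / eps ^ 2 / x ^ k * Cmod h ^ 2)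
  with ((1 - 0) * (M * (/ eps ^ 2 / x ^ k * Cmod h ^ 2))) by (unfold Rdiv; ring).
apply is_CRInt_bound with (f := fun t =>
  (RtoC (e t) * pw (x + t) (s + h) - RtoC (e t) * pw (x + t) s
   - h * (RtoC (e t) * (- RtoC (ln (x + t)) * pw (x + t) s)))%C); [lra| |].
- intros t Ht.
  replace (RtoC (e t) * pw (x + t) (s + h) - RtoC (e t) * pw (x + t) s
    - h * (RtoC (e t) * (- RtoC (ln (x + t)) * pw (x + t) s)))%C
    with (RtoC (e t) * (pw (x + t) (s + h) - pw (x + t) s
      - h * (- RtoC (ln (x + t)) * pw (x + t) s)))%C by ring.
  rewrite Cmod_mult, Cmod_R; apply Rmult_le_compat.
  + apply Rabs_pos.
  + apply Cmod_ge_0.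
  + apply (kernel_bound _ _ He), Ht.
  + eapply Rle_trans; [apply qdiff_pw_rem with (k := k) (eps := eps); try assumption; lra|].
    apply Rmult_le_compat_r; [apply pow2_ge_0|].
    apply Rmult_le_compat_l; [apply Rlt_le, Rinv_0_lt_compat, pow_lt, Heps|].
    apply inv_pow_le; lra.
- apply is_CRInt_minus; [apply is_CRInt_minus; apply cell_correct with M; auto; lra|].
  apply is_CRInt_Cmult, HI.
Qed.

(* Sum over j of lam^j times the integral of e t (x + j + t)^(-z) over [0, 1]: the
   Mellin-type integral over [0, +oo) of the lam-periodic extension of e. *)
Definition strip_terms (lam : R) (e : R -> R) (z : C) (x : R) (j : nat) : C :=
  (RtoC (lam ^ j) * cell e z (x + INR j))%C.

Definition strip (lam : R) (e : R -> R) (z : C) (x : R) : C :=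
  Clim_val (Csum (strip_terms lam e z x)).

Lemma Rabs_pow_le_1 (lam : R) (j : nat) : Rabs lam <= 1 -> Rabs (lam ^ j) <= 1.
Proof.
intros H; rewrite <- RPow_abs, <- (pow1 j); apply pow_incr; split; [apply Rabs_pos|exact H].
Qed.

Lemma strip_terms_bound (lam : R) (e : R -> R) (M : R) (z : C) (x : R) (j k : nat) :
  Rabs lam <= 1 -> kernel e M -> 1 <= x -> INR k <= Re z ->
  Cmod (strip_terms lam e z x j) <= M / (x + INR j) ^ k.
Proof.
intros Hl He Hx Hz; unfold strip_terms; rewrite Cmod_mult, Cmod_R, <- (Rmult_1_l (M / _)).
apply Rmult_le_compat; [apply Rabs_pos|apply Cmod_ge_0|apply Rabs_pow_le_1, Hl|].
apply cell_bound; auto; generalize (pos_INR j); lra.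
Qed.

Lemma strip_correct (lam : R) (e : R -> R) (M : R) (z : C) (x : R) :
  Rabs lam <= 1 -> kernel e M -> 1 <= x -> 2 <= Re z ->
  Clim (Csum (strip_terms lam e z x)) (strip lam e z x) /\
  forall N, Cmod (strip lam e z x - Csum (strip_terms lam e z x) N) <= 2 * M / (x + INR N).
Proof.
intros Hl He Hx Hz.
destruct (Csum_conv (strip_terms lam e z x) M x (kernel_pos _ _ He) Hx) as [l [H1 H2]].
- intros n; apply strip_terms_bound; auto.
- unfold strip; rewrite (Clim_val_unique _ _ H1); auto.
Qed.

Lemma strip_bound (lam : R) (e : R -> R) (M : R) (z : C) (x : R) :
  Rabs lam <= 1 -> kernel e M -> 1 <= x -> 2 <= Re z ->
  Cmod (strip lam e z x) <= 2 * M / x.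
Proof.
intros Hl He Hx Hz; destruct (strip_correct lam e M z x Hl He Hx Hz) as [_ H].
specialize (H O); simpl in H; rewrite Rplus_0_r in H.
replace (strip lam e z x - 0)%C with (strip lam e z x) in H by ring; exact H.
Qed.

(** Splitting off the cell j = 0 leaves lam times the sum started at x + 1. *)
Lemma strip_shift (lam : R) (e : R -> R) (M : R) (z : C) (x : R) :
  Rabs lam <= 1 -> kernel e M -> 1 <= x -> 2 <= Re z ->
  (strip lam e z x - RtoC lam * strip lam e z (x + 1))%C = cell e z x.
Proof.
intros Hl He Hx Hz.
destruct (strip_correct lam e M z x Hl He Hx Hz) as [H _].
destruct (strip_correct lam e M z (x + 1) Hl He ltac:(lra) Hz) as [H' _].
apply Clim_S in H.
apply (Clim_unique (fun _ => cell e z x)); [|apply (Ctends_const eventually)].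
eapply Clim_ext; [|exact (Clim_minus _ _ _ _ H ((Ctends_scal eventually) (RtoC lam) _ _ H'))].
intros n; simpl; rewrite <- Csum_scal.
change (Csum (strip_terms lam e z x) n + strip_terms lam e z x n)%C
  with (Csum (strip_terms lam e z x) (S n)).
rewrite Csum_shift.
rewrite (Csum_ext (fun k => strip_terms lam e z x (S k))
  (fun k => RtoC lam * strip_terms lam e z (x + 1) k)%C).
- unfold strip_terms at 1; simpl; rewrite Rplus_0_r; ring.
- intros k _; unfold strip_terms; rewrite S_INR.
  replace (x + 1 + INR k) with (x + (INR k + 1)) by ring; simpl pow; rewrite RtoC_mult; ring.
Qed.

Lemma Re_plus_ge (s h : C) (eps : R) : Cmod h < eps -> Re s - eps <= Re (s + h).
Proof.
intros H; rewrite re_plus; generalize (re_le_Cmod h); intros.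
apply Rabs_le_between in H0; lra.
Qed.

Lemma qdiff_strip (lam : R) (e : R -> R) (M : R) (s : C) (x eps : R) :
  Rabs lam <= 1 -> kernel e M -> 1 <= x -> 0 < eps -> 2 + 3 * eps <= Re s ->
  qdiff (fun z => strip lam e z x) s eps (2 * (M / eps ^ 2) / x).
Proof.
intros Hl He Hx Heps Hs; set (K := M / eps ^ 2).
assert (HK : 0 <= K) by (apply Rdiv_le_0_compat; [apply (kernel_pos _ _ He)|apply pow_lt, Heps]).
apply qdiff_series with (f := fun n z => strip_terms lam e z x n); try assumption.
- intros n; eapply qdiff_ext; [intros; reflexivity| |].
  2: { apply qdiff_scal, qdiff_cell with (k := 2%nat); try eassumption.
       generalize (pos_INR n); lra. }
  rewrite Cmod_R; fold K; apply Rle_trans with (1 * (K / (x + INR n) ^ 2)); [|lra].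
  apply Rmult_le_compat_r; [|apply Rabs_pow_le_1, Hl].
  apply Rdiv_le_0_compat; [exact HK|apply pow_lt; generalize (pos_INR n); lra].
- intros h Hh; apply (strip_correct lam e M); auto.
  generalize (Re_plus_ge s h eps Hh); lra.
Qed.

Lemma Cdiff_strip (lam : R) (e : R -> R) (M : R) (s : C) (x : R) :
  Rabs lam <= 1 -> kernel e M -> 1 <= x -> 2 < Re s -> Cdiff (fun z => strip lam e z x) s.
Proof.
intros Hl He Hx Hs; eapply qdiff_Cdiff; [|apply qdiff_strip with (eps := (Re s - 2) / 3);
  try eassumption]; lra.
Qed.

(** For lam = -1 and the Euler kernel the sum over n is, up to a factorial, the remainder integral
    of the theorem; the sum over n in phi^+ has been moved outside the integral. *)
Definition weighted_strip_terms (lam : R) (e : R -> R) (z : C) (n : nat) : C :=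
  (RtoC (/ INR (S n)) * strip lam e z (INR (S n)))%C.

Definition weighted_strip (lam : R) (e : R -> R) (z : C) : C :=
  Clim_val (Csum (weighted_strip_terms lam e z)).

Lemma INR_S_ge_1 (n : nat) : 1 <= INR (S n).
Proof. rewrite S_INR; generalize (pos_INR n); lra. Qed.

Lemma weighted_strip_correct (lam : R) (e : R -> R) (M : R) (z : C) :
  Rabs lam <= 1 -> kernel e M -> 2 <= Re z ->
  Clim (Csum (weighted_strip_terms lam e z)) (weighted_strip lam e z).
Proof.
intros Hl He Hz; apply Clim_val_correct.
destruct (Csum_conv (weighted_strip_terms lam e z) (2 * M) 1) as [l [H1 _]]; [|lra| |].
- generalize (kernel_pos _ _ He); lra.
- intros n; unfold weighted_strip_terms; assert (Hn := INR_S_ge_1 n).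
  rewrite Cmod_mult, Cmod_R, Rabs_right by (apply Rle_ge, Rlt_le, Rinv_0_lt_compat; lra).
  replace (1 + INR n) with (INR (S n)) by (rewrite S_INR; ring).
  replace (2 * M / INR (S n) ^ 2) with (/ INR (S n) * (2 * M / INR (S n))) by (field; lra).
  apply Rmult_le_compat_l; [apply Rlt_le, Rinv_0_lt_compat; lra|].
  apply strip_bound; auto.
- exists l; exact H1.
Qed.

Lemma qdiff_weighted_strip (lam : R) (e : R -> R) (M : R) (s : C) (eps : R) :
  Rabs lam <= 1 -> kernel e M -> 0 < eps -> 2 + 3 * eps <= Re s ->
  qdiff (weighted_strip lam e) s eps (4 * (M / eps ^ 2)).
Proof.
intros Hl He Heps Hs; set (K := 2 * (M / eps ^ 2)).
assert (HK : 0 <= K).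
{ apply Rmult_le_pos; [lra|].
  apply Rdiv_le_0_compat; [apply (kernel_pos _ _ He)|apply pow_lt, Heps]. }
replace (4 * (M / eps ^ 2)) with (2 * K / 1) by (unfold K; field; lra).
apply qdiff_series with (f := fun n z => weighted_strip_terms lam e z n); try assumption; [lra| |].
- intros n; assert (Hn := INR_S_ge_1 n); eapply qdiff_ext; [intros; reflexivity| |].
  2: apply qdiff_scal, qdiff_strip; eassumption.
  rewrite Cmod_R, Rabs_right by (apply Rle_ge, Rlt_le, Rinv_0_lt_compat; lra).
  replace (1 + INR n) with (INR (S n)) by (rewrite S_INR; ring); fold K; right; field; lra.
- intros h Hh; apply (weighted_strip_correct lam e M); auto.
  generalize (Re_plus_ge s h eps Hh); lra.
Qed.

Lemma Cdiff_weighted_strip (lam : R) (e : R -> R) (M : R) (s : C) :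
  Rabs lam <= 1 -> kernel e M -> 2 < Re s -> Cdiff (weighted_strip lam e) s.
Proof.
intros Hl He Hs; eapply qdiff_Cdiff; [|apply qdiff_weighted_strip with (eps := (Re s - 2) / 3);
  try eassumption]; lra.
Qed.

(** * Continuation of the zeta function *)

(** For each s some index is chosen. Agreement under q -> q + 1 makes the choice immaterial, and
    openness of [D q] gives equality near s, which differentiability requires. *)
Lemma glue (F : nat -> C -> C) (D : nat -> C -> Prop) :
  (forall q s, D q s -> D (S q) s /\ F (S q) s = F q s) ->
  (forall s, exists q, D q s) ->
  (forall q s, D q s -> near s (D q)) ->
  exists G : C -> C, (forall q s, D q s -> G s = F q s) /\
    (forall q s, D q s -> Cdiff (F q) s -> Cdiff G s).
Proof.
intros Hup Hcov Hopen; destruct (choice _ Hcov) as [qq Hqq].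
assert (K : forall k q s, D q s -> D (k + q)%nat s /\ F (k + q)%nat s = F q s).
{ induction k; intros q s H; [simpl; auto|].
  destruct (IHk q s H) as [H1 H2]; destruct (Hup _ _ H1) as [H3 H4].
  split; [exact H3|]; simpl; rewrite H4; exact H2. }
assert (E : forall q s, D q s -> F (qq s) s = F q s).
{ intros q s H; rewrite <- (proj2 (K q _ _ (Hqq s))), <- (proj2 (K (qq s) _ _ H)).
  rewrite Nat.add_comm; reflexivity. }
exists (fun s => F (qq s) s); split; [exact E|].
intros q s H; apply Cdiff_ext_loc; eapply filter_imp; [|exact (Hopen q s H)].
intros w Hw; symmetry; apply E, Hw.
Qed.

Lemma pw_lim_0 (z : C) : 0 < Re z -> Clim (fun n => pw (INR (S n)) z) (RtoC 0).
Proof.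
intros Hz eps He; destruct (INR_unbounded (exp (- ln eps / Re z))) as [N HN].
exists N; intros n Hn.
replace (pw (INR (S n)) z - 0)%C with (pw (INR (S n)) z) by ring; rewrite Cmod_pw.
rewrite <- (exp_ln eps He) at 1; apply exp_increasing.
assert (H : - ln eps / Re z < ln (INR (S n))).
{ rewrite <- (ln_exp (- ln eps / Re z)); apply ln_increasing; [apply exp_pos|].
  eapply Rlt_le_trans; [exact HN|apply le_INR; lia]. }
apply Rmult_lt_compat_l with (r := Re z) in H; [|exact Hz].
replace (Re z * (- ln eps / Re z)) with (- ln eps) in H by (field; lra); lra.
Qed.

(** The constant makes the mean 0, so that integration can be repeated; when [e] has mean 0 the
    values at 0 and 1 agree, so that boundary terms telescope. Bernoulli polynomials arise in the
    same way. *)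
Definition antiderivative (e : R -> R) (t : R) : R :=
  RInt e 0 t - RInt (fun u => RInt e 0 u) 0 1.

Definition mean_zero_kernel (e : R -> R) : Prop :=
  (exists M, kernel e M) /\ RInt e 0 1 = 0.

Lemma continuous_ex_RInt (e : R -> R) (a b : R) : (forall t, continuous e t) -> ex_RInt e a b.
Proof. intros H; apply (ex_RInt_continuous (V := R_CompleteNormedModule)); auto. Qed.

Lemma is_derive_antiderivative (e : R -> R) (t : R) : (forall t, continuous e t) ->
  is_derive (antiderivative e) t (e t).
Proof.
intros He; unfold antiderivative.
replace (e t) with (minus (e t) zero) by (unfold minus, opp, plus, zero; simpl; ring).
apply (is_derive_minus (V := R_NormedModule)); [|apply @is_derive_const].
apply (is_derive_RInt (V := R_NormedModule) e (fun t => RInt e 0 t) 0); [|apply He].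
exists (mkposreal 1 Rlt_0_1); intros u _.
apply (RInt_correct (V := R_CompleteNormedModule)), continuous_ex_RInt, He.
Qed.

Lemma continuous_antiderivative (e : R -> R) (t : R) : (forall t, continuous e t) ->
  continuous (antiderivative e) t.
Proof.
intros He; apply continuous_of_ex_derive.
eexists; apply is_derive_antiderivative, He.
Qed.

Lemma kernel_continuous (e : R -> R) : (forall t, continuous e t) -> exists M, kernel e M.
Proof.
intros He; destruct (bounded_on (fun t => RtoC (e t)) 0 1) as [M [HM HM']].
- intros; apply Rcont_RtoC, He.
- exists M; split; [exact He|lra|]; intros t Ht; rewrite <- Cmod_R; apply HM', Ht.
Qed.

Lemma antiderivative_mean_zero (e : R -> R) :
  mean_zero_kernel e -> mean_zero_kernel (antiderivative e).
Proof.
intros [[M He] _]; assert (Hc := kernel_cont _ _ He); split.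
- apply kernel_continuous; intros t; apply continuous_antiderivative, Hc.
- unfold antiderivative; set (c := RInt (fun u => RInt e 0 u) 0 1).
  assert (H1 : is_RInt (fun u => RInt e 0 u) 0 1 c).
  { apply (RInt_correct (V := R_CompleteNormedModule)), continuous_ex_RInt; intros t.
    apply continuous_of_ex_derive.
    exists (e t); apply (is_derive_RInt (V := R_NormedModule) e (fun t => RInt e 0 t) 0); [|apply Hc].
    exists (mkposreal 1 Rlt_0_1); intros u _.
    apply (RInt_correct (V := R_CompleteNormedModule)), continuous_ex_RInt, Hc. }
  apply is_RInt_unique.
  assert (H2 := is_RInt_minus _ _ _ _ _ _ H1 (is_RInt_const (V := R_NormedModule) 0 1 c)).
  change (is_RInt (fun t => RInt e 0 t - c) 0 1 (c - (1 - 0) * c)) in H2.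
  replace (c - (1 - 0) * c) with 0 in H2 by ring; exact H2.
Qed.

Lemma antiderivative_periodic (e : R -> R) :
  mean_zero_kernel e -> antiderivative e 1 = antiderivative e 0.
Proof.
intros [_ H]; unfold antiderivative; rewrite H, RInt_point; reflexivity.
Qed.

Lemma cell_by_parts (e : R -> R) (z : C) (x : R) : mean_zero_kernel e -> 0 < x ->
  cell e z x = (RtoC (antiderivative e 0) * (pw (x + 1) z - pw x z)
    + z * cell (antiderivative e) (z + 1) x)%C.
Proof.
intros He Hx; assert (Hg := antiderivative_mean_zero e He).
assert (Hp := antiderivative_periodic e He).
destruct He as [[M He] _]; destruct Hg as [[N Hg] _].
assert (I : is_CRInt (fun t => RtoC (e t) * pw (x + t) z
    + RtoC (antiderivative e t) * (- (z * pw (x + t) (z + 1))))%C 0 1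
  (RtoC (antiderivative e 1) * pw (x + 1) z - RtoC (antiderivative e 0) * pw (x + 0) z)%C).
{ apply (is_CRInt_derive (fun t => RtoC (antiderivative e t) * pw (x + t) z)%C);
    intros t Ht; rewrite Rmin_left in Ht by lra.
  - apply is_Cderive_Rmult; [apply is_derive_antiderivative, (kernel_cont _ _ He)|].
    apply is_Cderive_pw; lra.
  - apply Rcont_plus; apply Rcont_mult.
    + apply Rcont_RtoC, (kernel_cont _ _ He).
    + apply Rcont_pw; lra.
    + apply Rcont_RtoC, (kernel_cont _ _ Hg).
    + apply (Rcont_comp_Ccont (fun w => - (z * w))%C (fun t => pw (x + t) (z + 1))).
      * apply Rcont_pw; lra.
      * apply Cdiff_Ccont, Cdiff_opp, Cdiff_scal, Cdiff_id. }
rewrite Hp, Rplus_0_r in I.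
assert (I2 := is_CRInt_Cmult z _ _ _ _ (cell_correct _ N (z + 1) x Hg Hx)).
assert (I3 := is_CRInt_plus _ _ _ _ _ _ I I2).
apply (is_CRInt_unique2 (fun t => RtoC (e t) * pw (x + t) z)%C 0 1).
- apply cell_correct with M; assumption.
- replace (RtoC (antiderivative e 0) * (pw (x + 1) z - pw x z))%C
    with (RtoC (antiderivative e 0) * pw (x + 1) z - RtoC (antiderivative e 0) * pw x z)%C by ring.
  eapply is_CRInt_ext; [|exact I3]; intros t _; simpl; ring.
Qed.

(** The boundary terms of consecutive cells telescope; only the one at the starting point 1, where
    every power is 1, survives in the limit. *)
Lemma strip_by_parts (e : R -> R) (z : C) : mean_zero_kernel e -> 2 <= Re z ->
  strip 1 e z 1 = (- RtoC (antiderivative e 0) + z * strip 1 (antiderivative e) (z + 1) 1)%C.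
Proof.
intros He Hz; assert (Hg := antiderivative_mean_zero e He).
assert (H1 : Rabs 1 <= 1) by (rewrite Rabs_R1; lra).
set (c := RtoC (antiderivative e 0)).
assert (S : forall N, Csum (strip_terms 1 e z 1) N =
  (c * (pw (INR (S N)) z - 1) + z * Csum (strip_terms 1 (antiderivative e) (z + 1) 1) N)%C).
{ induction N; [simpl; rewrite pw_base_1; ring|]; simpl Csum; rewrite IHN.
  unfold strip_terms at 2 4; rewrite pow1, cell_by_parts by (auto; generalize (pos_INR N); lra).
  fold c; replace (1 + INR N + 1) with (INR (S (S N))) by (rewrite !S_INR; ring).
  replace (1 + INR N) with (INR (S N)) by (rewrite S_INR; ring); ring. }
assert (Hg' := Hg); destruct He as [[M HM] _]; destruct Hg' as [[N HN] _].
destruct (strip_correct 1 e M z 1 H1 HM (Rle_refl 1) Hz) as [L1 _].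
destruct (strip_correct 1 (antiderivative e) N (z + 1) 1 H1 HN (Rle_refl 1)) as [L2 _];
  [rewrite re_plus, re_RtoC; lra|].
apply (Clim_unique _ _ _ L1).
eapply Clim_ext; [intros n; symmetry; apply S|].
replace (- c + z * strip 1 (antiderivative e) (z + 1) 1)%C
  with (c * (0 - 1) + z * strip 1 (antiderivative e) (z + 1) 1)%C by ring.
apply (Ctends_plus eventually); [|apply (Ctends_scal eventually), L2].
apply (Ctends_scal eventually), Clim_minus; [|apply (Ctends_const eventually)].
apply pw_lim_0; lra.
Qed.

(** Each integration by parts moves the argument one unit to the right, so p of them reach the
    half-plane Re s > 2 - p. *)
Fixpoint strip_cont (p : nat) (e : R -> R) (s : C) : C :=
  match p with
  | O => strip 1 e s 1
  | S p' => (- RtoC (antiderivative e 0) + s * strip_cont p' (antiderivative e) (s + 1))%C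
  end.

Lemma strip_cont_S (p : nat) : forall e s, mean_zero_kernel e -> 2 - INR p < Re s ->
  strip_cont (S p) e s = strip_cont p e s.
Proof.
induction p; intros e s He Hs.
- simpl in *; symmetry; apply strip_by_parts; [exact He|lra].
- change (strip_cont (S (S p)) e s) with
    (- RtoC (antiderivative e 0) + s * strip_cont (S p) (antiderivative e) (s + 1))%C.
  rewrite IHp; [reflexivity|apply antiderivative_mean_zero, He|].
  rewrite S_INR in Hs; rewrite re_plus, re_RtoC; lra.
Qed.

Lemma Cdiff_strip_cont (p : nat) : forall e s, mean_zero_kernel e -> 2 - INR p < Re s ->
  Cdiff (strip_cont p e) s.
Proof.
induction p; intros e s He Hs.
- destruct He as [[M He] _]; simpl in *.
  apply Cdiff_strip with M; try assumption; [rewrite Rabs_R1|..]; lra.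
- simpl; apply Cdiff_plus; [apply Cdiff_const|]; apply Cdiff_mult; [apply Cdiff_id|].
  apply (Cdiff_shift (strip_cont p (antiderivative e))); apply IHp.
  + apply antiderivative_mean_zero, He.
  + rewrite S_INR in Hs; rewrite re_plus, re_RtoC; lra.
Qed.

Lemma strip_entire (e : R -> R) : mean_zero_kernel e ->
  exists G, (forall s, Cdiff G s) /\ forall s, 2 < Re s -> G s = strip 1 e s 1.
Proof.
intros He.
assert (Hcov : forall s : C, exists q, 2 - INR q < Re s).
{ intros s; destruct (INR_unbounded (2 - Re s)) as [q Hq]; exists q; lra. }
destruct (glue (fun p => strip_cont p e) (fun p s => 2 - INR p < Re s)) as [G [G1 G2]].
- intros q s H; split; [rewrite S_INR; lra|apply strip_cont_S; assumption].
- exact Hcov.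
- intros q s H; exists (Re s - (2 - INR q)); split; [lra|]; intros w Hw.
  generalize (re_le_Cmod (w - s)); unfold Cminus; rewrite re_plus, re_opp; intros K.
  apply Rabs_le_between in K; unfold Cminus in Hw; lra.
- exists G; split.
  + intros s; destruct (Hcov s) as [q Hq]; apply (G2 q s Hq), Cdiff_strip_cont; assumption.
  + intros s Hs; apply (G1 O); simpl; lra.
Qed.

(* the second Bernoulli polynomial divided by 2! *)
Definition bernoulli2 (t : R) : R := (t ^ 2 - t + 1 / 6) / 2.

Lemma bernoulli2_mean_zero : mean_zero_kernel bernoulli2.
Proof.
split.
- apply kernel_continuous; intros t.
  apply continuous_of_ex_derive.
  unfold bernoulli2; auto_derive; auto.
- apply is_RInt_unique; set (P := fun t => (t ^ 3 / 3 - t ^ 2 / 2 + t / 6) / 2).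
  assert (I : is_RInt bernoulli2 0 1 (P 1 - P 0)).
  { apply (is_RInt_derive (V := R_CompleteNormedModule) P).
    - intros t _; unfold P, bernoulli2; auto_derive; auto; simpl; field.
    - intros t _; apply continuous_of_ex_derive.
      unfold bernoulli2; auto_derive; auto. }
  replace (P 1 - P 0) with 0 in I by (unfold P; field); exact I.
Qed.

(** [t - 1 / 2] is the derivative of [bernoulli2], so two integrations by parts amount to
    differentiating the single primitive [P]. *)
Lemma cell_bernoulli2 (s : C) (x : R) : s <> RtoC 1 -> 0 < x ->
  (s * (s + 1) * cell bernoulli2 (s + 2) x)%C =
  ((pw x (s - 1) - pw (x + 1) (s - 1)) / (s - 1) - (pw x s + pw (x + 1) s) / 2
   + s / 12 * (pw x (s + 1) - pw (x + 1) (s + 1)))%C.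
Proof.
intros Hs Hx; destruct bernoulli2_mean_zero as [[M He] _].
assert (Hs1 : (s - 1)%C <> RtoC 0) by (apply Cminus_eq_contra, Hs).
set (P := fun t => ((/ (s - 1)) * pw (x + t) (s - 1) + (RtoC (t - 1 / 2) * pw (x + t) s
  + RtoC (bernoulli2 t) * (s * pw (x + t) (s + 1))))%C).
assert (I : is_CRInt (fun t => (- (s * (s + 1))) * (RtoC (bernoulli2 t) * pw (x + t) (s + 2)))%C 0 1
  (P 1 - P 0)%C).
{ apply is_CRInt_derive; intros t Ht; rewrite Rmin_left in Ht by lra.
  - apply is_Cderive_ext with (f := P) (l :=
      ((/ (s - 1)) * (- ((s - 1) * pw (x + t) ((s - 1) + 1)))
       + ((RtoC 1 * pw (x + t) s + RtoC (t - 1 / 2) * (- (s * pw (x + t) (s + 1))))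
       + (RtoC (t - 1 / 2) * (s * pw (x + t) (s + 1))
          + RtoC (bernoulli2 t) * (s * (- ((s + 1) * pw (x + t) ((s + 1) + 1)))))))%C).
    + reflexivity.
    + replace ((s - 1) + 1)%C with s by ring.
      replace ((s + 1) + 1)%C with (s + 2)%C
        by (rewrite <- Cplus_assoc, <- RtoC_plus; do 2 f_equal; ring).
      field; exact Hs1.
    + apply is_Cderive_plus; [apply is_Cderive_Cmult, is_Cderive_pw; lra|].
      apply is_Cderive_plus.
      * apply (is_Cderive_Rmult (fun t => t - 1 / 2) (fun t => pw (x + t) s));
          [auto_derive; auto; ring|apply is_Cderive_pw; lra].
      * apply (is_Cderive_Rmult bernoulli2 (fun t => s * pw (x + t) (s + 1))%C).
        -- unfold bernoulli2; auto_derive; auto; field.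
        -- apply is_Cderive_Cmult, is_Cderive_pw; lra.
  - apply Rcont_mult; [apply Rcont_const|]; apply Rcont_mult.
    + apply Rcont_RtoC, (kernel_cont _ _ He).
    + apply Rcont_pw; lra. }
assert (I2 := is_CRInt_Cmult (- (s * (s + 1)))%C _ _ _ _ (cell_correct _ M (s + 2) x He Hx)).
assert (E := is_CRInt_unique2 _ _ _ _ _ I I2).
replace (s * (s + 1) * cell bernoulli2 (s + 2) x)%C
  with (- (- (s * (s + 1)) * cell bernoulli2 (s + 2) x))%C by ring.
rewrite <- E; unfold P; rewrite Rplus_0_r.
replace (bernoulli2 1) with (/ 12) by (unfold bernoulli2; field).
replace (bernoulli2 0) with (/ 12) by (unfold bernoulli2; field).
replace (1 - 1 / 2) with (/ 2) by field; replace (0 - 1 / 2) with (- / 2) by field.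
rewrite RtoC_opp, !RtoC_inv by lra.
field; exact Hs1.
Qed.

(* Euler-Maclaurin tail: [zeta_tail s x] is the sum of (x + j)^(-s) over j >= 0. *)
Definition zeta_tail (s : C) (x : R) : C :=
  (pw x (s - 1) / (s - 1) + pw x s / 2 + s / 12 * pw x (s + 1)
   - s * (s + 1) * strip 1 bernoulli2 (s + 2) x)%C.

Lemma zeta_tail_shift (s : C) (x : R) : s <> RtoC 1 -> 0 < Re s -> 1 <= x ->
  (zeta_tail s x - zeta_tail s (x + 1))%C = pw x s.
Proof.
intros Hs Hre Hx; destruct bernoulli2_mean_zero as [[M He] _].
assert (E := cell_bernoulli2 s x Hs ltac:(lra)).
rewrite <- (strip_shift 1 bernoulli2 M) in E; try assumption;
  [|rewrite Rabs_R1; lra|rewrite re_plus, re_RtoC; lra].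
unfold zeta_tail.
replace (pw x (s - 1) / (s - 1) + pw x s / 2 + s / 12 * pw x (s + 1)
  - s * (s + 1) * strip 1 bernoulli2 (s + 2) x
  - (pw (x + 1) (s - 1) / (s - 1) + pw (x + 1) s / 2 + s / 12 * pw (x + 1) (s + 1)
  - s * (s + 1) * strip 1 bernoulli2 (s + 2) (x + 1)))%C with
  (pw x (s - 1) / (s - 1) + pw x s / 2 + s / 12 * pw x (s + 1)
  - (pw (x + 1) (s - 1) / (s - 1) + pw (x + 1) s / 2 + s / 12 * pw (x + 1) (s + 1))
  - s * (s + 1) * (strip 1 bernoulli2 (s + 2) x - 1 * strip 1 bernoulli2 (s + 2) (x + 1)))%C
  by ring.
rewrite E; field; apply Cminus_eq_contra, Hs.
Qed.

Lemma Re_add_R (s : C) (a : R) : Re (s + RtoC a) = Re s + a.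
Proof. rewrite re_plus, re_RtoC; reflexivity. Qed.

Lemma Re_sub_R (s : C) (a : R) : Re (s - RtoC a) = Re s - a.
Proof. unfold Cminus; rewrite re_plus, re_opp, re_RtoC; ring. Qed.

Lemma strip_lim_0 (lam : R) (e : R -> R) (M : R) (z : C) :
  Rabs lam <= 1 -> kernel e M -> 2 <= Re z ->
  Clim (fun n => strip lam e z (INR (S n))) (RtoC 0).
Proof.
intros Hl He Hz; apply Clim_le_0 with (fun n => 2 * M * / INR (S n)).
- intros n; apply strip_bound; auto; apply INR_S_ge_1.
- replace (Finite 0) with (Rbar_mult (2 * M) 0) by (simpl; f_equal; ring).
  apply is_lim_seq_scal_l.
  apply (is_lim_seq_inv _ p_infty); [|discriminate].
  apply (is_lim_seq_incr_1 INR), is_lim_seq_INR.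
Qed.

Lemma zeta_tail_lim_0 (s : C) : 1 < Re s -> Clim (fun n => zeta_tail s (INR (S n))) (RtoC 0).
Proof.
intros Hs; destruct bernoulli2_mean_zero as [[M He] _].
apply (Clim_ext (fun n => / (s - 1) * pw (INR (S n)) (s - 1) + / 2 * pw (INR (S n)) s
  + s / 12 * pw (INR (S n)) (s + 1)
  - s * (s + 1) * strip 1 bernoulli2 (s + 2) (INR (S n)))%C).
- intros n; unfold zeta_tail; field; intros E; apply Ceq_minus in E; subst; simpl in Hs; lra.
- replace (RtoC 0) with (/ (s - 1) * 0 + / 2 * 0 + s / 12 * 0 - s * (s + 1) * 0)%C by ring.
  apply Clim_minus; [apply (Ctends_plus eventually); [apply (Ctends_plus eventually)|]|]; apply (Ctends_scal eventually).
  + apply pw_lim_0; rewrite Re_sub_R; lra.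
  + apply pw_lim_0; lra.
  + apply pw_lim_0; rewrite Re_add_R; lra.
  + apply strip_lim_0 with M; try assumption; [rewrite Rabs_R1; lra|rewrite Re_add_R; lra].
Qed.

Lemma zeta_tail_series (s : C) : 1 < Re s ->
  Clim (Csum (fun k => pw (INR (S k)) s)) (zeta_tail s 1).
Proof.
intros Hs.
assert (S : forall n, Csum (fun k => pw (INR (S k)) s) n = (zeta_tail s 1 - zeta_tail s (INR (S n)))%C).
{ induction n; [simpl; ring|]; rewrite Csum_S, IHn.
  rewrite <- (zeta_tail_shift s (INR (S n))), (S_INR (S n)).
  - ring.
  - intros E; subst; simpl in Hs; lra.
  - lra.
  - apply INR_S_ge_1. }
eapply Clim_ext; [intros n; symmetry; apply S|].
replace (zeta_tail s 1) with (zeta_tail s 1 - 0)%C at 1 by ring.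
apply Clim_minus; [apply (Ctends_const eventually)|apply zeta_tail_lim_0, Hs].
Qed.

(** At x = 1 all powers are 1, so [zeta_tail] is 1 / (s - 1) plus terms that become entire once the
    strip is replaced by its continuation [G]. *)
Lemma zeta_cont_exists : exists Z0 : C -> C, (forall s, Cdiff Z0 s) /\
  is_riemann_zeta (fun s => / (s - 1) + Z0 s)%C.
Proof.
destruct (strip_entire bernoulli2 bernoulli2_mean_zero) as [G [G1 G2]].
exists (fun s => / 2 + s / 12 - s * (s + 1) * G (s + 2))%C.
assert (D : forall s, Cdiff (fun s => / 2 + s / 12 - s * (s + 1) * G (s + 2))%C s).
{ intros s; apply Cdiff_minus.
  - apply Cdiff_plus; [apply Cdiff_const|]; apply Cdiff_mult; [apply Cdiff_id|apply Cdiff_const].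
  - apply Cdiff_mult; [apply Cdiff_mult; [apply Cdiff_id|]|apply (Cdiff_shift G), G1].
    apply Cdiff_plus; [apply Cdiff_id|apply Cdiff_const]. }
split; [exact D|]; split.
- intros s Hs; apply Cdiff_ex_derive, Cdiff_plus; [|apply D].
  apply (Cdiff_comp (fun s => s - 1)%C Cinv).
  + apply Cdiff_minus; [apply Cdiff_id|apply Cdiff_const].
  + apply Cdiff_inv, Cminus_eq_contra, Hs.
- intros s Hs; apply is_series_Csum.
  apply (Clim_ext (Csum (fun k => pw (INR (S k)) s))).
  + intros n; apply Csum_ext; intros k _; symmetry; apply inv_Rcpow.
  + replace (/ (s - 1) + (/ 2 + s / 12 - s * (s + 1) * G (s + 2)))%C with (zeta_tail s 1);
      [apply zeta_tail_series, Hs|].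
    unfold zeta_tail; rewrite !pw_base_1, G2 by (rewrite Re_add_R; lra).
    field; intros E; apply Ceq_minus in E; subst; simpl in Hs; lra.
Qed.

Lemma zeta_spec : is_riemann_zeta zeta.
Proof.
unfold zeta; apply epsilon_spec; destruct zeta_cont_exists as [Z0 [_ H]]; eexists; exact H.
Qed.

Lemma zeta_series (s : C) : 1 < Re s -> Clim (Csum (fun k => pw (INR (S k)) s)) (zeta s).
Proof.
intros Hs; assert (H := proj2 zeta_spec s Hs); apply is_series_Csum in H.
eapply Clim_ext; [|exact H]; intros n; apply Csum_ext; intros k _; apply inv_Rcpow.
Qed.

Lemma Cdiff_zeta (s : C) : s <> RtoC 1 -> Cdiff zeta s.
Proof. intros Hs; apply Cdiff_ex_derive, zeta_spec, Hs. Qed.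

(** [zeta] is known only by its specification; the identity theorem carries the Laurent form over
    from the concrete continuation. *)
Lemma zeta_laurent : exists Z0 : C -> C, (forall s, Cdiff Z0 s) /\
  forall s, s <> RtoC 1 -> zeta s = (/ (s - 1) + Z0 s)%C.
Proof.
destruct zeta_cont_exists as [Z0 [H [H1 H2]]]; exists Z0; split; [exact H|]; intros s Hs.
apply (proj2 (Ceq_minus _ _)), (identity_theorem_punctured (fun s => zeta s - (/ (s - 1) + Z0 s))%C);
  [| |exact Hs].
- intros w Hw; apply Cdiff_minus; [apply Cdiff_zeta, Hw|apply Cdiff_ex_derive, H1, Hw].
- intros w Hw; apply (proj1 (Ceq_minus _ _)).
  apply (Clim_unique (Csum (fun k => / Rcpow (INR (S k)) w)%C)).
  + exact (proj1 (is_series_Csum _ _) (proj2 zeta_spec w Hw)).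
  + exact (proj1 (is_series_Csum _ _) (H2 w Hw)).
Qed.

(** * Boole summation *)

Lemma continuous_euler_poly_coef (n : nat) (t : R) : continuous (euler_poly_coef n) t.
Proof.
apply continuous_of_ex_derive.
destruct n; [|eexists; apply is_derive_euler_poly_coef].
exists 0; apply is_derive_ext with (fun _ => 1).
- intros u; symmetry; apply euler_poly_coef_deg0.
- apply @is_derive_const.
Qed.

Lemma kernel_euler (n : nat) : exists M, kernel (euler_poly_coef n) M.
Proof. apply kernel_continuous, continuous_euler_poly_coef. Qed.

(* (-1)^j times the j-th derivative of x^(-s) *)
Definition pw_deriv (s : C) (j : nat) (x : R) : C := (rising s j * pw x (s + RtoC (INR j)))%C.

Lemma is_Cderive_pw_deriv (s : C) (j : nat) (x t : R) : 0 < x + t ->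
  is_Cderive (fun t => pw_deriv s j (x + t)) t (- pw_deriv s (S j) (x + t))%C.
Proof.
intros Ht; unfold pw_deriv; rewrite S_INR, RtoC_plus; simpl rising.
replace (- (rising s j * (s + RtoC (INR j)) * pw (x + t) (s + (RtoC (INR j) + 1))))%C
  with (rising s j * (- ((s + RtoC (INR j)) * pw (x + t) (s + RtoC (INR j) + 1))))%C
  by (rewrite Cplus_assoc; ring).
apply is_Cderive_Cmult, is_Cderive_pw, Ht.
Qed.

Lemma Rcont_pw_deriv (s : C) (j : nat) (x t : R) : 0 < x + t ->
  Rcont (fun t => pw_deriv s j (x + t)) t.
Proof. intros H; eapply is_Cderive_Rcont, is_Cderive_pw_deriv, H. Qed.

Lemma boole_primitive (s : C) (p : nat) (x t : R) : 0 < x + t ->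
  is_Cderive (fun t => Csum (fun j => RtoC (euler_poly_coef j t) * pw_deriv s j (x + t)) (S p))%C t
    (- (RtoC (euler_poly_coef p t) * pw_deriv s (S p) (x + t)))%C.
Proof.
intros Ht; induction p.
- apply is_Cderive_ext with (f := fun t => pw_deriv s 0 (x + t))
    (l := (- pw_deriv s 1 (x + t))%C); [| |apply is_Cderive_pw_deriv, Ht].
  + intros u; simpl Csum; rewrite euler_poly_coef_deg0; ring.
  + rewrite euler_poly_coef_deg0; ring.
- eapply is_Cderive_ext; [intros u; symmetry; apply Csum_S| |].
  2: { apply is_Cderive_plus; [exact IHp|].
       apply (is_Cderive_Rmult (euler_poly_coef (S p)) (fun t => pw_deriv s (S p) (x + t))).
       - apply is_derive_euler_poly_coef.
       - apply is_Cderive_pw_deriv, Ht. }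
  ring.
Qed.

Lemma boole_cell (s : C) (p : nat) (x : R) : 0 < x ->
  (rising s (S p) * cell (euler_poly_coef p) (s + RtoC (INR (S p))) x)%C =
  (Csum (fun j => RtoC (euler_poly_coef j 0) * pw_deriv s j x) (S p)
   - Csum (fun j => RtoC (euler_poly_coef j 1) * pw_deriv s j (x + 1)) (S p))%C.
Proof.
intros Hx; destruct (kernel_euler p) as [M He].
assert (I := is_CRInt_Cmult (- rising s (S p))%C _ _ _ _
  (cell_correct _ M (s + RtoC (INR (S p))) x He Hx)).
assert (J : is_CRInt (fun t => - (RtoC (euler_poly_coef p t) * pw_deriv s (S p) (x + t)))%C 0 1
  (Csum (fun j => RtoC (euler_poly_coef j 1) * pw_deriv s j (x + 1)) (S p)
   - Csum (fun j => RtoC (euler_poly_coef j 0) * pw_deriv s j (x + 0)) (S p))%C).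
{ apply (is_CRInt_derive (fun t => Csum (fun j => RtoC (euler_poly_coef j t) * pw_deriv s j (x + t)) (S p))%C);
    intros t Ht; rewrite Rmin_left in Ht by lra.
  - apply boole_primitive; lra.
  - apply (Rcont_comp_Ccont (fun w => - w)%C
      (fun t => RtoC (euler_poly_coef p t) * pw_deriv s (S p) (x + t))%C).
    + apply Rcont_mult; [apply Rcont_RtoC, continuous_euler_poly_coef|apply Rcont_pw_deriv; lra].
    + apply Cdiff_Ccont, Cdiff_opp, Cdiff_id. }
rewrite Rplus_0_r in J.
apply (is_CRInt_ext _ (fun t => - rising s (S p)
  * (RtoC (euler_poly_coef p t) * pw (x + t) (s + RtoC (INR (S p)))))%C) in J;
  [|intros t _; unfold pw_deriv; ring].
assert (E := is_CRInt_unique2 _ _ _ _ _ I J).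
replace (rising s (S p) * cell (euler_poly_coef p) (s + RtoC (INR (S p))) x)%C
  with (- (- rising s (S p) * cell (euler_poly_coef p) (s + RtoC (INR (S p))) x))%C by ring.
rewrite E; ring.
Qed.

Lemma euler_odd_sum (h : nat -> C) (q : nat) :
  Csum (fun j => RtoC (euler_coef j) * h j)%C (2 * S q) =
  (h O + Csum (fun m => RtoC (euler_coef (2 * m + 1)) * h (2 * m + 1)%nat)%C (S q))%C.
Proof.
induction q.
- simpl; rewrite euler_coef_0; ring.
- replace (2 * S (S q))%nat with (S (S (2 * S q))) by lia.
  rewrite 2!Csum_S, IHq, (Csum_S _ (S q)), euler_coef_even by lia.
  replace (S (2 * S q)) with (2 * S q + 1)%nat by lia; ring.
Qed.

(** This is E_(2q-1) divided by (2q-1)!; the factorial reappears in the remainder integral and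
    cancels the denominator in front of it. *)
Definition euler_kernel (q : nat) : R -> R := euler_poly_coef (2 * q - 1).

Notation euler_strip q s :=
  (strip (-1) (euler_kernel q) (Cplus s (RtoC (INR (Nat.mul 2 q))))).
Notation euler_weighted_strip q s :=
  (weighted_strip (-1) (euler_kernel q) (Cplus s (RtoC (INR (Nat.mul 2 q))))).

(** E_j(1) = -E_j(0) for j > 0 while E_0(1) = E_0(0): hence the powers enter with opposite signs and
    the derivatives with equal ones. *)
Lemma boole_cell_odd (s : C) (q : nat) (x : R) : (0 < q)%nat -> 0 < x ->
  (rising s (2 * q) * cell (euler_kernel q) (s + RtoC (INR (2 * q))) x)%C =
  (pw x s - pw (x + 1) s + Csum (fun m => RtoC (euler_coef (2 * m + 1))
     * (pw_deriv s (2 * m + 1) x + pw_deriv s (2 * m + 1) (x + 1))) q)%C.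
Proof.
intros Hq Hx; destruct q as [|q]; [lia|]; unfold euler_kernel.
replace (2 * S q)%nat with (S (2 * S q - 1)) by lia.
replace (S (2 * S q - 1) - 1)%nat with (2 * S q - 1)%nat by lia.
rewrite boole_cell by exact Hx; replace (S (2 * S q - 1)) with (2 * S q)%nat by lia.
rewrite (Csum_ext _ (fun j => RtoC (euler_coef j) * pw_deriv s j x)%C)
  by (intros; rewrite euler_poly_coef_0; reflexivity).
assert (E : Csum (fun j => RtoC (euler_poly_coef j 1) * pw_deriv s j (x + 1))%C (2 * S q) =
  (2 * pw_deriv s 0 (x + 1) - Csum (fun j => RtoC (euler_coef j) * pw_deriv s j (x + 1)) (2 * S q))%C).
{ replace (2 * S q)%nat with (S (2 * q + 1)) by lia; rewrite !Csum_shift.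
  rewrite euler_poly_coef_deg0, euler_coef_0.
  rewrite (Csum_ext _ (fun k => (-(1)) * (RtoC (euler_coef (S k)) * pw_deriv s (S k) (x + 1)))%C).
  - rewrite Csum_scal; ring.
  - intros k _; rewrite euler_poly_coef_1, RtoC_opp; ring. }
rewrite E, !euler_odd_sum.
rewrite (Csum_ext (fun m => RtoC (euler_coef (2 * m + 1))
     * (pw_deriv s (2 * m + 1) x + pw_deriv s (2 * m + 1) (x + 1)))%C
  (fun m => RtoC (euler_coef (2 * m + 1)) * pw_deriv s (2 * m + 1) x
   + RtoC (euler_coef (2 * m + 1)) * pw_deriv s (2 * m + 1) (x + 1))%C) by (intros; ring).
rewrite Csum_plus.
unfold pw_deriv at 1 3 4; simpl rising; simpl INR; rewrite Cplus_0_r; ring.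
Qed.

(* Boole summation: [boole q s x] is the alternating sum of (-1)^j (x + j)^(-s) over
   j >= 0, and continues it to 2 <= Re s + 2 q. *)
Definition boole (q : nat) (s : C) (x : R) : C :=
  ((pw x s - Csum (fun m => RtoC (euler_coef (2 * m + 1)) * pw_deriv s (2 * m + 1) x) q
    + rising s (2 * q) * euler_strip q s x) / 2)%C.

Lemma Rabs_m1_le : Rabs (-1) <= 1.
Proof. rewrite Rabs_left; lra. Qed.

(** With lam = -1, [strip_shift] reduces the two remainders to one cell, which [boole_cell_odd]
    evaluates; the derivative terms then cancel. *)
Lemma boole_shift (q : nat) (s : C) (x : R) : (0 < q)%nat -> 1 <= x ->
  2 <= Re s + INR (2 * q) -> (boole q s x + boole q s (x + 1))%C = pw x s.
Proof.
intros Hq Hx Hs; destruct (kernel_euler (2 * q - 1)) as [M He].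
assert (E := boole_cell_odd s q x Hq ltac:(lra)).
rewrite <- (strip_shift (-1) (euler_kernel q) M _ x Rabs_m1_le He Hx) in E
  by (rewrite Re_add_R; exact Hs).
rewrite (Csum_ext _ (fun m => RtoC (euler_coef (2 * m + 1)) * pw_deriv s (2 * m + 1) x
   + RtoC (euler_coef (2 * m + 1)) * pw_deriv s (2 * m + 1) (x + 1))%C) in E by (intros; ring).
rewrite Csum_plus in E; unfold boole.
set (A := Csum (fun m => RtoC (euler_coef (2 * m + 1)) * pw_deriv s (2 * m + 1) x)%C q) in *.
set (B := Csum (fun m => RtoC (euler_coef (2 * m + 1)) * pw_deriv s (2 * m + 1) (x + 1))%C q) in *.
set (P := euler_strip q s x) in *.
set (P' := euler_strip q s (x + 1)) in *.
match type of E with ?X = _ =>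
  transitivity ((pw x s - A + pw (x + 1) s - B + X) / 2)%C; [field|rewrite E; field]
end.
Qed.

Lemma Clim_Csum (u : nat -> nat -> C) (l : nat -> C) (q : nat) :
  (forall m, (m < q)%nat -> Clim (u m) (l m)) -> Clim (fun n => Csum (fun m => u m n) q) (Csum l q).
Proof.
induction q; intros H; [exact ((Ctends_const eventually) (RtoC 0))|]; simpl.
apply (Ctends_plus eventually); [apply IHq; intros|]; apply H; lia.
Qed.

Lemma Clim_scal_0 (c : C) (u : nat -> C) : Clim u (RtoC 0) -> Clim (fun n => c * u n)%C (RtoC 0).
Proof. intros H; replace (RtoC 0) with (c * 0)%C by ring; apply (Ctends_scal eventually), H. Qed.

Lemma pw_deriv_lim_0 (s : C) (j : nat) : 0 < Re s + INR j ->
  Clim (fun n => pw_deriv s j (INR (S n))) (RtoC 0).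
Proof. intros H; apply Clim_scal_0, pw_lim_0; rewrite Re_add_R; exact H. Qed.

Lemma euler_strip_lim_0 (q : nat) (s : C) : 2 <= Re s + INR (2 * q) ->
  Clim (fun n => rising s (2 * q) * euler_strip q s (INR (S n)))%C
    (RtoC 0).
Proof.
intros H; destruct (kernel_euler (2 * q - 1)) as [M He].
apply Clim_scal_0, strip_lim_0 with M; [apply Rabs_m1_le|exact He|rewrite Re_add_R; exact H].
Qed.

Lemma boole_lim_0 (q : nat) (s : C) : 0 < Re s -> 2 <= Re s + INR (2 * q) ->
  Clim (fun n => boole q s (INR (S n))) (RtoC 0).
Proof.
intros H0 H2.
apply (Clim_ext (fun n => / 2 * (pw (INR (S n)) s
  - Csum (fun m => RtoC (euler_coef (2 * m + 1)) * pw_deriv s (2 * m + 1) (INR (S n))) q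
  + rising s (2 * q) * euler_strip q s (INR (S n))))%C).
- intros n; unfold boole; field.
- apply Clim_scal_0; replace (RtoC 0) with (0 - 0 + 0)%C by ring.
  apply (Ctends_plus eventually); [apply Clim_minus|].
  + apply pw_lim_0, H0.
  + rewrite <- (Csum_zero q).
    apply (Clim_Csum (fun m n => RtoC (euler_coef (2 * m + 1)) * pw_deriv s (2 * m + 1) (INR (S n)))%C
      (fun _ => RtoC 0)).
    intros m _; apply Clim_scal_0, pw_deriv_lim_0; generalize (pos_INR (2 * m + 1)); lra.
  + apply euler_strip_lim_0, H2.
Qed.

Lemma alternating_null (D : nat -> C) :
  (forall n, (D n + D (S n))%C = RtoC 0) -> Clim D (RtoC 0) -> forall n, D n = RtoC 0.
Proof.
intros H HL n.
assert (K : forall k, Cmod (D (k + n)%nat) = Cmod (D n)).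
{ induction k; [reflexivity|]; rewrite <- IHk; simpl.
  replace (D (S (k + n))) with (- D (k + n)%nat)%C; [apply Cmod_opp|].
  replace (D (S (k + n))) with (D (k + n)%nat + D (S (k + n)) - D (k + n)%nat)%C by ring.
  rewrite H; ring. }
apply Cmod_small_0; intros eps He; destruct (HL eps He) as [N HN].
rewrite <- (K N); specialize (HN (N + n)%nat ltac:(lia)).
replace (D (N + n)%nat - 0)%C with (D (N + n)%nat) in HN by ring; lra.
Qed.

(** For Re s <= 0 the expansions need not tend to 0 separately. In their difference only the
    derivative term of order 2q + 1 and the two remainders are left, and these decay on the whole
    range. *)
Lemma boole_succ (q : nat) (s : C) (n : nat) : (0 < q)%nat -> 2 <= Re s + INR (2 * q) ->
  boole (S q) s (INR (S n)) = boole q s (INR (S n)).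
Proof.
intros Hq Hs.
assert (Hs' : 2 <= Re s + INR (2 * S q)).
{ replace (2 * S q)%nat with (2 * q + 2)%nat by lia; rewrite plus_INR; simpl (INR 2); lra. }
apply (proj2 (Ceq_minus _ _)).
apply (alternating_null (fun n => boole (S q) s (INR (S n)) - boole q s (INR (S n)))%C).
- intros k; rewrite (S_INR (S k)).
  replace (boole (S q) s (INR (S k)) - boole q s (INR (S k))
    + (boole (S q) s (INR (S k) + 1) - boole q s (INR (S k) + 1)))%C
  with ((boole (S q) s (INR (S k)) + boole (S q) s (INR (S k) + 1))
    - (boole q s (INR (S k)) + boole q s (INR (S k) + 1)))%C by ring.
  rewrite !boole_shift by (try apply INR_S_ge_1; auto; lia); ring.
- apply (Clim_ext (fun n => / 2 * (rising s (2 * S q) * euler_strip (S q) s (INR (S n))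
    - RtoC (euler_coef (2 * q + 1)) * pw_deriv s (2 * q + 1) (INR (S n))
    - rising s (2 * q) * euler_strip q s (INR (S n))))%C).
  + intros k; unfold boole; rewrite Csum_S; field.
  + apply Clim_scal_0; replace (RtoC 0) with (0 - 0 - 0)%C by ring.
    apply Clim_minus; [apply Clim_minus|].
    * apply euler_strip_lim_0, Hs'.
    * apply Clim_scal_0, pw_deriv_lim_0; rewrite plus_INR; simpl (INR 1); lra.
    * apply euler_strip_lim_0, Hs.
Qed.

Lemma Cdiff_rising (j : nat) (s : C) : Cdiff (fun s => rising s j) s.
Proof.
induction j; simpl; [apply Cdiff_const|]; apply Cdiff_mult; [exact IHj|].
apply Cdiff_plus; [apply Cdiff_id|apply Cdiff_const].
Qed.

Lemma Cdiff_Csum (u : nat -> C -> C) (q : nat) (s : C) :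
  (forall m, (m < q)%nat -> Cdiff (u m) s) -> Cdiff (fun s => Csum (fun m => u m s) q) s.
Proof.
induction q; intros H; simpl; [apply Cdiff_const|].
apply Cdiff_plus; [apply IHq; intros|]; apply H; lia.
Qed.

Lemma Cdiff_boole (q : nat) (s : C) (x : R) : 1 <= x -> 2 < Re s + INR (2 * q) ->
  Cdiff (fun s => boole q s x) s.
Proof.
intros Hx Hs; destruct (kernel_euler (2 * q - 1)) as [M He].
unfold boole, Cdiv; apply Cdiff_mult; [|apply Cdiff_const].
apply Cdiff_plus; [apply Cdiff_minus|].
- apply Cdiff_pw.
- apply (Cdiff_Csum (fun m s => RtoC (euler_coef (2 * m + 1)) * pw_deriv s (2 * m + 1) x)%C).
  intros m _; apply Cdiff_scal; unfold pw_deriv; apply Cdiff_mult; [apply Cdiff_rising|].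
  apply (Cdiff_shift (pw x)), Cdiff_pw.
- apply Cdiff_mult; [apply Cdiff_rising|].
  apply (Cdiff_shift (fun z => strip (-1) (euler_kernel q) z x)), Cdiff_strip with M; auto.
  + apply Rabs_m1_le.
Qed.

(** The right-hand side of the continuation formula, with (2m+1)! absorbed in [euler_coef] and the
    integral replaced by its series over n. *)
Definition zeta_boole (q : nat) (s : C) : C :=
  (zeta (s + 1) - Csum (fun m => RtoC (euler_coef (2 * m + 1)) *
     (rising s (2 * m + 1) * zeta (s + RtoC (INR (2 * m + 2))))) q
   + rising s (2 * q) * euler_weighted_strip q s)%C.

Lemma inv_mul_pw (n : nat) (z : C) :
  (RtoC (/ INR (S n)) * pw (INR (S n)) z)%C = pw (INR (S n)) (z + 1).
Proof.
rewrite pw_plus, pw_1 by (generalize (INR_S_ge_1 n); lra); ring.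
Qed.

Lemma pw_deriv_series (s : C) (j : nat) : 0 < Re s + INR j ->
  Clim (Csum (fun n => RtoC (/ INR (S n)) * pw_deriv s j (INR (S n)))%C)
    (rising s j * zeta (s + RtoC (INR (j + 1))))%C.
Proof.
intros H.
apply (Clim_ext (fun N => rising s j * Csum (fun k => pw (INR (S k)) (s + RtoC (INR (j + 1)))) N)%C).
- intros n; rewrite <- Csum_scal; apply Csum_ext; intros k _; unfold pw_deriv.
  rewrite plus_INR, RtoC_plus, Cplus_assoc, <- inv_mul_pw; ring.
- apply (Ctends_scal eventually), zeta_series; rewrite Re_add_R, plus_INR; simpl (INR 1); lra.
Qed.

Lemma Csum_exchange (u : nat -> nat -> C) (p q : nat) :
  Csum (fun i => Csum (fun j => u i j) q) p = Csum (fun j => Csum (fun i => u i j) p) q.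
Proof.
induction p; simpl; [|rewrite IHp, <- Csum_plus; reflexivity].
induction q; simpl; [reflexivity|rewrite <- IHq; ring].
Qed.

(** Division by n raises every exponent by one, so the powers in the expansion sum to values of
    zeta. *)
Lemma boole_series (q : nat) (s : C) : 0 < Re s -> 2 <= Re s + INR (2 * q) ->
  Clim (Csum (fun n => 2 * (RtoC (/ INR (S n)) * boole q s (INR (S n))))%C) (zeta_boole q s).
Proof.
intros H0 H2; destruct (kernel_euler (2 * q - 1)) as [M He].
apply (Clim_ext (fun N => Csum (fun n => RtoC (/ INR (S n)) * pw_deriv s 0 (INR (S n))) N
  - Csum (fun m => RtoC (euler_coef (2 * m + 1))
      * Csum (fun n => RtoC (/ INR (S n)) * pw_deriv s (2 * m + 1) (INR (S n))) N) q
  + rising s (2 * q) * Csum (weighted_strip_terms (-1) (euler_kernel q) (s + RtoC (INR (2 * q)))) N)%C).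
- intros N.
  rewrite (Csum_ext (fun m => RtoC (euler_coef (2 * m + 1)) *
      Csum (fun n => RtoC (/ INR (S n)) * pw_deriv s (2 * m + 1) (INR (S n))) N)%C
    (fun m => Csum (fun n => RtoC (euler_coef (2 * m + 1)) *
      (RtoC (/ INR (S n)) * pw_deriv s (2 * m + 1) (INR (S n)))) N)%C)
    by (intros; symmetry; apply Csum_scal).
  rewrite Csum_exchange, <- Csum_scal, <- Csum_minus, <- Csum_plus.
  apply Csum_ext; intros n _; unfold boole, weighted_strip_terms.
  replace (pw_deriv s 0 (INR (S n))) with (pw (INR (S n)) s)
    by (unfold pw_deriv; simpl rising; simpl (INR 0); rewrite Cplus_0_r; ring).
  rewrite (Csum_ext (fun m => RtoC (euler_coef (2 * m + 1)) *
      (RtoC (/ INR (S n)) * pw_deriv s (2 * m + 1) (INR (S n))))%C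
    (fun m => RtoC (/ INR (S n)) * (RtoC (euler_coef (2 * m + 1)) * pw_deriv s (2 * m + 1) (INR (S n))))%C)
    by (intros; ring).
  rewrite Csum_scal; field.
- unfold zeta_boole; apply (Ctends_plus eventually); [apply Clim_minus|].
  + assert (K := pw_deriv_series s 0 ltac:(simpl; lra)); simpl rising in K; simpl (INR _) in K.
    rewrite Cmult_1_l in K; exact K.
  + apply (Clim_Csum (fun m N => RtoC (euler_coef (2 * m + 1))
      * Csum (fun n => RtoC (/ INR (S n)) * pw_deriv s (2 * m + 1) (INR (S n))) N)%C
      (fun m => RtoC (euler_coef (2 * m + 1)) *
        (rising s (2 * m + 1) * zeta (s + RtoC (INR (2 * m + 2)))))%C).
    intros m _; apply (Ctends_scal eventually).
    replace (2 * m + 2)%nat with (2 * m + 1 + 1)%nat by lia.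
    apply pw_deriv_series; generalize (pos_INR (2 * m + 1)); lra.
  + apply (Ctends_scal eventually), weighted_strip_correct with M; [apply Rabs_m1_le|exact He|].
    rewrite Re_add_R; exact H2.
Qed.

Lemma zeta_boole_succ (q : nat) (s : C) : (0 < q)%nat -> 2 <= Re s + INR (2 * q) ->
  zeta_boole (S q) s = zeta_boole q s.
Proof.
intros Hq Hs.
assert (Hs' : 2 <= Re s + INR (2 * S q)).
{ replace (2 * S q)%nat with (2 * q + 2)%nat by lia; rewrite plus_INR; simpl (INR 2); lra. }
destruct (kernel_euler (2 * q - 1)) as [M He]; destruct (kernel_euler (2 * S q - 1)) as [M' He'].
assert (L : Clim (fun N => rising s (2 * S q) * Csum (weighted_strip_terms (-1) (euler_kernel (S q)) (s + RtoC (INR (2 * S q)))) N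
   - RtoC (euler_coef (2 * q + 1))
      * Csum (fun n => RtoC (/ INR (S n)) * pw_deriv s (2 * q + 1) (INR (S n))) N
   - rising s (2 * q) * Csum (weighted_strip_terms (-1) (euler_kernel q) (s + RtoC (INR (2 * q)))) N)%C
  (rising s (2 * S q) * euler_weighted_strip (S q) s
   - RtoC (euler_coef (2 * q + 1)) * (rising s (2 * q + 1) * zeta (s + RtoC (INR (2 * q + 2))))
   - rising s (2 * q) * euler_weighted_strip q s)%C).
{ apply Clim_minus; [apply Clim_minus|]; apply (Ctends_scal eventually).
  - apply weighted_strip_correct with M'; [apply Rabs_m1_le|exact He'|rewrite Re_add_R; exact Hs'].
  - replace (2 * q + 2)%nat with (2 * q + 1 + 1)%nat by lia.
    apply pw_deriv_series; rewrite plus_INR; simpl (INR 1); lra.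
  - apply weighted_strip_correct with M; [apply Rabs_m1_le|exact He|rewrite Re_add_R; exact Hs]. }
apply (Clim_ext _ (fun _ => RtoC 0)) in L.
- assert (E := Clim_unique _ _ _ ((Ctends_const eventually) (RtoC 0)) L).
  apply (proj2 (Ceq_minus _ _)); rewrite E; unfold zeta_boole; rewrite Csum_S; ring.
- intros N; rewrite <- !Csum_scal, <- !Csum_minus.
  rewrite (Csum_ext _ (fun _ => RtoC 0)); [apply Csum_zero|].
  intros n _; assert (E := boole_succ q s n Hq Hs); unfold boole in E.
  apply (proj1 (Ceq_minus _ _)) in E; rewrite Csum_S in E; unfold weighted_strip_terms.
  match type of E with ?X = _ => transitivity (RtoC (/ INR (S n)) * 2 * X)%C end.
  + field.
  + rewrite E; ring.
Qed.

(** * The remainder integral, the series v and special values of zeta *)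

Definition phi_term (z : C) (t : R) (k : nat) : C :=
  (RtoC (/ INR (S k)) * pw (INR (S k) + t) z)%C.

Lemma Rcpow_neq_0 (x : R) (z : C) : Rcpow x z <> RtoC 0.
Proof. apply Cexp_neq_0. Qed.

Lemma phi_plus_term_eq (z : C) (t : R) (k : nat) : phi_plus_term z t (S k) = phi_term z t k.
Proof.
unfold phi_plus_term, phi_term; rewrite <- inv_Rcpow, RtoC_inv by (apply not_0_INR; lia).
field; split; [apply Rcpow_neq_0|].
intros E; apply RtoC_inj in E; apply (not_0_INR (S k)); [lia|exact E].
Qed.

(** (k + 1 + t)^2 >= (k + 1)(t + 1): one factor joins the weight 1/(k + 1) to give summability in k,
    the other keeps decay in t. *)
Lemma phi_term_bound (z : C) (t : R) (k : nat) : 0 <= t -> 2 <= Re z ->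
  Cmod (phi_term z t k) <= / (1 + t) / (1 + INR k) ^ 2.
Proof.
intros Ht Hz; unfold phi_term; assert (Hk := pos_INR k).
rewrite Cmod_mult, Cmod_R, S_INR, Rabs_right by (apply Rle_ge, Rlt_le, Rinv_0_lt_compat; lra).
apply Rle_trans with (/ (INR k + 1) * / ((1 + INR k) * (1 + t))).
- apply Rmult_le_compat_l; [apply Rlt_le, Rinv_0_lt_compat; lra|].
  eapply Rle_trans; [apply Cmod_pw_le with (k := 2%nat); [lra|exact Hz]|].
  apply Rinv_le_contravar; [apply Rmult_lt_0_compat; lra|]; nra.
- right; field; lra.
Qed.

Lemma phi_plus_correct (z : C) (t : R) : 0 <= t -> 2 <= Re z ->
  ex_Cseries (fun k => phi_plus_term z t (S k)) /\
  forall N, Cmod (phi_plus z t - Csum (phi_term z t) N) <= 2 * / (1 + t) / (1 + INR N).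
Proof.
intros Ht Hz.
destruct (Csum_conv (phi_term z t) (/ (1 + t)) 1) as [l [H1 H2]].
- apply Rlt_le, Rinv_0_lt_compat; lra.
- lra.
- intros n; apply phi_term_bound; assumption.
- assert (H3 : Clim (Csum (fun k => phi_plus_term z t (S k))) l).
  { eapply Clim_ext; [|exact H1]; intros n; apply Csum_ext; intros k _.
    symmetry; apply phi_plus_term_eq. }
  split; [exists l; exact (proj2 (is_series_Csum _ _) H3)|].
  unfold phi_plus; rewrite (Cseries_unique _ _ H3); exact H2.
Qed.

Lemma phi_plus_bound (z : C) (t : R) : 0 <= t -> 2 <= Re z -> Cmod (phi_plus z t) <= 2 / (1 + t).
Proof.
intros Ht Hz; destruct (phi_plus_correct z t Ht Hz) as [_ H]; specialize (H O); simpl in H.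
replace (phi_plus z t - 0)%C with (phi_plus z t) in H by ring.
replace (2 / (1 + t)) with (2 * / (1 + t) / (1 + 0)) by (field; lra); exact H.
Qed.

Lemma is_CRInt_Csum (f : nat -> R -> C) (l : nat -> C) (a b : R) (N : nat) :
  (forall k, is_CRInt (f k) a b (l k)) ->
  is_CRInt (fun t => Csum (fun k => f k t) N) a b (Csum l N).
Proof.
intros H; induction N.
- simpl; assert (I0 := is_RInt_const (V := C_R_NormedModule) a b (RtoC 0)).
  rewrite scal_R_Cmult, Cmult_0_r in I0; exact I0.
- apply is_CRInt_plus; auto.
Qed.

(** The exchange of limit and integral below asks for uniform convergence on the whole line;
    clipping the variable confines it to [0, 1]. *)
Definition clip (t : R) : R := Rmax 0 (Rmin 1 t).

Lemma clip_bounds (t : R) : 0 <= clip t <= 1.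
Proof.
unfold clip, Rmax, Rmin; destruct (Rle_dec 1 t), (Rle_dec 0 _); lra.
Qed.

Lemma clip_id (t : R) : 0 <= t <= 1 -> clip t = t.
Proof.
intros H; unfold clip; rewrite Rmin_right, Rmax_right by lra; reflexivity.
Qed.

Lemma phi_cell (e : R -> R) (M : R) (z : C) (j : nat) : kernel e M -> 2 <= Re z ->
  exists W, is_CRInt (fun u => RtoC (e u) * phi_plus z (INR j + u))%C 0 1 W /\
    Clim (Csum (fun k => RtoC (/ INR (S k)) * cell e z (INR (S k) + INR j))%C) W.
Proof.
intros He Hz; assert (HM := kernel_pos _ _ He); assert (Hj := pos_INR j).
destruct (filterlim_RInt (V := C_R_CompleteNormedModule)
  (fun N u => RtoC (e (clip u)) * Csum (phi_term z (INR j + clip u)) N)%C 0 1 eventually _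
  (fun u => RtoC (e (clip u)) * phi_plus z (INR j + clip u))%C
  (fun N => Csum (fun k => RtoC (/ INR (S k)) * cell e z (INR (S k) + INR j))%C N)) as [W [H1 H2]].
- intros N.
  apply is_CRInt_ext with (fun u => Csum (fun k => RtoC (/ INR (S k)) *
    (RtoC (e u) * pw (INR (S k) + INR j + u) z)) N)%C.
  + intros u Hu; rewrite Rmin_left, Rmax_right in Hu by lra.
    rewrite clip_id by lra; rewrite <- Csum_scal; apply Csum_ext; intros k _.
    unfold phi_term; rewrite Rplus_assoc; ring.
  + apply (is_CRInt_Csum (fun k u => RtoC (/ INR (S k)) *
      (RtoC (e u) * pw (INR (S k) + INR j + u) z))%C).
    intros k; apply is_CRInt_Cmult, cell_correct with M; [exact He|].
    generalize (INR_S_ge_1 k); lra.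
- apply filterlim_locally; intros eps; assert (Heps := cond_pos eps).
  destruct (INR_unbounded (2 * M / eps)) as [N HN].
  exists N; intros n Hn u; apply ball_C_Cmod; assert (Hu := clip_bounds u).
  replace (RtoC (e (clip u)) * Csum (phi_term z (INR j + clip u)) n
    - RtoC (e (clip u)) * phi_plus z (INR j + clip u))%C
    with (- (RtoC (e (clip u)) * (phi_plus z (INR j + clip u) - Csum (phi_term z (INR j + clip u)) n)))%C
    by ring.
  rewrite Cmod_opp, Cmod_mult, Cmod_R.
  destruct (phi_plus_correct z (INR j + clip u) ltac:(lra) Hz) as [_ B]; specialize (B n).
  assert (Hn' : INR N <= INR n) by (apply le_INR, Hn).
  assert (HN0 := pos_INR N).
  apply Rle_lt_trans with (M * (2 * / (1 + (INR j + clip u)) / (1 + INR n))).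
  + apply Rmult_le_compat; [apply Rabs_pos|apply Cmod_ge_0|apply (kernel_bound _ _ He), Hu|exact B].
  + apply Rle_lt_trans with (2 * M / (1 + INR n)).
    * replace (2 * M / (1 + INR n)) with (M * (2 * / 1 / (1 + INR n))) by (field; lra).
      apply Rmult_le_compat_l; [lra|]; apply Rmult_le_compat_r;
        [apply Rlt_le, Rinv_0_lt_compat; lra|].
      apply Rmult_le_compat_l; [lra|]; apply Rinv_le_contravar; lra.
    * apply Rmult_lt_reg_r with (1 + INR n); [lra|].
      unfold Rdiv at 1; rewrite Rmult_assoc, Rinv_l, Rmult_1_r by lra.
      apply Rmult_lt_compat_l with (r := eps) in HN; [|exact Heps].
      replace (eps * (2 * M / eps)) with (2 * M) in HN by (field; lra).
      nra.
- exists W; split; [|apply (filterlim_Ctends eventually); exact H1].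
  eapply is_CRInt_ext; [|exact H2]; intros u Hu; rewrite Rmin_left, Rmax_right in Hu by lra.
  simpl; rewrite clip_id by lra; reflexivity.
Qed.

Lemma euler_bar_shift_n (q n : nat) (x : R) : euler_bar q (x + INR n) = (-1) ^ n * euler_bar q x.
Proof.
induction n; [simpl; rewrite Rplus_0_r; ring|].
rewrite S_INR, <- Rplus_assoc, euler_bar_shift, IHn; simpl; ring.
Qed.

(** -t + j + 1 = 1 - (t - j) lies in (0, 1). The j + 1 antiperiods give (-1)^(j+1), and reflecting a
    polynomial of odd degree gives one more sign. The interval is open because t = j would lead to
    the endpoint 1. *)
Lemma euler_bar_opp (q j : nat) (t : R) : (0 < q)%nat -> INR j < t < INR j + 1 ->
  euler_bar (2 * q - 1) (- t) =
  (-1) ^ j * (INR (fact (2 * q - 1)) * euler_kernel q (t - INR j)).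
Proof.
intros Hq Ht.
assert (E := euler_bar_shift_n (2 * q - 1) (S j) (- t)).
rewrite euler_bar_unit in E by (rewrite S_INR; lra).
assert (E2 : (-1) ^ S j * (-1) ^ S j = 1).
{ rewrite <- Rpow_mult_distr; replace (-1 * -1) with 1 by ring; apply pow1. }
replace (euler_bar (2 * q - 1) (- t)) with ((-1) ^ S j * ((-1) ^ S j * euler_bar (2 * q - 1) (- t)))
  by (rewrite <- Rmult_assoc, E2; ring).
rewrite <- E.
replace (- t + INR (S j)) with (1 - (t - INR j)) by (rewrite S_INR; ring).
assert (E3 := euler_poly_eq (2 * q - 1) (1 - (t - INR j))).
rewrite euler_poly_coef_sym in E3.
replace ((-1) ^ (2 * q - 1)) with (-1) in E3.
- unfold euler_kernel; simpl pow.
  replace (euler_poly (2 * q - 1) (1 - (t - INR j)))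
    with (euler_poly (2 * q - 1) (1 - (t - INR j)) / INR (fact (2 * q - 1)) * INR (fact (2 * q - 1)))
    by (field; apply INR_fact_neq_0).
  rewrite E3; ring.
- destruct q; [lia|]; replace (2 * S q - 1)%nat with (S (2 * q)) by lia.
  rewrite pow_1_odd; reflexivity.
Qed.

Section Remainder.

Variables (q : nat) (s : C) (M : R).
Hypothesis q_pos : (0 < q)%nat.
Let z := (s + RtoC (INR (2 * q)))%C.
Hypothesis Re_z : 3 <= Re z.
Hypothesis kernel_M : kernel (euler_kernel q) M.
Let c := RtoC (INR (fact (2 * q - 1))).

Lemma remainder_cell (j : nat) :
  exists W, is_CRInt (remainder_integrand q s) (INR j) (INR (S j)) (c * (RtoC ((-1) ^ j) * W))%C /\
    Clim (Csum (fun k => RtoC (/ INR (S k)) * cell (euler_kernel q) z (INR (S k) + INR j))%C) W.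
Proof.
destruct (phi_cell (euler_kernel q) M z j kernel_M ltac:(lra)) as [W [H1 H2]].
exists W; split; [|exact H2].
assert (H3 : is_CRInt (fun u => RtoC (euler_kernel q u) * phi_plus z (INR j + u))%C
  (1 * INR j + - INR j) (1 * INR (S j) + - INR j) W).
{ replace (1 * INR j + - INR j) with 0 by ring.
  replace (1 * INR (S j) + - INR j) with 1 by (rewrite S_INR; ring); exact H1. }
apply (is_RInt_comp_lin (V := C_R_NormedModule)) in H3.
assert (H4 := is_CRInt_Cmult (c * RtoC ((-1) ^ j))%C _ _ _ _ H3).
rewrite Cmult_assoc; eapply is_CRInt_ext; [|exact H4].
intros t Ht; rewrite S_INR, Rmin_left, Rmax_right in Ht by lra; simpl.
rewrite scal_R_Cmult; unfold remainder_integrand; fold z.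
rewrite (euler_bar_opp q j) by assumption.
replace (1 * t + - INR j) with (t - INR j) by ring.
replace (INR j + (t - INR j)) with t by ring.
unfold c; rewrite !RtoC_mult; ring.
Qed.

(** For finite N the integral is a sum over k of N-term partial sums of the strips; comparing with
    the complete strips is left to [strip_tail]. *)
Lemma remainder_upto (N : nat) : exists V,
  is_CRInt (remainder_integrand q s) 0 (INR N) (c * V)%C /\
  Clim (Csum (fun k => RtoC (/ INR (S k)) * Csum (strip_terms (-1) (euler_kernel q) z (INR (S k))) N)%C) V.
Proof.
induction N as [|N [V [IH1 IH2]]].
- exists (RtoC 0); split.
  + rewrite Cmult_0_r; apply (is_RInt_point (V := C_R_NormedModule)).
  + apply (Clim_ext (fun _ => RtoC 0)); [|apply (Ctends_const eventually)].
    intros n; symmetry; rewrite <- (Csum_zero n); apply Csum_ext; intros k _; simpl Csum; ring.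
- destruct (remainder_cell N) as [W [H1 H2]].
  exists (V + RtoC ((-1) ^ N) * W)%C; split.
  + replace (c * (V + RtoC ((-1) ^ N) * W))%C with (c * V + c * (RtoC ((-1) ^ N) * W))%C by ring.
    apply is_CRInt_Chasles with (INR N); assumption.
  + eapply Clim_ext; [|exact ((Ctends_plus eventually) _ _ _ _ IH2 ((Ctends_scal eventually) (RtoC ((-1) ^ N)) _ _ H2))].
    intros n; cbv beta; rewrite <- Csum_scal, <- Csum_plus; apply Csum_ext; intros k _.
    rewrite Csum_S.
    replace (strip_terms (-1) (euler_kernel q) z (INR (S k)) N)
      with (RtoC ((-1) ^ N) * cell (euler_kernel q) z (INR (S k) + INR N))%C by reflexivity.
    ring.
Qed.

(** With exponent 3, one factor of (S k + n)^3 is at least S k. This extra 1 / S k, joined to the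
    weight 1 / S k, makes the tails summable over k, with a sum that vanishes as N grows. *)
Lemma strip_tail (k N : nat) :
  Cmod (strip (-1) (euler_kernel q) z (INR (S k)) - Csum (strip_terms (-1) (euler_kernel q) z (INR (S k))) N)
    <= 2 * M / (1 + INR N) / INR (S k).
Proof.
assert (HM := kernel_pos _ _ kernel_M); assert (Hk := INR_S_ge_1 k).
destruct (Csum_conv (strip_terms (-1) (euler_kernel q) z (INR (S k))) (M / INR (S k)) (INR (S k)))
  as [l [H1 H2]]; [apply Rdiv_le_0_compat; lra|exact Hk| |].
- intros n; assert (Hn := pos_INR n).
  eapply Rle_trans; [apply strip_terms_bound with (M := M) (k := 3%nat);
    [apply Rabs_m1_le|exact kernel_M|exact Hk|replace (INR 3) with 3 by (simpl; ring); exact Re_z]|].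
  replace (M / INR (S k) / (INR (S k) + INR n) ^ 2)
    with (M * / (INR (S k) * (INR (S k) + INR n) ^ 2)) by (field; lra).
  apply Rmult_le_compat_l; [exact HM|]; apply Rinv_le_contravar.
  + apply Rmult_lt_0_compat; [lra|apply pow_lt; lra].
  + replace ((INR (S k) + INR n) ^ 3) with ((INR (S k) + INR n) * (INR (S k) + INR n) ^ 2) by ring.
    apply Rmult_le_compat_r; [apply pow2_ge_0|lra].
- unfold strip; rewrite (Clim_val_unique _ _ H1); eapply Rle_trans; [apply H2|].
  assert (HN := pos_INR N).
  replace (2 * M / (1 + INR N) / INR (S k)) with (2 * (M / INR (S k)) * / (1 + INR N))
    by (field; lra).
  apply Rmult_le_compat_l.
  + apply Rmult_le_pos; [lra|apply Rdiv_le_0_compat; lra].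
  + apply Rinv_le_contravar; lra.
Qed.

Lemma remainder_upto_error (N : nat) : exists I,
  is_CRInt (remainder_integrand q s) 0 (INR N) I /\
  Cmod (I - c * weighted_strip (-1) (euler_kernel q) z) <= Cmod c * (4 * M / (1 + INR N)).
Proof.
destruct (remainder_upto N) as [V [H1 H2]]; exists (c * V)%C; split; [exact H1|].
replace (c * V - c * weighted_strip (-1) (euler_kernel q) z)%C
  with (- (c * (weighted_strip (-1) (euler_kernel q) z - V)))%C by ring.
rewrite Cmod_opp, Cmod_mult; apply Rmult_le_compat_l; [apply Cmod_ge_0|].
assert (HM := kernel_pos _ _ kernel_M); assert (HN := pos_INR N).
assert (L := weighted_strip_correct (-1) (euler_kernel q) M z Rabs_m1_le kernel_M ltac:(lra)).
assert (L2 := Clim_minus _ _ _ _ L H2).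
(* The deviation is itself a series over k with terms at most 2 M / (1 + N) / (1 + k)^2, so
   [Csum_conv] bounds its sum. *)
destruct (Csum_conv (fun k => RtoC (/ INR (S k)) * (strip (-1) (euler_kernel q) z (INR (S k))
    - Csum (strip_terms (-1) (euler_kernel q) z (INR (S k))) N))%C (2 * M / (1 + INR N)) 1)
  as [l [L3 B]]; [apply Rdiv_le_0_compat; lra|lra| |].
- intros k; assert (Hk := INR_S_ge_1 k).
  rewrite Cmod_mult, Cmod_R, Rabs_right by (apply Rle_ge, Rlt_le, Rinv_0_lt_compat; lra).
  replace (1 + INR k) with (INR (S k)) by (rewrite S_INR; ring).
  replace (2 * M / (1 + INR N) / INR (S k) ^ 2)
    with (/ INR (S k) * (2 * M / (1 + INR N) / INR (S k))) by (field; lra).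
  apply Rmult_le_compat_l; [apply Rlt_le, Rinv_0_lt_compat; lra|apply strip_tail].
- replace (weighted_strip (-1) (euler_kernel q) z - V)%C with l.
  + specialize (B O); simpl in B; replace (l - 0)%C with l in B by ring.
    eapply Rle_trans; [exact B|]; right; field; lra.
  + apply (Clim_unique _ _ _ L3); eapply Clim_ext; [|exact L2].
    intros n; cbv beta; rewrite <- Csum_minus; apply Csum_ext; intros k _.
    unfold weighted_strip_terms; ring.
Qed.

Lemma remainder_integrand_bound (N : nat) (t : R) : INR N < t < INR N + 1 ->
  Cmod (remainder_integrand q s t) <= Cmod c * (2 * M / (1 + INR N)).
Proof.
intros Ht; assert (HN := pos_INR N); assert (HM := kernel_pos _ _ kernel_M).
unfold remainder_integrand; fold z; rewrite (euler_bar_opp q N t q_pos Ht).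
rewrite Cmod_mult, Cmod_R, Rabs_mult, pow_1_abs, Rmult_1_l, Rabs_mult, Rmult_assoc; unfold c; rewrite Cmod_R.
apply Rmult_le_compat_l; [apply Rabs_pos|].
replace (2 * M / (1 + INR N)) with (M * (2 / (1 + INR N))) by (field; lra).
apply Rmult_le_compat; [apply Rabs_pos|apply Cmod_ge_0|apply (kernel_bound _ _ kernel_M); lra|].
eapply Rle_trans; [apply phi_plus_bound; lra|].
apply Rmult_le_compat_l; [lra|apply Rinv_le_contravar; lra].
Qed.

Lemma remainder_upto_real (T : R) : 0 < T -> exists I,
  is_CRInt (remainder_integrand q s) 0 T I /\
  Cmod (I - c * weighted_strip (-1) (euler_kernel q) z) <= Cmod c * (6 * M / T).
Proof.
intros HT; destruct (nfloor_ex T ltac:(lra)) as [N [HN1 HN2]].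
assert (HN := pos_INR N); assert (HM := kernel_pos _ _ kernel_M).
destruct (remainder_upto_error N) as [I [H1 H2]].
destruct (remainder_cell N) as [W [HW _]].
assert (Ex : ex_CRInt (remainder_integrand q s) (INR N) T).
{ apply (ex_RInt_Chasles_1 (V := C_R_CompleteNormedModule)) with (INR (S N)); [rewrite S_INR; lra|].
  eexists; exact HW. }
destruct Ex as [J HJ].
assert (BJ : Cmod J <= (T - INR N) * (Cmod c * (2 * M / (1 + INR N)))).
(* The pointwise bound holds inside the open cell; replacing the values at its endpoints by 0
   extends it to the closed interval without changing the integral. *)
{ set (f := fun t => if Rlt_dec (INR N) t then
    (if Rlt_dec t (INR N + 1) then remainder_integrand q s t else RtoC 0) else RtoC 0).
  assert (P : 0 <= Cmod c * (2 * M / (1 + INR N))).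
  { apply Rmult_le_pos; [apply Cmod_ge_0|apply Rdiv_le_0_compat; lra]. }
  apply is_CRInt_bound with (f := f); [lra| |].
  - intros t Ht; unfold f; destruct (Rlt_dec (INR N) t); [destruct (Rlt_dec t (INR N + 1))|];
      rewrite ?Cmod_0; try exact P.
    apply remainder_integrand_bound; lra.
  - eapply is_CRInt_ext; [|exact HJ]; intros t Ht; rewrite Rmin_left, Rmax_right in Ht by lra.
    unfold f; destruct (Rlt_dec (INR N) t); [destruct (Rlt_dec t (INR N + 1))|]; lra || reflexivity. }
exists (I + J)%C; split; [apply is_CRInt_Chasles with (INR N); assumption|].
replace (I + J - c * weighted_strip (-1) (euler_kernel q) z)%C
  with ((I - c * weighted_strip (-1) (euler_kernel q) z) + J)%C by ring.
eapply Rle_trans; [apply Cmod_triangle|].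
assert (Hc := Cmod_ge_0 c).
assert (P : 0 <= Cmod c * (2 * M / (1 + INR N))).
{ apply Rmult_le_pos; [lra|apply Rdiv_le_0_compat; lra]. }
apply Rle_trans with (Cmod c * (6 * M / (1 + INR N))).
- replace (Cmod c * (6 * M / (1 + INR N)))
    with (Cmod c * (4 * M / (1 + INR N)) + Cmod c * (2 * M / (1 + INR N))) by (field; lra).
  apply Rplus_le_compat; [exact H2|]; eapply Rle_trans; [exact BJ|]; nra.
- apply Rmult_le_compat_l; [lra|]; apply Rmult_le_compat_l; [lra|].
  apply Rinv_le_contravar; lra.
Qed.

Lemma remainder_is_RInt_gen :
  is_RInt_gen (V := C_R_NormedModule) (remainder_integrand q s) (at_point 0)
    (Rbar_locally p_infty) (c * weighted_strip (-1) (euler_kernel q) z)%C.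
Proof.
intros P HP; apply locally_C_Cmod in HP; destruct HP as [d [Hd HP]].
assert (HM := kernel_pos _ _ kernel_M); assert (Hc := Cmod_ge_0 c).
apply Filter_prod with (Q := fun x => x = 0) (R := fun T => Cmod c * (6 * M) / d < T /\ 0 < T).
- reflexivity.
- exists (Rmax (Cmod c * (6 * M) / d) 0); intros T HT; split;
    eapply Rle_lt_trans; [apply Rmax_l|exact HT|apply Rmax_r|exact HT].
- intros x T -> [HT1 HT2]; simpl.
  destruct (remainder_upto_real T HT2) as [I [H1 H2]]; exists I; split; [exact H1|].
  apply HP; eapply Rle_lt_trans; [exact H2|].
  apply Rmult_lt_reg_r with (T / d); [apply Rdiv_lt_0_compat; lra|].
  replace (Cmod c * (6 * M / T) * (T / d)) with (Cmod c * (6 * M) / d) by (field; lra).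
  replace (d * (T / d)) with T by (field; lra); exact HT1.
Qed.

End Remainder.

Lemma remainder_facts (q : nat) (s : C) : (0 < q)%nat -> 3 <= Re s + INR (2 * q) ->
  remainder_converges q s /\
  remainder_integral q s = (RtoC (INR (fact (2 * q - 1))) *
    euler_weighted_strip q s)%C.
Proof.
intros Hq Hs; destruct (kernel_euler (2 * q - 1)) as [M He].
rewrite <- Re_add_R in Hs.
assert (G := remainder_is_RInt_gen q s M Hq Hs He); split; [split|].
- intros t Ht; apply phi_plus_correct; lra.
- eexists; exact G.
- unfold remainder_integral.
  apply (is_RInt_gen_unique (V := C_R_CompleteNormedModule) (remainder_integrand q s)); exact G.
Qed.

Lemma continuation_rhs_eq (q : nat) (s : C) : (0 < q)%nat -> 3 <= Re s + INR (2 * q) ->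
  continuation_rhs q s = zeta_boole q s.
Proof.
intros Hq Hs; destruct (remainder_facts q s Hq Hs) as [_ E].
unfold continuation_rhs, zeta_boole; rewrite E, Csum_sum_n.
replace (S (q - 1)) with q by lia.
assert (F : forall n, RtoC (INR (fact n)) <> RtoC 0).
{ intros n H; apply RtoC_inj in H; exact (INR_fact_neq_0 n H). }
rewrite (Csum_ext (fun m => rising s (2 * m + 1) / RtoC (INR (fact (2 * m + 1)))
    * RtoC (euler_poly (2 * m + 1) 0) * zeta (s + RtoC (INR (2 * m + 2))))%C
  (fun m => RtoC (euler_coef (2 * m + 1)) *
     (rising s (2 * m + 1) * zeta (s + RtoC (INR (2 * m + 2)))))%C).
- field; apply F.
- intros m _; rewrite <- euler_poly_coef_0, <- euler_poly_eq, RtoC_div by apply INR_fact_neq_0.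
  field; apply F.
Qed.

(** * Summation by parts for the series v *)

Lemma Hminus_0 : Hminus 0 = 0.
Proof. unfold Hminus; rewrite sum_n_m_zero by lia; reflexivity. Qed.

Lemma Hminus_S (n : nat) : Hminus (S n) = Hminus n + (-1) ^ n / INR (S n).
Proof.
unfold Hminus; rewrite sum_n_Sm by lia; replace (S n - 1)%nat with n by lia; reflexivity.
Qed.

(** The sums of even length increase from 0 and those of odd length decrease from 1, with the odd
    ones above. *)
Lemma Hminus_bound (n : nat) : Rabs (Hminus n) <= 1.
Proof.
assert (K : forall k, 0 <= Hminus (2 * k) /\ Hminus (2 * k + 1) <= 1 /\
  Hminus (2 * k + 1) = Hminus (2 * k) + / INR (2 * k + 1)).
{ assert (E : forall k, Hminus (2 * k + 1) = Hminus (2 * k) + / INR (2 * k + 1)).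
  { intros k; replace (2 * k + 1)%nat with (S (2 * k)) by lia.
    rewrite Hminus_S, pow_1_even; unfold Rdiv; ring. }
  assert (E' : forall k, Hminus (2 * S k) = Hminus (2 * k + 1) - / INR (2 * k + 2)).
  { intros k; replace (2 * S k)%nat with (S (S (2 * k))) by lia.
    rewrite Hminus_S, pow_1_odd; replace (S (2 * k)) with (2 * k + 1)%nat by lia.
    replace (S (2 * k + 1)) with (2 * k + 2)%nat by lia; unfold Rdiv; ring. }
  assert (D : forall a b, (0 < a < b)%nat -> / INR b < / INR a).
  { intros a b Hab; apply Rinv_lt_contravar; [|apply lt_INR; lia].
    apply Rmult_lt_0_compat; apply lt_0_INR; lia. }
  induction k as [|k [IH1 [IH2 IH3]]].
  - split; [|split; [|apply E]]; [rewrite Nat.mul_0_r, Hminus_0; lra|].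
    rewrite E, Nat.mul_0_r, Hminus_0; simpl; lra.
  - assert (D1 := D (2 * k + 1)%nat (2 * k + 2)%nat ltac:(lia)).
    assert (D2 := D (2 * k + 2)%nat (2 * S k + 1)%nat ltac:(lia)).
    split; [rewrite E'; lra|split; [rewrite E, E'; lra|apply E]]. }
assert (P : forall k, 0 < / INR (2 * k + 1)) by (intros; apply Rinv_0_lt_compat, lt_0_INR; lia).
apply Rabs_le; destruct (Nat.Even_or_Odd n) as [[k ->]|[k ->]]; generalize (K k) (P k); lra.
Qed.

(** Abel summation after writing n^(-s) as B(s,n) + B(s,n+1): the coefficient of B(s,n) becomes
    (-1)^(n-1) (H_n^- - H_(n-1)^-) = 1/n. *)
Lemma v_partial (q : nat) (s : C) (N : nat) : (0 < q)%nat -> 2 <= Re s + INR (2 * q) ->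
  Csum (fun k => v_term s (S k)) N =
  (Csum (fun k => RtoC (/ INR (S k)) * boole q s (INR (S k))) N
   - RtoC ((-1) ^ N * Hminus N) * boole q s (INR (S N)))%C.
Proof.
intros Hq Hs; induction N; [rewrite Hminus_0, Rmult_0_r; simpl Csum; ring|].
rewrite !Csum_S, IHN.
assert (B := boole_shift q s (INR (S N)) Hq (INR_S_ge_1 N) Hs); rewrite <- S_INR in B.
unfold v_term; replace (S N - 1)%nat with N by lia.
unfold Cdiv; rewrite inv_Rcpow, <- B, Hminus_S.
assert (E : (-1) ^ N * (-1) ^ N = 1).
{ rewrite <- Rpow_mult_distr; replace (-1 * -1) with 1 by ring; apply pow1. }
replace (RtoC (/ INR (S N))) with (RtoC ((-1) ^ N) * RtoC ((-1) ^ N / INR (S N)))%C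
  by (rewrite <- RtoC_mult; f_equal; unfold Rdiv; rewrite <- Rmult_assoc, E; ring).
replace ((-1) ^ S N) with (- (-1) ^ N) by (simpl; ring).
set (b1 := boole q s (INR (S N))); set (b2 := boole q s (INR (S (S N)))).
rewrite !RtoC_mult, !RtoC_plus, RtoC_opp; ring.
Qed.

Lemma Clim_bounded_mult (a : nat -> R) (u : nat -> C) (B : R) :
  (forall n, Rabs (a n) <= B) -> Clim u (RtoC 0) -> Clim (fun n => RtoC (a n) * u n)%C (RtoC 0).
Proof.
intros Ha Hu eps He.
assert (HB : 0 <= B) by (generalize (Ha O) (Rabs_pos (a O)); lra).
destruct (Hu (eps / (B + 1))) as [N HN]; [apply Rdiv_lt_0_compat; lra|].
exists N; intros n Hn; specialize (HN n Hn).
replace (RtoC (a n) * u n - 0)%C with (RtoC (a n) * (u n - 0))%C by ring.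
rewrite Cmod_mult, Cmod_R.
apply Rle_lt_trans with ((B + 1) * Cmod (u n - 0)).
- apply Rmult_le_compat_r; [apply Cmod_ge_0|generalize (Ha n); lra].
- apply Rmult_lt_compat_l with (r := B + 1) in HN; [|lra].
  replace ((B + 1) * (eps / (B + 1))) with eps in HN by (field; lra); exact HN.
Qed.

Lemma v_series (q : nat) (s : C) : (0 < q)%nat -> 0 < Re s -> 2 <= Re s + INR (2 * q) ->
  Clim (Csum (fun k => v_term s (S k))) (zeta_boole q s / 2)%C.
Proof.
intros Hq H0 H2.
eapply Clim_ext; [intros N; symmetry; apply (v_partial q s N Hq H2)|].
replace (zeta_boole q s / 2)%C with (/ 2 * zeta_boole q s - 0)%C by field.
apply Clim_minus.
- eapply Clim_ext; [|exact ((Ctends_scal eventually) (/ 2)%C _ _ (boole_series q s H0 H2))].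
  intros N; cbv beta; rewrite Csum_scal; field.
- apply (Clim_bounded_mult (fun N => (-1) ^ N * Hminus N) (fun N => boole q s (INR (S N))) 1).
  + intros n; rewrite Rabs_mult, pow_1_abs, Rmult_1_l; apply Hminus_bound.
  + apply boole_lim_0; assumption.
Qed.

(** The range of q in the theorem; it is stable under q -> q + 1 and open in s, as [glue]
    requires. *)
Definition admissible (q : nat) (s : C) : Prop := 1 + Rabs (Re s) < INR q.

Lemma admissible_bounds (q : nat) (s : C) : admissible q s ->
  (0 < q)%nat /\ 3 < Re s + INR (2 * q).
Proof.
unfold admissible; intros H; assert (P := Rabs_pos (Re s)).
(* q > 1 forces q >= 2, and then 2q - |Re s| > q + 1 >= 3. *)
assert (Hq : (2 <= q)%nat) by (apply INR_lt; simpl; lra).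
split; [lia|]; apply le_INR in Hq; rewrite mult_INR; simpl (INR 2) in *.
generalize (Rle_abs (- Re s)); rewrite Rabs_Ropp; lra.
Qed.

Lemma admissible_S (q : nat) (s : C) : admissible q s -> admissible (S q) s.
Proof. unfold admissible; rewrite S_INR; lra. Qed.

Lemma admissible_exists (s : C) : exists q, admissible q s.
Proof. destruct (INR_unbounded (1 + Rabs (Re s))) as [q Hq]; exists q; exact Hq. Qed.

Lemma admissible_open (q : nat) (s : C) : admissible q s ->
  exists d, 0 < d /\ forall w, Cmod (w - s) < d -> admissible q w.
Proof.
unfold admissible; intros H; exists (INR q - (1 + Rabs (Re s))); split; [lra|]; intros w Hw.
generalize (re_le_Cmod (w - s)); unfold Cminus at 1; rewrite re_plus, re_opp; intros K.
generalize (Rabs_triang (Re s) (Re w + - Re s)).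
replace (Re s + (Re w + - Re s)) with (Re w) by ring; lra.
Qed.

Lemma V_exists : exists V : C -> C,
  (forall q s, admissible q s -> V s = (zeta_boole q s / 2)%C) /\
  (forall q s, admissible q s -> Cdiff (fun s => zeta_boole q s / 2)%C s -> Cdiff V s).
Proof.
apply (glue (fun q s => zeta_boole q s / 2)%C admissible).
- intros q s H; split; [apply admissible_S, H|]; destruct (admissible_bounds q s H).
  rewrite zeta_boole_succ by (auto; lra); reflexivity.
- apply admissible_exists.
- apply admissible_open.
Qed.

(** * The alternating zeta function and values of zeta *)

Lemma eta_exists : exists eta : C -> C, (forall s, Cdiff eta s) /\
  forall q s, admissible q s -> eta s = boole q s 1.
Proof.
destruct (glue (fun q s => boole q s 1) admissible) as [eta [H1 H2]].
- intros q s H; split; [apply admissible_S, H|]; destruct (admissible_bounds q s H).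
  apply (boole_succ q s 0); [assumption|lra].
- apply admissible_exists.
- apply admissible_open.
- exists eta; split; [|exact H1]; intros s; destruct (admissible_exists s) as [q Hq].
  destruct (admissible_bounds q s Hq); apply (H2 q s Hq), Cdiff_boole; lra.
Qed.

Lemma boole_alternating_series (q : nat) (s : C) : (0 < q)%nat -> 0 < Re s ->
  2 <= Re s + INR (2 * q) ->
  Clim (Csum (fun k => RtoC ((-1) ^ k) * pw (INR (S k)) s)%C) (boole q s 1).
Proof.
intros Hq H0 H2.
apply (Clim_ext (fun N => boole q s 1 - RtoC ((-1) ^ N) * boole q s (INR (S N)))%C).
- induction n; [simpl; ring|]; rewrite Csum_S, <- IHn.
  rewrite <- (boole_shift q s (INR (S n)) Hq (INR_S_ge_1 n) H2), <- (S_INR (S n)).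
  replace ((-1) ^ S n) with (- (-1) ^ n) by (simpl; ring); rewrite RtoC_opp; ring.
- assert (L := Clim_bounded_mult (fun N => (-1) ^ N) (fun N => boole q s (INR (S N))) 1
    ltac:(intros n; rewrite pow_1_abs; lra) (boole_lim_0 q s H0 H2)).
  assert (L2 := Clim_minus _ _ _ _ ((Ctends_const eventually) (boole q s 1)) L).
  replace (boole q s 1 - 0)%C with (boole q s 1) in L2 by ring; exact L2.
Qed.

Lemma Clim_double (u : nat -> C) (l : C) : Clim u l -> Clim (fun n => u (2 * n)%nat) l.
Proof. intros H eps He; destruct (H eps He) as [N HN]; exists N; intros; apply HN; lia. Qed.

(** The alternating sum is the full sum minus twice its terms of even base, and (2k)^(-s) = 2^(-s)
    k^(-s). *)
Lemma alternating_double (s : C) (N : nat) :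
  Csum (fun k => RtoC ((-1) ^ k) * pw (INR (S k)) s)%C (2 * N) =
  (Csum (fun k => pw (INR (S k)) s) (2 * N) - 2 * pw 2 s * Csum (fun k => pw (INR (S k)) s) N)%C.
Proof.
induction N; [simpl; ring|].
replace (2 * S N)%nat with (S (S (2 * N))) by lia; rewrite !Csum_S, IHN, pow_1_odd, pow_1_even.
replace (INR (S (S (2 * N)))) with (2 * INR (S N)).
- rewrite pw_mult by (generalize (INR_S_ge_1 N); lra); ring.
- replace (S (S (2 * N))) with (2 * S N)%nat by lia; rewrite mult_INR; reflexivity.
Qed.

(** For Re s > 1 the two sides are limits of the same partial sums of even length; the identity
    theorem extends the equality. *)
Lemma zeta_eta (eta : C -> C) : (forall s, Cdiff eta s) ->
  (forall q s, admissible q s -> eta s = boole q s 1) ->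
  forall s, s <> RtoC 1 -> ((1 - pw 2 (s - 1)) * zeta s)%C = eta s.
Proof.
intros D E s Hs; apply (proj2 (Ceq_minus _ _)).
apply (identity_theorem_punctured (fun s => (1 - pw 2 (s - 1)) * zeta s - eta s)%C); [| |exact Hs].
- intros w Hw; apply Cdiff_minus; [|apply D]; apply Cdiff_mult; [|apply Cdiff_zeta, Hw].
  apply Cdiff_minus; [apply Cdiff_const|apply (Cdiff_shift (pw 2)), Cdiff_pw].
- intros w Hw; apply (proj1 (Ceq_minus _ _)).
  destruct (admissible_exists w) as [q Hq]; destruct (admissible_bounds q w Hq) as [Hq0 Hq1].
  rewrite (E q w Hq).
  apply (Clim_unique (fun N => Csum (fun k => RtoC ((-1) ^ k) * pw (INR (S k)) w)%C (2 * N))).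
  + eapply Clim_ext; [intros N; symmetry; apply alternating_double|].
    replace (pw 2 (w - 1)) with (2 * pw 2 w)%C.
    * replace ((1 - 2 * pw 2 w) * zeta w)%C with (zeta w - 2 * pw 2 w * zeta w)%C by ring.
      apply Clim_minus; [apply (Clim_double (Csum (fun k => pw (INR (S k)) w)))|apply (Ctends_scal eventually)];
        apply zeta_series, Hw.
    * unfold Cminus; rewrite pw_plus, <- RtoC_opp, pw_m1 by lra; ring.
  + apply (Clim_double (Csum (fun k => RtoC ((-1) ^ k) * pw (INR (S k)) w)%C)).
    apply boole_alternating_series; [exact Hq0|lra|lra].
Qed.

Lemma rising_neg (n j : nat) : (j <= n)%nat ->
  rising (RtoC (- INR n)) j = RtoC ((-1) ^ j * INR (fact n) / INR (fact (n - j))).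
Proof.
induction j; intros Hj.
- simpl rising; rewrite Nat.sub_0_r; f_equal; simpl; field; apply INR_fact_neq_0.
- simpl rising; rewrite IHj by lia; rewrite <- RtoC_plus, <- RtoC_mult; f_equal.
  replace (n - j)%nat with (S (n - S j)) by lia; rewrite fact_simpl, mult_INR.
  replace (- INR n + INR j) with (- INR (S (n - S j))).
  + simpl pow; field; split; [apply INR_fact_neq_0|apply not_0_INR; lia].
  + replace n with (S (n - S j) + j)%nat at 2 by lia; rewrite plus_INR; ring.
Qed.

Lemma rising_neg_0 (n j : nat) : (n < j)%nat -> rising (RtoC (- INR n)) j = RtoC 0.
Proof.
induction j; intros Hj; [lia|]; simpl rising.
destruct (Nat.eq_dec n j) as [->|Hn].
- rewrite <- RtoC_plus, Rplus_opp_l; ring.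
- rewrite IHj by lia; ring.
Qed.

Lemma Csum_zero_tail (u : nat -> C) (n N : nat) : (n <= N)%nat ->
  (forall j, (n <= j)%nat -> u j = RtoC 0) -> Csum u N = Csum u n.
Proof.
intros H Hu; induction H; [reflexivity|]; rewrite Csum_S, IHle, Hu by exact H; ring.
Qed.

Lemma RtoC_sum (f : nat -> R) (n : nat) :
  RtoC (sum_f_R0 f n) = Csum (fun k => RtoC (f k)) (S n).
Proof.
induction n; [simpl; ring|]; rewrite tech5, RtoC_plus, IHn; reflexivity.
Qed.

(** At s = -2k the expansion is finite and the remainder is multiplied by 0; what is left is half of
    E_(2k)(1), and E_(2k)(1) = -E_(2k)(0) = 0. *)
Lemma boole_neg_even (k q : nat) : (0 < k)%nat -> (k < q)%nat ->
  boole q (RtoC (- INR (2 * k))) 1 = RtoC 0.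
Proof.
intros Hk Hq; unfold boole; rewrite rising_neg_0 by lia; rewrite pw_base_1.
rewrite (Csum_zero_tail _ k) by (try lia; intros j Hj; unfold pw_deriv;
  rewrite rising_neg_0 by lia; ring).
set (h := fun j : nat => RtoC (INR (fact (2 * k)) / INR (fact (2 * k - j)))).
rewrite (Csum_ext _ (fun m => (-(1)) * (RtoC (euler_coef (2 * m + 1)) * h (2 * m + 1)%nat))%C).
- rewrite Csum_scal.
  assert (E : (h O + Csum (fun m => RtoC (euler_coef (2 * m + 1)) * h (2 * m + 1)%nat) k)%C = RtoC 0).
  { destruct k as [|k']; [lia|]; rewrite <- euler_odd_sum.
    assert (P := euler_poly_coef_1 (2 * S k' - 1)).
    replace (S (2 * S k' - 1)) with (2 * S k')%nat in P by lia.
    rewrite euler_coef_even, Ropp_0 in P by lia; unfold euler_poly_coef, PS_mult in P.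
    apply (f_equal RtoC) in P; rewrite RtoC_sum, Csum_S, euler_coef_even in P by lia.
    rewrite (Csum_ext _ (fun j => RtoC (INR (fact (2 * S k'))) *
      RtoC (euler_coef j * (1 ^ (2 * S k' - j) / INR (fact (2 * S k' - j)))))%C).
    - rewrite Csum_scal.
      rewrite Rmult_0_l, Cplus_0_r in P; rewrite P; ring.
    - intros j _; unfold h; rewrite <- !RtoC_mult; f_equal; rewrite pow1; unfold Rdiv; ring. }
  replace (h O) with (RtoC 1) in E
    by (unfold h; rewrite Nat.sub_0_r; f_equal; field; apply INR_fact_neq_0).
  set (S0 := Csum _ k) in *.
  replace ((1 - - (1) * S0 + 0 * strip (-1) (euler_kernel q) (RtoC (- INR (2 * k)) + RtoC (INR (2 * q))) 1) / 2)%C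
    with ((1 + S0) / 2)%C by field.
  rewrite E; field.
- intros m Hm; unfold pw_deriv, h; rewrite pw_base_1, rising_neg by lia.
  replace ((-1) ^ (2 * m + 1)) with (-1)
    by (replace (2 * m + 1)%nat with (S (2 * m)) by lia; rewrite pow_1_odd; reflexivity).
  replace (-1 * INR (fact (2 * k)) / INR (fact (2 * k - (2 * m + 1))))
    with (- (INR (fact (2 * k)) / INR (fact (2 * k - (2 * m + 1))))) by (unfold Rdiv; ring).
  rewrite RtoC_opp; ring.
Qed.

Lemma zeta_neg_even (k : nat) : (0 < k)%nat -> zeta (RtoC (- INR (2 * k))) = RtoC 0.
Proof.
intros Hk; destruct eta_exists as [eta [D E]]; set (s := RtoC (- INR (2 * k))).
assert (HI : 2 <= INR (2 * k)) by (rewrite mult_INR; generalize (le_INR 1 k Hk); simpl; lra).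
destruct (admissible_exists s) as [q Hq].
assert (Hqk : (k < q)%nat).
{ apply INR_lt; unfold admissible in Hq; unfold s in Hq; rewrite re_RtoC, Rabs_Ropp, Rabs_right in Hq by lra.
  rewrite mult_INR in *; simpl (INR 2) in *; lra. }
assert (Z := zeta_eta eta D E s); rewrite (E q s Hq) in Z; unfold s in Z at 4.
rewrite boole_neg_even in Z by assumption.
assert (N1 : s <> RtoC 1) by (unfold s; intros H; apply RtoC_inj in H; lra).
specialize (Z N1).
destruct (Ceq_dec (zeta s) (RtoC 0)) as [|Hn]; [assumption|exfalso].
apply (Cmult_neq_0 (1 - pw 2 (s - 1)) (zeta s)); [|exact Hn|exact Z].
(* At s = -2k the power 2^(1-s) has modulus 2^(2k+1), so the factor of zeta does not vanish. *)
intros H; apply (proj2 (Ceq_minus _ _)) in H; apply (f_equal Cmod) in H.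
rewrite Cmod_1, Cmod_pw, Re_sub_R in H; unfold s in H; rewrite re_RtoC in H.
apply (f_equal ln) in H; rewrite ln_1, ln_exp in H.
assert (0 < ln 2) by (rewrite <- ln_1; apply ln_increasing; lra).
assert (0 < (INR (2 * k) + 1) * ln 2) by (apply Rmult_lt_0_compat; lra); lra.
Qed.

(** Every rising factorial of positive length vanishes at 0, so B(0,1) = 1/2; the factor 1 - 2^(1-s)
    is -1 there. *)
Lemma zeta_0 : zeta (RtoC 0) = RtoC (- / 2).
Proof.
destruct eta_exists as [eta [D E]].
assert (Z := zeta_eta eta D E (RtoC 0)).
assert (A : admissible 2 (RtoC 0)) by (unfold admissible; rewrite re_RtoC, Rabs_R0; simpl; lra).
rewrite (E 2%nat _ A) in Z.
replace (0 - 1)%C with (RtoC (-1)) in Z by (rewrite <- RtoC_minus; f_equal; ring).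
rewrite pw_m1 in Z by lra.
assert (B : boole 2 (RtoC 0) 1 = RtoC (/ 2)).
{ unfold boole; rewrite pw_base_1; unfold pw_deriv.
  replace (RtoC 0) with (RtoC (- INR 0)) by (simpl; f_equal; ring).
  rewrite (Csum_zero_tail _ 0) by (try lia; intros; rewrite rising_neg_0 by lia; ring).
  rewrite rising_neg_0 by lia; rewrite RtoC_inv by lra; simpl Csum; field. }
rewrite B in Z.
replace (zeta (RtoC 0)) with (- ((1 - 2) * zeta (RtoC 0)))%C by ring.
rewrite Z, RtoC_opp; [reflexivity|intros H; apply RtoC_inj in H; lra].
Qed.

(** * Poles and residues *)

(* [f - r / (w - a)] extends holomorphically to [a]; a pole only if [r <> 0] *)
Definition polar_part (f : C -> C) (a r : C) : Prop :=
  exists h : C -> C, near a (Cdiff h) /\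
    near a (fun w => w <> a -> f w = (r / (w - a) + h w)%C).

Lemma polar_part_regular (f : C -> C) (a : C) : near a (Cdiff f) -> polar_part f a (RtoC 0).
Proof.
intros H; exists f; split; [exact H|]; apply filter_forall; intros w Hw.
unfold Cdiv; ring.
Qed.

Lemma polar_part_plus (f g : C -> C) (a r p : C) :
  polar_part f a r -> polar_part g a p -> polar_part (fun w => f w + g w)%C a (r + p)%C.
Proof.
intros [h [H1 H2]] [k [K1 K2]]; exists (fun w => h w + k w)%C; split.
- eapply filter_imp; [|exact (filter_and _ _ H1 K1)]; intros w [A B]; apply Cdiff_plus; assumption.
- eapply filter_imp; [|exact (filter_and _ _ H2 K2)]; intros w [A B] Hw; rewrite A, B by exact Hw.
  unfold Cdiv; ring.
Qed.

(** The quotient [Q] of g - g(a) by w - a is supplied as an entire function, so multiplying by g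
    turns r / (w - a) into g(a) r / (w - a) plus the regular term r Q. *)
Lemma polar_part_factor (g Q f : C -> C) (a r : C) :
  (forall w, Cdiff g w) -> (forall w, Cdiff Q w) ->
  (forall w, g w = (g a + (w - a) * Q w)%C) ->
  polar_part f a r -> polar_part (fun w => g w * f w)%C a (g a * r)%C.
Proof.
intros Dg DQ E [h [H1 H2]]; exists (fun w => r * Q w + g w * h w)%C; split.
- eapply filter_imp; [|exact H1]; intros w Hw; apply Cdiff_plus; [apply Cdiff_scal, DQ|].
  apply Cdiff_mult; [apply Dg|exact Hw].
- eapply filter_imp; [|exact H2]; intros w A Hw; rewrite A by exact Hw.
  rewrite (E w) at 1; assert (Hn := Cminus_eq_contra _ _ Hw).
  replace (g w * h w)%C with ((g a + (w - a) * Q w) * h w)%C by (rewrite <- E; reflexivity).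
  field; exact Hn.
Qed.

Lemma polar_part_scal (c : C) (f : C -> C) (a r : C) :
  polar_part f a r -> polar_part (fun w => c * f w)%C a (c * r)%C.
Proof.
apply (polar_part_factor (fun _ => c) (fun _ => RtoC 0)); intros; try apply Cdiff_const; ring.
Qed.

Lemma polar_part_ext (f g : C -> C) (a r p : C) :
  near a (fun w => f w = g w) -> r = p -> polar_part f a r -> polar_part g a p.
Proof.
intros E <- [h [H1 H2]]; exists h; split; [exact H1|].
eapply filter_imp; [|exact (filter_and _ _ E H2)]; intros w [A B] Hw; rewrite <- A; auto.
Qed.

Lemma polar_part_Csum (f : nat -> C -> C) (r : nat -> C) (a : C) (q : nat) :
  (forall m, (m < q)%nat -> polar_part (f m) a (r m)) ->
  polar_part (fun w => Csum (fun m => f m w) q) a (Csum r q).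
Proof.
induction q; intros H; simpl.
- apply polar_part_regular, filter_forall; intros; apply Cdiff_const.
- apply polar_part_plus; [apply IHq; intros|]; apply H; lia.
Qed.

(** Polynomial division by w - a, with the quotient built along the recursion of [rising]. *)
Lemma rising_factor (j : nat) (a : C) : exists Q : C -> C, (forall w, Cdiff Q w) /\
  forall w, rising w j = (rising a j + (w - a) * Q w)%C.
Proof.
induction j as [|j [Q [DQ E]]].
- exists (fun _ => RtoC 0); split; [intros; apply Cdiff_const|intros; simpl; ring].
- exists (fun w => Q w * (w + RtoC (INR j)) + rising a j)%C; split.
  + intros w; apply Cdiff_plus; [|apply Cdiff_const]; apply Cdiff_mult; [apply DQ|].
    apply Cdiff_plus; [apply Cdiff_id|apply Cdiff_const].
  + intros w; simpl; rewrite E; ring.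
Qed.

Lemma polar_part_rising (j : nat) (f : C -> C) (a r : C) :
  polar_part f a r -> polar_part (fun w => rising w j * f w)%C a (rising a j * r)%C.
Proof.
destruct (rising_factor j a) as [Q [DQ E]].
apply (polar_part_factor (fun w => rising w j) Q); [apply Cdiff_rising|exact DQ|exact E].
Qed.

Lemma polar_part_zeta_shift (a b : C) : (a + b)%C = RtoC 1 ->
  polar_part (fun w => zeta (w + b)) a (RtoC 1).
Proof.
intros Hab; destruct zeta_laurent as [Z0 [D E]].
exists (fun w => Z0 (w + b)%C); split.
- apply filter_forall; intros w; apply (Cdiff_shift Z0), D.
- apply filter_forall; intros w Hw.
  assert (Hb : b = (1 - a)%C) by (rewrite <- Hab; ring).
  rewrite E.
  + rewrite Hb; replace (w + (1 - a) - 1)%C with (w - a)%C by ring; unfold Cdiv; ring.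
  + intros H; apply Hw; replace w with (w + b - b)%C by ring; rewrite H, Hb; ring.
Qed.

Lemma near_neq (a b : C) : a <> b -> near a (fun w => w <> b).
Proof.
intros H; assert (Hn := Cminus_eq_contra _ _ H); exists (Cmod (a - b)); split.
- apply Cmod_gt_0, Hn.
- intros w Hw E; subst; rewrite Cmod_minus_sym in Hw; lra.
Qed.

Lemma regular_zeta_shift (a b : C) : (a + b)%C <> RtoC 1 ->
  near a (Cdiff (fun w => zeta (w + b)%C)).
Proof.
intros H; assert (H' : a <> (1 - b)%C) by (intros E; apply H; rewrite E; ring).
eapply filter_imp; [|apply (near_neq _ _ H')]; intros w Hw.
apply (Cdiff_shift zeta), Cdiff_zeta; intros E; apply Hw.
replace w with (w + b - b)%C by ring; rewrite E; reflexivity.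
Qed.

Lemma regular_remainder (q : nat) (a : C) : admissible q a ->
  near a (Cdiff (fun s => rising s (2 * q) *
    euler_weighted_strip q s)%C).
Proof.
intros H; destruct (kernel_euler (2 * q - 1)) as [M He].
destruct (admissible_open q a H) as [d [Hd0 Hd]]; exists d; split; [exact Hd0|]; intros w Hw.
destruct (admissible_bounds q w (Hd w Hw)) as [_ Hb].
apply Cdiff_mult; [apply Cdiff_rising|].
apply (Cdiff_shift (weighted_strip (-1) (euler_kernel q))), Cdiff_weighted_strip with M;
  [apply Rabs_m1_le|exact He|rewrite Re_add_R; lra].
Qed.

Lemma Cdiff_zeta_boole (q : nat) (s : C) : admissible q s -> ~ v_pole s -> Cdiff (zeta_boole q) s.
Proof.
intros H Hp; unfold zeta_boole; apply Cdiff_plus; [apply Cdiff_minus|].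
- apply (Cdiff_shift zeta), Cdiff_zeta; intros E; apply Hp; left.
  replace s with (s + 1 - 1)%C by ring; rewrite E; ring.
- apply (Cdiff_Csum (fun m s => RtoC (euler_coef (2 * m + 1)) *
    (rising s (2 * m + 1) * zeta (s + RtoC (INR (2 * m + 2)))))%C).
  intros m _; apply Cdiff_scal, Cdiff_mult; [apply Cdiff_rising|].
  apply (Cdiff_shift zeta), Cdiff_zeta; intros E; apply Hp; right; exists m.
  replace s with (s + RtoC (INR (2 * m + 2)) - RtoC (INR (2 * m + 2)))%C by ring.
  rewrite E, <- RtoC_minus; f_equal; rewrite !plus_INR; simpl (INR 2); simpl (INR 1); ring.
- apply (near_self _ _ (regular_remainder q s H)).
Qed.

Lemma Csum_single (n q : nat) (x : C) : (n < q)%nat ->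
  Csum (fun m => if Nat.eq_dec m n then x else RtoC 0) q = x.
Proof.
intros H; rewrite (Csum_zero_tail _ (S n)) by
  (first [lia|intros j Hj; destruct (Nat.eq_dec j n); [lia|reflexivity]]).
rewrite Csum_S; destruct (Nat.eq_dec n n); [|congruence].
rewrite (Csum_ext _ (fun _ => RtoC 0)).
- rewrite Csum_zero; ring.
- intros m Hm; destruct (Nat.eq_dec m n); [lia|reflexivity].
Qed.

(** Residue 0 is allowed for each zeta factor, so the same computation serves the pole at 0, where
    [r0] is the nonzero entry, and the poles at -(2n+1), where one [r m] is. *)
Lemma polar_part_zeta_boole (q : nat) (a r0 : C) (r : nat -> C) : admissible q a ->
  polar_part (fun s => zeta (s + 1)) a r0 ->
  (forall m, (m < q)%nat -> polar_part (fun s => zeta (s + RtoC (INR (2 * m + 2)))) a (r m)) ->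
  polar_part (zeta_boole q) a
    (r0 - Csum (fun m => RtoC (euler_coef (2 * m + 1)) * (rising a (2 * m + 1) * r m)) q)%C.
Proof.
intros H H0 Hm.
assert (P := polar_part_Csum _ _ a q (fun m Hq => polar_part_scal (RtoC (euler_coef (2 * m + 1))) _ _ _
  (polar_part_rising (2 * m + 1) _ _ _ (Hm m Hq)))).
assert (P2 := polar_part_plus _ _ _ _ _ (polar_part_plus _ _ _ _ _ H0 (polar_part_scal (-(1))%C _ _ _ P))
  (polar_part_regular _ _ (regular_remainder q a H))).
eapply polar_part_ext; [| |exact P2].
- apply filter_forall; intros w; unfold zeta_boole; ring.
- cbv beta; ring.
Qed.

Lemma polar_simple_pole (V f : C -> C) (a r : C) :
  near a (fun w => V w = (f w / 2)%C) -> polar_part f a r -> (r / 2)%C <> RtoC 0 ->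
  simple_pole_res V a (r / 2)%C.
Proof.
intros E P Hr; split; [exact Hr|].
destruct (polar_part_scal (/ 2)%C f a r P) as [h [H1 H2]]; exists h; split.
- apply locally_C_Cmod; destruct H1 as [d [Hd H1]]; exists d; split; [exact Hd|].
  intros w Hw; apply Cdiff_ex_derive, H1, Hw.
- apply locally_C_Cmod; destruct (filter_and _ _ E H2) as [d [Hd H]]; exists d; split; [exact Hd|].
  intros w Hw Hne; destruct (H w Hw) as [A B]; rewrite A; unfold Cdiv at 1 2.
  rewrite (Cmult_comm (f w)), B by exact Hne; unfold Cdiv; ring.
Qed.

(** The rising factorial kills the terms with m >= n, and zeta(-2(n - 1 - m)) = 0 those with m < n -
    1. The term m = n - 1 has zeta(0) = -1/2, and its factor -(2n)! (-1/2) / (2n-1)! equals n. *)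
Lemma zeta_boole_neg_even (n q : nat) : (1 <= n)%nat -> (n < q)%nat ->
  zeta_boole q (RtoC (- INR (2 * n))) =
  (zeta (RtoC (1 - INR (2 * n))) - RtoC (INR n * euler_poly (2 * n - 1) 0))%C.
Proof.
intros Hn Hq; unfold zeta_boole.
rewrite (rising_neg_0 (2 * n) (2 * q)) by lia; rewrite Cmult_0_l, Cplus_0_r.
rewrite (Csum_zero_tail _ n) by (try lia; intros j Hj; rewrite rising_neg_0 by lia; ring).
rewrite <- RtoC_plus; replace (- INR (2 * n) + 1) with (1 - INR (2 * n)) by ring.
f_equal; f_equal; destruct n as [|k]; [lia|]; rewrite Csum_S.
rewrite (Csum_ext _ (fun _ => RtoC 0)).
- rewrite Csum_zero, <- RtoC_plus.
  replace (- INR (2 * S k) + INR (2 * k + 2)) with 0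
    by (replace (2 * S k)%nat with (2 * k + 2)%nat by lia; ring).
  rewrite zeta_0, rising_neg by lia.
  replace (2 * S k - (2 * k + 1))%nat with 1%nat by lia.
  replace (2 * S k - 1)%nat with (2 * k + 1)%nat by lia.
  rewrite Cplus_0_l, <- !RtoC_mult; f_equal.
  rewrite <- euler_poly_coef_0, <- euler_poly_eq.
  replace ((-1) ^ (2 * k + 1)) with (-1)
    by (replace (2 * k + 1)%nat with (S (2 * k)) by lia; rewrite pow_1_odd; reflexivity).
  replace (2 * S k)%nat with (S (2 * k + 1)) by lia.
  rewrite fact_simpl, mult_INR.
  replace (INR (S (2 * k + 1))) with (2 * INR (S k))
    by (replace (S (2 * k + 1)) with (2 * S k)%nat by lia; rewrite mult_INR; reflexivity).
  replace (INR (fact 1)) with 1 by reflexivity; field; apply INR_fact_neq_0.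
- intros m Hm; rewrite <- RtoC_plus.
  replace (- INR (2 * S k) + INR (2 * m + 2)) with (- INR (2 * (k - m))).
  + rewrite zeta_neg_even by lia; ring.
  + replace (2 * S k)%nat with (2 * (k - m) + (2 * m + 2))%nat by lia; rewrite plus_INR; ring.
Qed.

Theorem theorem2 :
  (forall s : C, 0 < Re s -> ex_Cseries (fun k : nat => v_term s (S k))) /\
  (forall (s : C) (q : nat), 0 < Re s -> (0 < q)%nat ->
     1 + Rabs (Re s) < INR q ->
     remainder_converges q s /\ (RtoC 2 * v s)%C = continuation_rhs q s) /\
  exists V : C -> C,
    (forall s : C, 0 < Re s -> V s = v s) /\
    holomorphic_on (fun s : C => ~ v_pole s) V /\
    (forall (s : C) (q : nat), ~ v_pole s -> (0 < q)%nat ->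
       1 + Rabs (Re s) < INR q ->
       remainder_converges q s /\ (RtoC 2 * V s)%C = continuation_rhs q s) /\
    simple_pole_res V (RtoC 0) (RtoC (1 / 2)) /\
    (forall n : nat,
       simple_pole_res V (RtoC (- INR (2 * n + 1)))
         (RtoC (1 / 2 * euler_poly (2 * n + 1) 0))) /\
    (forall n : nat, (1 <= n)%nat ->
       (RtoC 2 * V (RtoC (- INR (2 * n))))%C =
       (zeta (RtoC (1 - INR (2 * n)))
        - RtoC (INR n * euler_poly (2 * n - 1) 0))%C).
Proof.
assert (Hv : forall s q, 0 < Re s -> admissible q s ->
  Clim (Csum (fun k => v_term s (S k))) (zeta_boole q s / 2)%C).
{ intros s q H0 H; destruct (admissible_bounds q s H); apply v_series; auto; lra. }
assert (Hrhs : forall s q, admissible q s ->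
  remainder_converges q s /\ continuation_rhs q s = zeta_boole q s).
{ intros s q H; destruct (admissible_bounds q s H); split.
  - apply remainder_facts; auto; lra.
  - apply continuation_rhs_eq; auto; lra. }
split; [|split].
- intros s Hs; destruct (admissible_exists s) as [q Hq].
  exists (zeta_boole q s / 2)%C; exact (proj2 (is_series_Csum _ _) (Hv s q Hs Hq)).
- intros s q Hs _ Hq; destruct (Hrhs s q Hq) as [H1 H2]; split; [exact H1|].
  unfold v; rewrite (Cseries_unique _ _ (Hv s q Hs Hq)), H2; field.
- destruct V_exists as [V [V1 V2]]; exists V.
  assert (Vnear : forall a q, admissible q a -> near a (fun w => V w = (zeta_boole q w / 2)%C)).
  { intros a q H; eapply filter_imp; [|exact (admissible_open q a H)]; intros w; apply V1. }
  split; [|split; [|split; [|split; [|split]]]].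
  + intros s Hs; destruct (admissible_exists s) as [q Hq].
    rewrite (V1 q s Hq); symmetry; apply Cseries_unique, Hv; assumption.
  + intros s Hs; apply Cdiff_ex_derive; destruct (admissible_exists s) as [q Hq].
    apply (V2 q s Hq); unfold Cdiv; apply Cdiff_mult; [|apply Cdiff_const].
    apply Cdiff_zeta_boole; assumption.
  + intros s q _ _ Hq; destruct (Hrhs s q Hq) as [H1 H2]; split; [exact H1|].
    rewrite (V1 q s Hq), H2; field.
  + destruct (admissible_exists (RtoC 0)) as [q Hq].
    (* Only zeta(s + 1) is singular here: the other arguments at s = 0 are 2m + 2 >= 2. *)
    assert (P := polar_part_zeta_boole q (RtoC 0) (RtoC 1) (fun _ => RtoC 0) Hq).
    replace (RtoC (1 / 2)) with (1 / 2)%C by (rewrite RtoC_div by lra; reflexivity).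
    apply polar_simple_pole with (zeta_boole q).
    * apply Vnear, Hq.
    * eapply polar_part_ext; [apply filter_forall; reflexivity| |apply P].
      -- rewrite (Csum_ext _ (fun _ => 0 * 0)%C) by (intros; ring); rewrite Csum_scal; ring.
      -- apply polar_part_zeta_shift; ring.
      -- intros m _; apply polar_part_regular, regular_zeta_shift.
         rewrite Cplus_0_l; intros E; apply RtoC_inj in E; rewrite plus_INR in E.
         generalize (pos_INR (2 * m)); simpl (INR 2) in E; lra.
    * intros E; rewrite <- RtoC_div in E by lra; apply RtoC_inj in E; lra.
  + intros n; set (a := RtoC (- INR (2 * n + 1))).
    destruct (admissible_exists a) as [q Hq].
    (* |Re a| = 2n + 1 < q - 1, so the singular term m = n does occur among the q terms. *)
    assert (Hnq : (n < q)%nat).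
    { unfold admissible, a in Hq; rewrite re_RtoC, Rabs_Ropp, Rabs_right in Hq
        by (apply Rle_ge, pos_INR).
      apply INR_lt; rewrite plus_INR, mult_INR in Hq; simpl (INR 2) in Hq; simpl (INR 1) in Hq.
      generalize (pos_INR n); lra. }
    (* Only zeta(s + 2n + 2) is singular at [a]; the minus sign in front of the sum cancels the one
       of the rising factorial -(2n+1)!. *)
    assert (P := polar_part_zeta_boole q a (RtoC 0)
      (fun m => if Nat.eq_dec m n then RtoC 1 else RtoC 0) Hq).
    replace (RtoC (1 / 2 * euler_poly (2 * n + 1) 0))
      with (RtoC (euler_poly (2 * n + 1) 0) / 2)%C
      by (rewrite <- RtoC_div by lra; f_equal; field).
    apply polar_simple_pole with (zeta_boole q).
    * apply Vnear, Hq.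
    * eapply polar_part_ext; [apply filter_forall; reflexivity| |apply P].
      -- rewrite (Csum_ext _ (fun m => if Nat.eq_dec m n
           then RtoC (euler_coef (2 * n + 1)) * rising a (2 * n + 1) else RtoC 0)%C).
         ++ rewrite Csum_single by exact Hnq; unfold a; rewrite rising_neg, Nat.sub_diag by lia.
            rewrite <- euler_poly_coef_0, <- euler_poly_eq.
            replace ((-1) ^ (2 * n + 1)) with (-1)
              by (replace (2 * n + 1)%nat with (S (2 * n)) by lia; rewrite pow_1_odd; reflexivity).
            rewrite <- RtoC_mult, <- RtoC_minus; f_equal; simpl (INR (fact 0)).
            field; apply INR_fact_neq_0.
         ++ intros m _; destruct (Nat.eq_dec m n) as [->|]; ring.
      -- apply polar_part_regular, regular_zeta_shift; unfold a; rewrite <- RtoC_plus.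
         intros E; apply RtoC_inj in E; rewrite plus_INR in E; simpl (INR 1) in E.
         generalize (pos_INR (2 * n)); lra.
      -- intros m _; destruct (Nat.eq_dec m n) as [->|Hm].
         ++ apply polar_part_zeta_shift; unfold a; rewrite <- RtoC_plus; f_equal.
            rewrite !plus_INR; simpl (INR 2); simpl (INR 1); ring.
         ++ apply polar_part_regular, regular_zeta_shift; unfold a; rewrite <- RtoC_plus.
            intros E; apply RtoC_inj in E; apply Hm.
            assert (E2 : INR (2 * m + 2) = INR (2 * n + 2))
              by (rewrite (plus_INR (2 * n)) in *; simpl (INR 2); simpl (INR 1) in E; lra).
            apply INR_eq in E2; lia.
    (* A simple pole requires a nonzero residue, hence E_(2n+1)(0) must not vanish. *)
    * intros E; rewrite <- RtoC_div in E by lra; apply RtoC_inj in E.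
      apply (euler_poly_odd_neq_0 n); lra.
  + intros n Hn; destruct (admissible_exists (RtoC (- INR (2 * n)))) as [q Hq].
    assert (Hnq : (n < q)%nat).
    { unfold admissible in Hq; rewrite re_RtoC, Rabs_Ropp, Rabs_right in Hq
        by (apply Rle_ge, pos_INR).
      apply INR_lt; rewrite mult_INR in Hq; simpl (INR 2) in Hq; generalize (pos_INR n); lra. }
    rewrite (V1 q _ Hq), zeta_boole_neg_even by assumption; field.
Qed.
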